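(* $\textsc{BNSL}^{\neq 0}$ is W[1]-hard when parameterized by the treecut width of the superstructure graph.
   Context: Let $V$ be a finite set and $\mathcal{F}=\{f_v:2^{V\setminus\{v\}}\to\mathbb{N}_0 : v\in V\}$. For a digraph $D=(V,A)$ let $P_D(v)=\{u:uv\in A\}$ and $\texttt{score}(D)=\sum_v f_v(P_D(v))$. BNSL: given $V$, $\mathcal{F}$ and an integer $\ell$, decide whether there is an acyclic digraph $D$ on $V$ with $\texttt{score}(D)\geq\ell$. In $\textsc{BNSL}^{\neq 0}$, $\mathcal{F}$ is given in the non-zero representation: for each $v$ the collection $\Gamma_f(v)=\{Z:f_v(Z)\neq 0\}$ with its values; input size $|V|+\ell+\sum_{v,P\in\Gamma_f(v)}|P|$. With $P_\to(v)=\bigcup_{Z\in\Gamma_f(v)}Z$, the superstructure graph $G=(V,E)$ has $ab\in E$ iff $a\in P_\to(b)$ or $b\in P_\to(a)$. Treecut width is the standard graph parameter of Wollan / Marx–Wollan defined via treecut decompositions. *)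

(* Defs.v *)
From mathcomp Require Import all_boot.
From mathcomp Require Import boolp.

Set Implicit Arguments.
Unset Strict Implicit.
Unset Printing Implicit Defensive.

(** * Unit-cost random access machines

   Structured programs over an unbounded memory of natural numbers, with
   indirect addressing, addition and truncated subtraction but no
   multiplication.  One step is charged per assignment and per test; the
   expressions of a fixed program have bounded size, and a value grows by O(1)
   bits per step, so running times agree with those of Turing machines up to a
   polynomial. *)

Definition memory := nat -> nat.

Inductive expr :=
| Const of nat
| Fetch of expr
| Add of expr & expr
| Sub of expr & expr.

Fixpoint eval (m : memory) (e : expr) : nat :=
  match e with
  | Const n => n
  | Fetch e1 => m (eval m e1)
  | Add e1 e2 => eval m e1 + eval m e2
  | Sub e1 e2 => eval m e1 - eval m e2
  end.

Inductive prog :=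
| Skip
| Store of expr & expr
| Seqn of prog & prog
| Ifnz of expr & prog & prog
| Whilenz of expr & prog.

Definition update (m : memory) (a x : nat) : memory :=
  fun b => if b == a then x else m b.

(* [exec c m t m']: started in memory [m], [c] halts in [m'] after [t] steps. *)
Inductive exec : prog -> memory -> nat -> memory -> Prop :=
| ExecSkip m : exec Skip m 1 m
| ExecStore a e m : exec (Store a e) m 1 (update m (eval m a) (eval m e))
| ExecSeqn c1 c2 m m1 m2 t1 t2 :
    exec c1 m t1 m1 -> exec c2 m1 t2 m2 -> exec (Seqn c1 c2) m (t1 + t2) m2
| ExecIfT e c1 c2 m m1 t :
    eval m e != 0 -> exec c1 m t m1 -> exec (Ifnz e c1 c2) m t.+1 m1
| ExecIfF e c1 c2 m m1 t :
    eval m e = 0 -> exec c2 m t m1 -> exec (Ifnz e c1 c2) m t.+1 m1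
| ExecWhileT e c m m1 m2 t1 t2 :
    eval m e != 0 -> exec c m t1 m1 -> exec (Whilenz e c) m1 t2 m2 ->
    exec (Whilenz e c) m (t1 + t2).+1 m2
| ExecWhileF e c m : eval m e = 0 -> exec (Whilenz e c) m 1 m.

(* A word is passed with its length in cell 0 and its [i]-th bit in cell
   [i + 1]. *)
Definition input_memory (w : seq bool) : memory :=
  fun a => if a is i.+1 then nat_of_bool (nth false w i) else size w.

Definition holds_output (m : memory) (w : seq bool) : Prop :=
  m 0 = size w /\ (forall i, i < size w -> m i.+1 = nat_of_bool (nth false w i)).

Definition runs_within (c : prog) (w w' : seq bool) (b : nat) : Prop :=
  exists t m, [/\ exec c (input_memory w) t m, holds_output m w' & t <= b].

Definition computable (f : nat -> nat) : Prop :=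
  exists c, forall n, exists b, runs_within c (nseq n true) (nseq (f n) true) b.

(** * Binary encodings

   Natural numbers are written in unary.  All codes are self-delimiting. *)

Definition enc_nat (n : nat) : seq bool := rcons (nseq n true) false.

Definition enc_pair S T (eS : S -> seq bool) (eT : T -> seq bool) (p : S * T) :=
  eS p.1 ++ eT p.2.

Definition enc_seq T (eT : T -> seq bool) (s : seq T) : seq bool :=
  enc_nat (size s) ++ flatten (map eT s).

Definition self_delimiting T (eT : T -> seq bool) : Prop :=
  forall x y u v, eT x ++ u = eT y ++ v -> x = y /\ u = v.

Lemma self_delimiting_inj T (eT : T -> seq bool) :
  self_delimiting eT -> injective eT.
Proof. by move=> sd x y e; case: (sd x y [::] [::]); rewrite ?cats0. Qed.

Lemma enc_nat_sd : self_delimiting enc_nat.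
Proof.
elim=> [|n IH] [|m] u v //=; first by case.
by case=> /IH[-> ->].
Qed.

Lemma enc_pair_sd S T (eS : S -> seq bool) (eT : T -> seq bool) :
  self_delimiting eS -> self_delimiting eT -> self_delimiting (enc_pair eS eT).
Proof.
move=> sS sT [a b] [c d] u v; rewrite /enc_pair /= -!catA.
by case/sS=> -> /sT[-> ->].
Qed.

Lemma enc_seq_sd T (eT : T -> seq bool) :
  self_delimiting eT -> self_delimiting (enc_seq eT).
Proof.
move=> sT s t u v; rewrite /enc_seq -!catA => /enc_nat_sd[].
elim: s t => [|x s IH] [|y t] //= [] est; rewrite -!catA => /sT[->].
by case/(IH _ est)=> -> ->.
Qed.

(** * Parameterized problems, fpt-reductions and the W-hierarchy *)

Record pproblem := PProblem {
  instance : Type;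
  encode : instance -> seq bool;
  encode_inj : injective encode;
  yes : instance -> Prop;
  param : instance -> nat
}.

Definition fpt_reducible (P Q : pproblem) : Prop :=
  exists (r : instance P -> instance Q) (c : prog) (f g : nat -> nat) (e : nat),
    [/\ computable f, computable g &
     forall x : instance P,
       [/\ yes x <-> yes (r x),
           param (r x) <= g (param x) &
           runs_within c (encode x) (encode (r x))
             (f (param x) * (size (encode x)).+1 ^ e)]].

(* Boolean circuits are lists of gates in topological order: a gate refers to
   its in-neighbours by their positions in the list, and the last gate is the
   output.  Each [Input] gate is a variable. *)
Inductive gate :=
| Input
| Neg of nat
| And of seq nat
| Or of seq nat.

Definition circuit := seq gate.

Definition fanin (g : gate) : seq nat :=
  match g with Input => [::] | Neg j => [:: j] | And s => s | Or s => s end.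

Definition is_input (g : gate) : bool := if g is Input then true else false.

Definition gate_ok (i : nat) (g : gate) : bool :=
  [&& all (fun j => j < i) (fanin g), uniq (fanin g) &
      match g with And s | Or s => 2 <= size s | _ => true end].

Definition circuit_ok (C : circuit) : bool :=
  (0 < size C) && [forall i : 'I_(size C), gate_ok i (nth Input C i)].

(* [F i g acc] is the value at gate [g] in position [i], given the list [acc] of
   the values at the previous positions. *)
Definition sweep T (F : nat -> gate -> seq T -> T) (C : circuit) : seq T :=
  foldl (fun acc g => rcons acc (F (size acc) g acc)) [::] C.

Definition circuit_value (a : nat -> bool) (C : circuit) : bool :=
  last false (sweep (fun i g acc =>
    match g with
    | Input => a i
    | Neg j => ~~ nth false acc j
    | And s => all (nth false acc) s
    | Or s => has (nth false acc) s
    end) C).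

(* The number of edges on a longest path from an input to the output. *)
Definition circuit_depth (C : circuit) : nat :=
  last 0 (sweep (fun _ g acc =>
    if is_input g then 0 else (\max_(j <- fanin g) nth 0 acc j).+1) C).

(* The largest number of gates of fan-in more than 2 on a path from an input to
   the output. *)
Definition circuit_weft (C : circuit) : nat :=
  last 0 (sweep (fun _ g acc =>
    (2 < size (fanin g)) + \max_(j <- fanin g) nth 0 acc j) C).

Definition weight (C : circuit) (a : nat -> bool) : nat :=
  \sum_(i < size C | is_input (nth Input C i)) a i.

Record wcs_instance (t d : nat) := WCSInstance {
  wcs_circuit : circuit;
  wcs_weight : nat;
  wcs_ok : [&& circuit_ok wcs_circuit, circuit_weft wcs_circuit <= t &
               circuit_depth wcs_circuit <= d]
}.

Definition wcs_yes t d (x : wcs_instance t d) : Prop :=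
  exists a : nat -> bool,
    weight (wcs_circuit x) a = wcs_weight x /\ circuit_value a (wcs_circuit x).

Definition gate_code (g : gate) : nat * seq nat :=
  (match g with Input => 0 | Neg _ => 1 | And _ => 2 | Or _ => 3 end, fanin g).

Definition wcs_encode t d (x : wcs_instance t d) : seq bool :=
  enc_pair enc_nat (enc_seq (enc_pair enc_nat (enc_seq enc_nat)))
    (wcs_weight x, map gate_code (wcs_circuit x)).

Lemma gate_code_inj : injective gate_code.
Proof. by case=> [|i|s|s] [|j|s'|s'] // [->]. Qed.

Lemma wcs_encode_inj t d : injective (@wcs_encode t d).
Proof.
move=> [C k okx] [C' k' oky]; rewrite /wcs_encode /= => eqc.
have inj : injective
    (enc_pair enc_nat (enc_seq (enc_pair enc_nat (enc_seq enc_nat)))).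
  apply/self_delimiting_inj/enc_pair_sd; first exact: enc_nat_sd.
  apply/enc_seq_sd/enc_pair_sd; first exact: enc_nat_sd.
  exact/enc_seq_sd/enc_nat_sd.
have [ek /(inj_map gate_code_inj) eC] := inj _ _ eqc.
clear eqc; subst.
by rewrite (bool_irrelevance okx oky).
Qed.

(* Weighted circuit satisfiability on circuits of weft at most [t] and depth at
   most [d], parameterized by the weight. *)
Definition WCS (t d : nat) : pproblem :=
  PProblem (@wcs_encode_inj t d) (@wcs_yes t d) (@wcs_weight t d).

Definition in_W (t : nat) (P : pproblem) : Prop :=
  exists d, fpt_reducible P (WCS t d).

Definition W_hard (t : nat) (Q : pproblem) : Prop :=
  forall P, in_W t P -> fpt_reducible P Q.

(** * Treecut width *)

Section Multigraphs.

Variable W : finType.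

(* [mult g x y] is the number of edges between [x] and [y], and [mult g x x] the
   number of loops at [x]; it is only meaningful on [verts g]. *)
Record multigraph := Multigraph {
  verts : {set W};
  mult : W -> W -> nat
}.

Definition degree (g : multigraph) (v : W) : nat :=
  (\sum_(u in verts g | u != v) mult g v u) + (mult g v v).*2.

(* For [v] of degree at most 2: delete [v] and, if its degree is 2, join its two
   neighbours by a new edge (a loop if both edges at [v] have the same other
   end). *)
Definition suppress (g : multigraph) (v : W) : multigraph :=
  Multigraph (verts g :\ v)
    (fun x y => mult g x y +
       (if x == y then mult g v x == 2
        else (mult g v x == 1) && (mult g v y == 1))).

Definition suppress_one (X : {set W}) (g : multigraph) : multigraph :=
  if [pick v | [&& v \in verts g, v \notin X & degree g v <= 2]] is Some v
  then suppress g v else g.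

(* Exhaustive suppression; the vertices that remain do not depend on the order
   of the suppressions. *)
Definition three_center (X : {set W}) (g : multigraph) : multigraph :=
  iter #|verts g| (suppress_one X) g.

End Multigraphs.

Definition is_tree (N : finType) (T : rel N) : Prop :=
  [/\ 0 < #|N|, symmetric T, irreflexive T, (forall x y, connect T x y) &
      forall s, ucycle T s -> size s <= 2].

Section TreecutDecompositions.

(* [G] is the edge relation of a simple graph.  A near-partition of its vertices
   indexed by the nodes of the tree [T] is given by the map [bag] that sends a
   vertex to the node whose part contains it. *)
Variables (V : finType) (G : rel V) (N : finType) (T : rel N) (bag : V -> N).

Definition del_edge (a b : N) : rel N :=
  [rel x y | T x y && ([set x; y] != [set a; b])].

Definition del_node (t : N) : rel N :=
  [rel x y | [&& T x y, x != t & y != t]].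

Definition side (a b : N) : {set N} := [set x | connect (del_edge a b) b x].

Definition adhesion (a b : N) : nat :=
  #|[set p : V * V | [&& G p.1 p.2, bag p.1 \in side a b
                       & bag p.2 \notin side a b]]|.

Definition component (t x : N) : {set N} := [set y | connect (del_node t) x y].

(* The vertices of the torso at [t] are those of the part of [t] (on the left)
   and one vertex for each component of [T - t] (on the right). *)
Definition consolidate (t : N) (v : V) : V + {set N} :=
  if bag v == t then inl v else inr (component t (bag v)).

Definition part (t : N) : {set V + {set N}} := [set inl v | v in V & bag v == t].

Definition torso (t : N) : multigraph (V + {set N})%type :=
  Multigraph (part t :|: [set inr (component t x) | x in N & x != t])
    (fun p q => if p == q then 0 else
       #|[set e : V * V | [&& G e.1 e.2, consolidate t e.1 == p
                            & consolidate t e.2 == q]]|).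

Definition torso_size (t : N) : nat :=
  #|verts (three_center (part t) (torso t))|.

Definition decomposition_width : nat :=
  maxn (\max_(e : N * N | T e.1 e.2) adhesion e.1 e.2) (\max_(t : N) torso_size t).

End TreecutDecompositions.

Definition has_treecut_decomposition (V : finType) (G : rel V) (k : nat) : Prop :=
  exists (N : finType) (T : rel N) (bag : V -> N),
    is_tree T /\ decomposition_width G T bag = k.

Lemma has_treecut_decomposition_ex (V : finType) (G : rel V) :
  exists k, `[< has_treecut_decomposition G k >].
Proof.
pose T := [rel _ _ : unit | false]; pose bag (_ : V) := tt.
exists (decomposition_width G T bag); apply/asboolP; exists unit, T, bag.
split=> //; split=> //; first by rewrite card_unit.
- by do 2!case; exact: connect0.
- by case=> [|x [|y s]].
Qed.

Definition treecut_width (V : finType) (G : rel V) : nat :=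
  ex_minn (has_treecut_decomposition_ex G).

(** * Bayesian network structure learning *)

Section BNSL.

(* The local score functions are extended to all subsets of [V]; the values
   [f v Z] with [v \in Z] are never used. *)
Variables (V : finType) (f : V -> {set V} -> nat).

Definition acyclic (D : rel V) : Prop := forall s, cycle D s -> s = [::].

Definition parents (D : rel V) (v : V) : {set V} := [set u | D u v].

Definition score (D : rel V) : nat := \sum_v f v (parents D v).

Definition Gamma (v : V) : {set {set V}} :=
  [set Z : {set V} | (v \notin Z) && (f v Z != 0)].

Definition potential_parents (v : V) : {set V} := \bigcup_(Z in Gamma v) Z.

Definition superstructure : rel V :=
  [rel a b | (a \in potential_parents b) || (b \in potential_parents a)].

End BNSL.

(* Non-zero representation: the vertices are the positions of [table], and the
   entry of [v] lists the pairs (Z, f_v(Z)) with f_v(Z) <> 0, the set [Z] being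
   given by its increasing enumeration. *)
Definition table := seq (seq (seq nat * nat)).

Definition table_ok (F : table) : bool :=
  [forall v : 'I_(size F), let L := nth [::] F v in
     uniq (unzip1 L) &&
     all (fun e => [&& sorted ltn e.1, all (fun u => u < size F) e.1,
                       (v : nat) \notin e.1 & e.2 != 0]) L].

(* At most one entry of the list of [v] contributes to the sum. *)
Definition local_score (F : table) (v : 'I_(size F)) (Z : {set 'I_(size F)}) :=
  \sum_(e <- nth [::] F v | [set u : 'I_(size F) | (u : nat) \in e.1] == Z) e.2.

Record bnsl_instance := BNSLInstance {
  bnsl_table : table;
  bnsl_goal : nat;
  bnsl_ok : table_ok bnsl_table
}.

Definition bnsl_yes (x : bnsl_instance) : Prop :=
  exists D : rel 'I_(size (bnsl_table x)),
    acyclic D /\ score (@local_score (bnsl_table x)) D >= bnsl_goal x.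

Definition bnsl_encode (x : bnsl_instance) : seq bool :=
  enc_pair enc_nat
    (enc_seq (enc_seq (enc_pair (enc_seq enc_nat) enc_nat)))
    (bnsl_goal x, bnsl_table x).

Lemma bnsl_encode_inj : injective bnsl_encode.
Proof.
move=> [F l okx] [F' l' oky]; rewrite /bnsl_encode /= => eqc.
have inj : injective (enc_pair enc_nat
    (enc_seq (enc_seq (enc_pair (enc_seq enc_nat) enc_nat)))).
  apply/self_delimiting_inj/enc_pair_sd; first exact: enc_nat_sd.
  apply/enc_seq_sd/enc_seq_sd/enc_pair_sd; last exact: enc_nat_sd.
  exact/enc_seq_sd/enc_nat_sd.
have [el eF] := inj _ _ eqc.
by clear eqc; subst; rewrite (bool_irrelevance okx oky).
Qed.

Definition superstructure_treecut_width (x : bnsl_instance) : nat :=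
  treecut_width (superstructure (@local_score (bnsl_table x))).

Definition BNSL_treecut : pproblem :=
  PProblem bnsl_encode_inj bnsl_yes superstructure_treecut_width.

(* Main.v *)
From mathcomp Require Import all_boot zify.
From mathcomp Require Import boolp.
Require Import Defs.

Set Implicit Arguments.
Unset Strict Implicit.
Unset Printing Implicit Defensive.

(** In a circuit of weft 1 and depth at most [d], gates of fan-in two combine the
    values of at most [2 ^ d] gates of large fan-in, whose in-neighbours depend on
    at most [2 ^ d] inputs each.  Write the [k] true inputs as an
    increasing sequence with sentinels at both ends: every input is an element of
    the sequence or lies in one of its gaps, so the value of an in-neighbour of a
    large gate is determined by boundedly many terms of the sequence.  One
    therefore takes a variable for every bounded tuple of indices; it guesses the
    corresponding terms together with a value and a witness for each large gate,
    and rejects what it can locally refute in Kleene's logic.  Pairwise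
    consistency of these [(k + 2) ^ O(1)] variables is equivalent to
    satisfiability by an assignment of weight [k].

    In the structure learning instance a variable is a core vertex whose parent
    sets are its options.  A pair of conflicting options [x] of [v] and [y] of
    [v'] gets vertices [e] and [e'], put into the parent sets of [x] and [y]
    respectively, with [{v, e'}] the only scoring parent set of [e] and
    [{v', e}] that of [e'].  At most one of them can score, and exactly one can
    if and only if [x] and [y] are not both chosen.  The superstructure graph is the
    core plus paths of two vertices attached to it by two edges, hence the star
    with the core in its centre is a treecut decomposition of width at most
    [max(|core|, 3)]. *)

(** * Running RAM programs *)

(** Hardness asks for a reduction from every problem in the class, so the program for weighted
    satisfiability must run on the memory that an unknown program leaves behind, arbitrary outside
    the output. Moreover the length of that output is not bounded by the running time: one step can
    double the length in cell 0, and unwritten cells read as zeros. Only the ones of an output can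
    be charged to the time. The composition works because the code of a circuit is at most linearly
    longer than its number of ones. Running times are polynomial by construction: every compiled
    loop runs up to one common bound, a fixed power of the input length, and shorter ranges are cut
    out by guards. The parameter limits the number of variables but not the number of their options.
    Hence tuples range over indices of the sequence of true inputs, while positions and witnesses,
    which depend on the size of the circuit, belong to the options. Claims are attached to paths
    from the output because there are boundedly many of them. Weft 1 forbids a large gate below
    another one, so the in-neighbours of a large gate can be evaluated without any claim. *)

Definition run (c : prog) (m : memory) (b : nat) (Q : memory -> Prop) : Prop :=
  exists t m', [/\ exec c m t m', Q m' & t <= b].

Lemma run_mono c m b b' (Q Q' : memory -> Prop) :
  b <= b' -> (forall m', Q m' -> Q' m') -> run c m b Q -> run c m b' Q'.
Proof.
by move=> le_b QQ' [t [m' [ex /QQ' q le_t]]]; exists t, m'; split=> //; lia.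
Qed.

Lemma run_skip m (Q : memory -> Prop) : Q m -> run Skip m 1 Q.
Proof. by move=> q; exists 1, m; split=> //; constructor. Qed.

Lemma run_store a e m (Q : memory -> Prop) :
  Q (update m (eval m a) (eval m e)) -> run (Store a e) m 1 Q.
Proof. by move=> q; do 2!eexists; split; [constructor | exact: q |]. Qed.

Lemma run_seq c1 c2 m b1 b2 Q :
  run c1 m b1 (fun m1 => run c2 m1 b2 Q) -> run (Seqn c1 c2) m (b1 + b2) Q.
Proof.
move=> [t1 [m1 [ex1 [t2 [m2 [ex2 q le2]]] le1]]].
by exists (t1 + t2), m2; split=> //; [apply: ExecSeqn ex1 ex2 | lia].
Qed.

Lemma run_if e c1 c2 m b Q :
  (eval m e != 0 -> run c1 m b Q) -> (eval m e = 0 -> run c2 m b Q) ->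
  run (Ifnz e c1 c2) m b.+1 Q.
Proof.
move=> r1 r2; case: (eqVneq (eval m e) 0) => [e0 | eN0].
- by have [t [m' [ex q le]]] := r2 e0; exists t.+1, m'; split=> //; exact: ExecIfF.
- by have [t [m' [ex q le]]] := r1 eN0; exists t.+1, m'; split=> //; exact: ExecIfT.
Qed.

Lemma run_while e c (Inv : nat -> memory -> Prop) n b :
  (forall i m, i < n -> Inv i m -> eval m e != 0) ->
  (forall m, Inv n m -> eval m e = 0) ->
  (forall i m, i < n -> Inv i m -> run c m b (Inv i.+1)) ->
  forall m, Inv 0 m -> run (Whilenz e c) m (n * b.+1).+1 (Inv n).
Proof.
move=> eT eF body m Im.
suff loop : forall j i m', i + j = n -> Inv i m' ->
    run (Whilenz e c) m' (j * b.+1).+1 (Inv n) by exact: (loop n 0).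
elim=> [|j IHj] i m' eqn Im'.
  move: Im'; have -> : i = n by lia.
  by move=> Im'; exists 1, m'; split=> //; apply: ExecWhileF; exact: eF.
have lt_in : i < n by lia.
have [t1 [m1 [ex1 I1 le1]]] := body i m' lt_in Im'.
have [|t2 [m2 [ex2 I2 le2]]] := IHj i.+1 m1 _ I1; first by lia.
exists (t1 + t2).+1, m2; split=> //; last by lia.
by apply: ExecWhileT ex1 ex2; exact: (eT i).
Qed.

(** * Polynomial bounds *)

Definition poly_bounded (T : nat -> nat) : Prop :=
  exists C q, forall n, T n <= C * n.+1 ^ q.

Lemma poly_bounded_const c : poly_bounded (fun _ => c).
Proof. by exists c, 0 => n; rewrite expn0 muln1. Qed.

Lemma poly_bounded_id : poly_bounded (fun n => n).
Proof. by exists 1, 1 => n; rewrite expn1; lia. Qed.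

Lemma poly_boundedD T1 T2 :
  poly_bounded T1 -> poly_bounded T2 -> poly_bounded (fun n => T1 n + T2 n).
Proof.
move=> [C1 [q1 le1]] [C2 [q2 le2]]; exists (C1 + C2), (q1 + q2) => n.
have := le1 n; have := le2 n; rewrite expnD.
have : 0 < n.+1 ^ q1 by rewrite expn_gt0.
have : 0 < n.+1 ^ q2 by rewrite expn_gt0.
by move: (T1 n) (T2 n) (n.+1 ^ q1) (n.+1 ^ q2) => a b x y; nia.
Qed.

Lemma poly_boundedM T1 T2 :
  poly_bounded T1 -> poly_bounded T2 -> poly_bounded (fun n => T1 n * T2 n).
Proof.
move=> [C1 [q1 le1]] [C2 [q2 le2]]; exists (C1 * C2), (q1 + q2) => n.
by rewrite expnD mulnACA; exact: leq_mul.
Qed.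

Lemma poly_boundedS T : poly_bounded T -> poly_bounded (fun n => (T n).+1).
Proof.
move=> pT; have [C [q le]] := poly_boundedD pT (poly_bounded_const 1).
by exists C, q => n; have := le n; lia.
Qed.

Lemma poly_boundedX T e : poly_bounded T -> poly_bounded (fun n => T n ^ e).
Proof.
move=> pT; elim: e => [|e IHe]; first exact: poly_bounded_const.
have [C [q le]] := poly_boundedM pT IHe.
by exists C, q => n; rewrite expnS.
Qed.

Create HintDb polyb.
#[global] Hint Resolve poly_bounded_const poly_bounded_id poly_boundedD
  poly_boundedM poly_boundedS poly_boundedX : polyb.

(** * Functions computed by programs whose loops have a common bound *)

(* Cell [3 r] is register [r], cell [3 i + 4] holds input bit [i] plus one, and
   cell [3 j + 2] holds output bit [j] plus one.  Registers 0, 1 and 2 hold the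
   input length, the common loop bound and the output length. *)
Definition reg (r : nat) : nat := 3 * r.

Definition ready (w : seq bool) (B : nat) (m : memory) : Prop :=
  [/\ m (reg 0) = size w, m (reg 1) = B &
      forall i, i < size w -> m (3 * i + 4) = (nth false w i).+1].

Definition written (o : seq bool) (m : memory) : Prop :=
  m (reg 2) = size o /\
  forall i, i < size o -> m (3 * i + 2) = (nth false o i).+1.

(** Residues modulo 3 of the addresses separate registers, input and output. Registers are allocated
    as on a stack: code that returns its result in register [r] may destroy the registers from [r]
    on, and nothing else. *)
Definition keeps (r : nat) (m m' : memory) : Prop :=
  [/\ forall j, j < r -> m' (3 * j) = m (3 * j),
      forall j, m' (3 * j + 1) = m (3 * j + 1) &
      forall j, m' (3 * j + 2) = m (3 * j + 2)].

Definition keeps_but_output (r : nat) (m m' : memory) : Prop :=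
  (forall j, j < r -> j != 2 -> m' (3 * j) = m (3 * j)) /\
  (forall j, m' (3 * j + 1) = m (3 * j + 1)).

Lemma keeps_trans r m1 m2 m3 :
  keeps r m1 m2 -> keeps r m2 m3 -> keeps r m1 m3.
Proof.
move=> [a1 b1 c1] [a2 b2 c2]; split=> [j lt_jr|j|j].
- by rewrite a2 ?a1.
- by rewrite b2 b1.
- by rewrite c2 c1.
Qed.

Lemma keepsW r r' m m' : r <= r' -> keeps r' m m' -> keeps r m m'.
Proof. by move=> le_r [a b c]; split=> // j lt_jr; apply: a; lia. Qed.

Lemma keeps_reg r m m' j : keeps r m m' -> j < r -> m' (reg j) = m (reg j).
Proof. by case=> a _ _; exact: a. Qed.

Lemma keeps_update r m j x : r <= j -> keeps r m (update m (reg j) x).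
Proof.
by move=> le_rj; split=> [i lt_ir|i|i]; rewrite /update /reg; case: eqP; lia.
Qed.

Lemma keeps_ready r m m' w B :
  2 <= r -> keeps r m m' -> ready w B m -> ready w B m'.
Proof.
move=> le_2r [a b c] [m0 m1 mi]; split=> [||i lt_i].
- by rewrite -m0; apply: (a 0); lia.
- by rewrite -m1; exact: (a 1).
- rewrite -(mi i lt_i); have -> : 3 * i + 4 = 3 * i.+1 + 1 by lia.
  exact: b.
Qed.

Lemma keeps_written r m m' o :
  2 < r -> keeps r m m' -> written o m -> written o m'.
Proof.
move=> lt_2r [a b c] [m2 mo]; split=> [|i lt_i]; first by rewrite -m2; exact: a.
by rewrite c mo.
Qed.

Lemma keeps_forget_output r m m' : keeps r m m' -> keeps_but_output r m m'.
Proof. by case=> a b c; split=> // j lt_jr _; exact: a. Qed.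

Lemma keeps_but_output_trans r m1 m2 m3 :
  keeps_but_output r m1 m2 -> keeps_but_output r m2 m3 ->
  keeps_but_output r m1 m3.
Proof.
move=> [a1 b1] [a2 b2]; split=> [j lt_jr jN2|j]; first by rewrite a2 ?a1.
by rewrite b2 b1.
Qed.

Lemma keeps_but_outputW r r' m m' :
  r <= r' -> keeps_but_output r' m m' -> keeps_but_output r m m'.
Proof. by move=> le_r [a b]; split=> // j lt_jr; apply: a; lia. Qed.

Lemma keeps_but_output_ready r m m' w B :
  2 <= r -> keeps_but_output r m m' -> ready w B m -> ready w B m'.
Proof.
move=> le_2r [a b] [m0 m1 mi]; split=> [||i lt_i].
- by rewrite -m0; apply: (a 0) => //; lia.
- by rewrite -m1; exact: (a 1).
- rewrite -(mi i lt_i); have -> : 3 * i + 4 = 3 * i.+1 + 1 by lia.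
  exact: b.
Qed.

Definition regs (m : memory) (rho : seq nat) : seq nat :=
  [seq m (reg j) | j <- rho].

Lemma keeps_regs r m m' rho :
  keeps r m m' -> all (fun j => j < r) rho -> regs m' rho = regs m rho.
Proof.
by move=> k /allP lt_r; apply/eq_in_map => j /lt_r; exact: keeps_reg.
Qed.

Lemma keeps_but_output_regs r m m' rho :
  keeps_but_output r m m' -> all (fun j => 2 < j < r) rho ->
  regs m' rho = regs m rho.
Proof.
move=> [a _] /allP lt_r; apply/eq_in_map => j /lt_r /andP[lt2 ltr].
by apply: a => //; lia.
Qed.

Definition rget (r : nat) : expr := Fetch (Const (reg r)).
Definition rset (r : nat) (e : expr) : prog := Store (Const (reg r)) e.

Section Compilable.

(* All lengths and values that occur are at most [B] once [B] exceeds a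
   polynomial of degree [E.+1] in the input length. *)
Variable E : nat.

Definition valid (w : seq bool) (B : nat) (e : seq nat) : Prop :=
  (size w).+2 ^ E.+1 <= B /\ all (fun x => x <= B) e.

Definition func := seq bool -> nat -> seq nat -> nat.

(* The environment [e] of [F] is passed in the registers [rho]; the result is
   returned in register [r], and lower registers are preserved. *)
Definition compilable (F : func) : Prop :=
  forall rho r, 2 < r -> all (fun j => 2 < j < r) rho ->
  exists c T, poly_bounded T /\
    forall w B m, ready w B m -> valid w B (regs m rho) ->
    run c m (T B) (fun m' => keeps r m m' /\ m' (reg r) = F w B (regs m rho)).

Definition bounded (F : func) : Prop :=
  forall w B e, valid w B e -> F w B e <= B.

(** Environments are de Bruijn stacks: a loop pushes its index at the head, and [shift] weakens a
    function of the outer environment to the body of the loop. *)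
Definition shift (F : func) : func := fun w B e => F w B (behead e).

Lemma valid_size w B e : valid w B e -> (size w).+2 <= B.
Proof.
move=> [le _]; apply: leq_trans le; rewrite expnS.
by rewrite leq_pmulr // expn_gt0.
Qed.

Lemma valid_cons w B i e : i <= B -> valid w B e -> valid w B (i :: e).
Proof. by move=> le_i [v1 v2]; split=> //=; rewrite le_i. Qed.

Lemma valid_behead w B e : valid w B e -> valid w B (behead e).
Proof. by case=> v1; case: e => //= x e /andP[_ v2]. Qed.

Lemma bounded_shift F : bounded F -> bounded (shift F).
Proof. by move=> bF w B e /valid_behead; exact: bF. Qed.

Lemma bounded_head : bounded (fun w B e => head 0 e).
Proof. by move=> w B [|x e] [_] //= /andP[]. Qed.

Lemma all_lt_wider r r' (rho : seq nat) : r <= r' ->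
  all (fun j => 2 < j < r) rho -> all (fun j => 2 < j < r') rho.
Proof. by move=> le_r; apply: sub_all => j /=; lia. Qed.

Lemma all_lt_keep r (rho : seq nat) :
  all (fun j => 2 < j < r) rho -> all (fun j => j < r) rho.
Proof. by apply: sub_all => j /andP[]. Qed.

Lemma compilable_ext F G :
  (forall w B e, valid w B e -> F w B e = G w B e) ->
  compilable F -> compilable G.
Proof.
move=> eFG cF rho r lt_r lt_rho; have [c [T [pT spec]]] := cF rho r lt_r lt_rho.
exists c, T; split=> // w B m rd vd; apply: run_mono (spec w B m rd vd) => // m'.
by rewrite eFG.
Qed.

Lemma compilable_direct (e : seq nat -> nat -> expr) (F : func) :
  (forall rho r w B m, ready w B m -> valid w B (regs m rho) ->
     eval m (e rho r) = F w B (regs m rho)) ->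
  compilable F.
Proof.
move=> eF rho r lt_r lt_rho; exists (rset r (e rho r)), (fun _ => 1).
split; first exact: poly_bounded_const.
move=> w B m rd vd; apply: run_store; split; first exact: keeps_update.
by rewrite /= /update eqxx; exact: eF.
Qed.

Lemma compilable_const n : compilable (fun _ _ _ => n).
Proof. exact: (@compilable_direct (fun _ _ => Const n)). Qed.

Lemma compilable_size : compilable (fun w _ _ => size w).
Proof.
by apply: (@compilable_direct (fun _ _ => rget 0)) => rho r w B m [].
Qed.

Lemma compilable_head : compilable (fun _ _ e => head 0 e).
Proof.
apply: (@compilable_direct
  (fun rho _ => if rho is j :: _ then rget j else Const 0)).
by case.
Qed.

Lemma compilable_shift F : compilable F -> compilable (shift F).
Proof.
move=> cF rho r lt_r lt_rho.
have lt_rho' : all (fun j => 2 < j < r) (behead rho).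
  by case: rho lt_rho => //= j rho /andP[].
have [c [T [pT spec]]] := cF (behead rho) r lt_r lt_rho'.
have eq_regs m : regs m (behead rho) = behead (regs m rho).
  by rewrite /regs behead_map.
exists c, T; split=> // w B m rd vd; rewrite /shift -eq_regs; apply: spec => //.
by rewrite eq_regs; exact: valid_behead.
Qed.

Lemma compilable_binary (F G : func) (op : nat -> nat -> nat)
    (eop : expr -> expr -> expr) :
  (forall m e1 e2, eval m (eop e1 e2) = op (eval m e1) (eval m e2)) ->
  compilable F -> compilable G ->
  compilable (fun w B e => op (F w B e) (G w B e)).
Proof.
move=> eval_op cF cG rho r lt_r lt_rho.
have [c [T [pT spec]]] := cF rho r lt_r lt_rho.
have [||c' [T' [pT' spec']]] := cG rho r.+1.
- by lia.
- exact: all_lt_wider lt_rho.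
exists (Seqn c (Seqn c' (rset r (eop (rget r) (rget r.+1))))).
exists (fun B => T B + (T' B + 1)); split; first by auto with polyb.
move=> w B m rd vd; apply: run_seq.
apply: run_mono (spec w B m rd vd) => // m1 [k1 v1].
have eq1 : regs m1 rho = regs m rho.
  exact: keeps_regs k1 (all_lt_keep lt_rho).
have rd1 : ready w B m1 by apply: keeps_ready rd; first exact: ltnW lt_r.
apply: run_seq.
have := spec' w B m1 rd1; rewrite eq1 => /(_ vd); apply: run_mono => // m2 [k2 v2].
apply: run_store; split.
  apply: keeps_trans k1 _; apply: keeps_trans (keepsW (leqnSn r) k2) _.
  exact: keeps_update.
rewrite /= /update eqxx eval_op /= v2; congr (op _ _).
by rewrite (keeps_reg k2).
Qed.

Lemma compilableD F G : compilable F -> compilable G ->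
  compilable (fun w B e => F w B e + G w B e).
Proof. exact: (@compilable_binary F G addn Add). Qed.

Lemma compilableB F G : compilable F -> compilable G ->
  compilable (fun w B e => F w B e - G w B e).
Proof. exact: (@compilable_binary F G subn Sub). Qed.

Lemma compilable_bit F : compilable F ->
  compilable (fun w B e => nat_of_bool (nth false w (F w B e))).
Proof.
move=> cF rho r lt_r lt_rho.
have [c [T [pT spec]]] := cF rho r lt_r lt_rho.
pose cell := Fetch (Add (Add (rget r) (Add (rget r) (rget r))) (Const 4)).
(* Cells past the input hold arbitrary values, so the position is compared with the length before
   the cell is read. *)
exists (Seqn c (Ifnz (Sub (rget 0) (rget r))
                     (rset r (Sub cell (Const 1))) (rset r (Const 0)))).
exists (fun B => T B + 2); split; first by auto with polyb.
move=> w B m rd vd; apply: run_seq.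
apply: run_mono (spec w B m rd vd) => // m1 [k1 v1].
have [m0 _ mi] : ready w B m1 by apply: keeps_ready rd; first exact: ltnW lt_r.
apply: run_if => /=; rewrite m0 v1 => test; apply: run_store.
all: split; first by apply: keeps_trans k1 _; exact: keeps_update.
all: rewrite /= /update eqxx /=.
- rewrite v1; set i := F w B _ in test *.
  have -> : i + (i + i) + 4 = 3 * i + 4 by lia.
  by rewrite mi ?subn1 //; lia.
- by rewrite nth_default //; lia.
Qed.

Lemma compilable_if F G H : compilable F -> compilable G -> compilable H ->
  compilable (fun w B e => if F w B e != 0 then G w B e else H w B e).
Proof.
move=> cF cG cH rho r lt_r lt_rho.
have [c [T [pT spec]]] := cF rho r lt_r lt_rho.
have [c1 [T1 [pT1 spec1]]] := cG rho r lt_r lt_rho.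
have [c2 [T2 [pT2 spec2]]] := cH rho r lt_r lt_rho.
exists (Seqn c (Ifnz (rget r) c1 c2)), (fun B => T B + (T1 B + T2 B).+1).
split; first by auto with polyb.
move=> w B m rd vd; apply: run_seq.
apply: run_mono (spec w B m rd vd) => // m1 [k1 v1].
have eq1 : regs m1 rho = regs m rho.
  exact: keeps_regs k1 (all_lt_keep lt_rho).
have rd1 : ready w B m1 by apply: keeps_ready rd; first exact: ltnW lt_r.
apply: run_if => /=; rewrite v1 => test.
- rewrite test; have := spec1 w B m1 rd1; rewrite eq1 => /(_ vd).
  apply: run_mono => [|m2 [k2 v2]]; first exact: leq_addr.
  by split=> //; exact: keeps_trans k1 k2.
- rewrite test eqxx; have := spec2 w B m1 rd1; rewrite eq1 => /(_ vd).
  apply: run_mono => [|m2 [k2 v2]]; first exact: leq_addl.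
  by split=> //; exact: keeps_trans k1 k2.
Qed.

(** The number of rounds is always the common bound in register 1, so the time is polynomial in it
    as soon as that of the body is. The body has to leave the counter [r] unchanged. *)
Definition for_loop (r : nat) (c : prog) : prog :=
  Seqn (rset r (Const 0))
    (Whilenz (Sub (rget 1) (rget r)) (Seqn c (rset r (Add (rget r) (Const 1))))).

Lemma run_for_loop (Inv : nat -> memory -> Prop) B r c b m :
  (forall i m', Inv i m' -> m' (reg 1) = B) ->
  Inv 0 (update m (reg r) 0) ->
  (forall i m', i < B -> Inv i m' -> m' (reg r) = i ->
     run c m' b (fun m'' => m'' (reg r) = i /\
                            Inv i.+1 (update m'' (reg r) i.+1))) ->
  run (for_loop r c) m (1 + (B * b.+2).+1) (Inv B).
Proof.
move=> IB I0 body; apply: run_seq; apply: run_store => /=.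
pose Inv' i m' := Inv i m' /\ m' (reg r) = i.
have := @run_while (Sub (rget 1) (rget r))
  (Seqn c (rset r (Add (rget r) (Const 1)))) Inv' B b.+1.
move=> /(_ _ _ _ (update m (reg r) 0)) loop.
apply: run_mono (loop _ _ _ _) => //=; clear loop.
- by move=> m' [].
- by move=> i m' lt_i [/IB -> ->]; lia.
- by move=> m' [/IB -> ->]; lia.
- move=> i m' lt_i [Im' ri].
  rewrite -(addn1 b); apply: run_seq; apply: run_mono (body i m' lt_i Im' ri) => //.
  move=> m'' [ri' I'']; apply: run_store; rewrite /= ri' addn1; split=> //.
  by rewrite /update eqxx.
- by split=> //; rewrite /update eqxx.
Qed.

Lemma compilable_sum F : compilable F ->
  compilable (fun w B e => \sum_(0 <= i < B) F w B (i :: e)).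
Proof.
move=> cF rho r lt_r lt_rho.
have [||c [T [pT spec]]] := cF (r.+1 :: rho) r.+2.
- by lia.
- by rewrite /= (@all_lt_wider r) //; lia.
(* Register [r] accumulates, [r.+1] counts, and the body returns its value in [r.+2]. *)
exists (Seqn (rset r (Const 0))
  (for_loop r.+1 (Seqn c (rset r (Add (rget r) (rget r.+2)))))).
exists (fun B => 1 + (1 + (B * (T B + 1).+2).+1)).
split; first by auto 10 with polyb.
move=> w B m rd vd.
pose Inv i m' := keeps r m m' /\ m' (reg r) = \sum_(0 <= j < i) F w B (j :: regs m rho).
apply: run_seq; apply: run_store => /=.
apply: (run_for_loop (Inv := Inv)).
- move=> i m' [k _]; rewrite (keeps_reg k) ?(ltnW lt_r) //; by case: rd.
- split; first by apply: (@keeps_trans _ _ (update m (reg r) 0));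
    apply: keeps_update.
  by rewrite big_geq // /update /reg; do !case: eqP => //=; lia.
- move=> i m' lt_i [k' v'] ri.
  have rd' : ready w B m' by apply: keeps_ready rd; first exact: ltnW lt_r.
  have eq' : regs m' (r.+1 :: rho) = i :: regs m rho.
    by rewrite /= ri (keeps_regs k') // all_lt_keep.
  apply: run_seq; have := spec w B m' rd'; rewrite eq'.
  have vd' : valid w B (i :: regs m rho) by apply: valid_cons vd; exact: ltnW.
  move=> /(_ vd'); apply: run_mono => // m'' [k'' v''].
  apply: run_store => /=; split.
    rewrite /update; case: eqP => [|_]; first by rewrite /reg; lia.
    by rewrite (keeps_reg k'').
  split.
    apply: keeps_trans k' _; apply: (@keeps_trans _ _ m'').
      by apply: keepsW k''; lia.
    by apply: (@keeps_trans _ _ (update m'' (reg r)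
      (m'' (reg r) + m'' (reg r.+2)))); apply: keeps_update.
  rewrite /update; case: eqP => [|_]; first by rewrite /reg; lia.
  by rewrite eqxx v'' (keeps_reg k'') // v' big_nat_recr.
Qed.

(** The accumulator belongs to the environment of the body, so it must stay at most [B] in every
    round for [valid] to hold. In a sum the body does not see the accumulator. *)
Lemma compilable_iteri F G : compilable F -> compilable G -> bounded G ->
  (forall w B i a e, valid w B (i :: a :: e) -> F w B (i :: a :: e) <= B) ->
  compilable
    (fun w B e => iteri B (fun i a => F w B (i :: a :: e)) (G w B e)).
Proof.
move=> cF cG bG bF rho r lt_r lt_rho.
have [c0 [T0 [pT0 spec0]]] := cG rho r lt_r lt_rho.
have [||c [T [pT spec]]] := cF (r.+1 :: r :: rho) r.+2.
- by lia.
- by rewrite /= (@all_lt_wider r) //; lia.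
exists (Seqn c0 (for_loop r.+1 (Seqn c (rset r (rget r.+2))))).
exists (fun B => T0 B + (1 + (B * (T B + 1).+2).+1)).
split; first by auto 10 with polyb.
move=> w B m rd vd.
pose f i a := F w B (i :: a :: regs m rho).
pose Inv i m' := [/\ keeps r m m', m' (reg r) = iteri i f (G w B (regs m rho)) &
                     m' (reg r) <= B].
apply: run_seq; apply: run_mono (spec0 w B m rd vd) => // m1 [k1 v1].
apply: (run_mono (leqnn _) (Q := Inv B)) => [m' []//|].
apply: (run_for_loop (Inv := Inv)).
- move=> i m' [k _ _]; rewrite (keeps_reg k) ?(ltnW lt_r) //; by case: rd.
- have upd : update m1 (reg r.+1) 0 (reg r) = m1 (reg r).
    by rewrite /update /reg; case: eqP => //; lia.
  split; rewrite ?upd //; first by apply: keeps_trans k1 _; exact: keeps_update.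
  by rewrite v1; exact: bG.
- move=> i m' lt_i [k' v' le'] ri.
  have rd' : ready w B m' by apply: keeps_ready rd; first exact: ltnW lt_r.
  have eq' : regs m' (r.+1 :: r :: rho) = [:: i, m' (reg r) & regs m rho].
    by rewrite /= ri (keeps_regs k') // all_lt_keep.
  have vd' : valid w B [:: i, m' (reg r) & regs m rho].
    by apply: valid_cons; [exact: ltnW | exact: valid_cons].
  apply: run_seq; have := spec w B m' rd'; rewrite eq' => /(_ vd').
  apply: run_mono => // m'' [k'' v''].
  have upd : update (update m'' (reg r) (m'' (reg r.+2))) (reg r.+1) i.+1 (reg r)
      = m'' (reg r.+2).
    rewrite /update; case: eqP => [|_]; first by rewrite /reg; lia.
    by rewrite eqxx.
  apply: run_store => /=; split.
    rewrite /update; case: eqP => [|_]; first by rewrite /reg; lia.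
    by rewrite (keeps_reg k'').
  split.
  + apply: keeps_trans k' _; apply: (@keeps_trans _ _ m'').
      by apply: keepsW k''; lia.
    by apply: (@keeps_trans _ _ (update m'' (reg r) (m'' (reg r.+2))));
      apply: keeps_update.
  + by rewrite upd v'' v'.
  + by rewrite upd v''; exact: bF.
Qed.

End Compilable.

(** * Tests, arithmetic and bounded quantifiers *)

Section DerivedCompilable.

Variable E : nat.

Local Notation compilable := (compilable E).
Local Notation bounded := (bounded E).

Definition compilableb (b : seq bool -> nat -> seq nat -> bool) : Prop :=
  compilable (fun w B e => nat_of_bool (b w B e)).

Lemma compilable_ifb b G H : compilableb b -> compilable G -> compilable H ->
  compilable (fun w B e => if b w B e then G w B e else H w B e).
Proof.
move=> cb cG cH; apply: compilable_ext (compilable_if cb cG cH) => w B e _.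
by case: (b w B e).
Qed.

Lemma compilableb_if b c1 c2 : compilableb b -> compilableb c1 ->
  compilableb c2 ->
  compilableb (fun w B e => if b w B e then c1 w B e else c2 w B e).
Proof.
move=> cb c1P c2P; apply: compilable_ext (compilable_ifb cb c1P c2P) => w B e _.
by case: (b w B e).
Qed.

Lemma compilable_lt F G : compilable F -> compilable G ->
  compilableb (fun w B e => F w B e < G w B e).
Proof.
move=> cF cG; apply: compilable_ext (compilable_if (compilableB cG cF)
  (compilable_const _ 1) (compilable_const _ 0)) => w B e _.
by rewrite subn_eq0 -ltnNge; case: ltnP.
Qed.

Lemma compilableN b : compilableb b -> compilableb (fun w B e => ~~ b w B e).
Proof.
move=> cb; apply: compilable_ext (compilableB (compilable_const _ 1) cb).
by move=> w B e _; case: (b w B e).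
Qed.

Lemma compilable_le F G : compilable F -> compilable G ->
  compilableb (fun w B e => F w B e <= G w B e).
Proof.
move=> cF cG; apply: compilable_ext (compilableN (compilable_lt cG cF)).
by move=> w B e _; rewrite -leqNgt.
Qed.

Lemma compilable_and b1 b2 : compilableb b1 -> compilableb b2 ->
  compilableb (fun w B e => b1 w B e && b2 w B e).
Proof.
move=> c1 c2; apply: compilable_ext (compilable_ifb c1 c2 (compilable_const _ 0)).
by move=> w B e _; case: (b1 w B e).
Qed.

Lemma compilable_or b1 b2 : compilableb b1 -> compilableb b2 ->
  compilableb (fun w B e => b1 w B e || b2 w B e).
Proof.
move=> c1 c2; apply: compilable_ext (compilable_ifb c1 (compilable_const _ 1) c2).
by move=> w B e _; case: (b1 w B e).
Qed.

Lemma compilable_imply b1 b2 : compilableb b1 -> compilableb b2 ->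
  compilableb (fun w B e => b1 w B e ==> b2 w B e).
Proof.
move=> c1 c2; apply: compilable_ext (compilable_ifb c1 c2 (compilable_const _ 1)).
by move=> w B e _; case: (b1 w B e).
Qed.

Lemma compilable_eq F G : compilable F -> compilable G ->
  compilableb (fun w B e => F w B e == G w B e).
Proof.
move=> cF cG; apply: compilable_ext
  (compilable_and (compilable_le cF cG) (compilable_le cG cF)).
by move=> w B e _; rewrite eqn_leq.
Qed.

Lemma compilableS F : compilable F -> compilable (fun w B e => (F w B e).+1).
Proof.
move=> cF; apply: compilable_ext (compilableD cF (compilable_const _ 1)).
by move=> w B e _; rewrite addn1.
Qed.

Lemma compilable_pred F : compilable F -> compilable (fun w B e => (F w B e).-1).
Proof.
move=> cF; apply: compilable_ext (compilableB cF (compilable_const _ 1)).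
by move=> w B e _; rewrite subn1.
Qed.

(** The loop up to [B] is cut down by the guard that its index is less than [G], which reaches the
    whole range because [G] is bounded by [B]. *)
Lemma compilable_sum_lt F G : bounded G -> compilable F -> compilable G ->
  compilable (fun w B e => \sum_(0 <= i < G w B e) F w B (i :: e)).
Proof.
move=> bG cF cG.
have cF' : compilable (fun w B e =>
    if head 0 e < shift G w B e then F w B e else 0).
  apply: compilable_ifb => //; last exact: compilable_const.
  by apply: compilable_lt; [exact: compilable_head | exact: compilable_shift].
apply: compilable_ext (compilable_sum cF') => w B e vd.
rewrite /shift /= -big_mkcond /= (big_nat_widen _ _ _ _ _ (bG _ _ _ vd)).
by apply: eq_bigl => i; rewrite andTb.
Qed.

(** The machine does not multiply: the product is a sum of [F] copies of [G], so the number of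
    summands is what has to be bounded. *)
Lemma compilableM F G : bounded F -> compilable F -> compilable G ->
  compilable (fun w B e => F w B e * G w B e).
Proof.
move=> bF cF cG.
apply: compilable_ext (compilable_sum_lt bF (compilable_shift cG) cF).
by move=> w B e _; rewrite /shift /= sum_nat_const_nat subn0.
Qed.

Lemma compilableX n F : bounded F -> compilable F ->
  compilable (fun w B e => F w B e ^ n).
Proof.
move=> bF cF; elim: n => [|n IHn]; first exact: compilable_const.
by apply: compilable_ext (compilableM bF cF IHn) => w B e _; rewrite expnS.
Qed.

Lemma sum_leq_id a N : \sum_(0 <= i < N) (i < a) = minn a N.
Proof.
elim: N => [|N IHN]; first by rewrite big_geq // minn0.
by rewrite big_nat_recr //= IHN; case: ltnP => ?; lia.
Qed.

(** The quotient is the number of indices [i] with [i.+1 * G <= F]; the guard [0 < G] yields the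
    conventional value 0 of a division by zero. *)
Lemma compilable_div F G : bounded F -> compilable F -> compilable G ->
  compilable (fun w B e => F w B e %/ G w B e).
Proof.
move=> bF cF cG.
have cL : compilableb (fun w B e =>
    (0 < shift G w B e) && ((head 0 e).+1 * shift G w B e <= shift F w B e)).
  apply: compilable_and.
    by apply: compilable_lt; [exact: compilable_const | exact: compilable_shift].
  apply: compilable_le; last exact: compilable_shift.
  apply: (@compilable_ext _ (fun w B e => head 0 e * shift G w B e
                                          + shift G w B e)).
    by move=> w B e _; rewrite mulSn addnC.
  apply: compilableD; last exact: compilable_shift.
  apply: compilableM; [exact: bounded_head | exact: compilable_head |].
  exact: compilable_shift.
apply: compilable_ext (compilable_sum cL) => w B e vd; rewrite /shift /=.
have := bF w B e vd; move: (F w B e) (G w B e) => x y le_xB.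
case: y => [|y] /=; first by rewrite big1.
rewrite (eq_bigr (fun i => nat_of_bool (i < x %/ y.+1))).
  by rewrite sum_leq_id; apply/minn_idPl; apply: leq_trans le_xB; exact: leq_div.
by move=> i _; rewrite leq_divRL.
Qed.

Lemma bounded_div F G : bounded F -> bounded (fun w B e => F w B e %/ G w B e).
Proof. by move=> bF w B e /bF; apply: leq_trans; exact: leq_div. Qed.

Lemma compilable_mod F G : bounded F -> compilable F -> compilable G ->
  compilable (fun w B e => F w B e %% G w B e).
Proof.
move=> bF cF cG.
have cM := compilableM (@bounded_div F G bF) (compilable_div bF cF cG) cG.
apply: compilable_ext (compilableB cF cM) => w B e _.
by rewrite {1}(divn_eq (F w B e) (G w B e)) addKn.
Qed.

Lemma bounded_mod F G : bounded F -> bounded (fun w B e => F w B e %% G w B e).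
Proof. by move=> bF w B e /bF; apply: leq_trans; exact: leq_mod. Qed.

Lemma compilable_all_lt b G : bounded G -> compilableb b -> compilable G ->
  compilableb (fun w B e => all (fun i => b w B (i :: e)) (iota 0 (G w B e))).
Proof.
move=> bG cb cG.
have := compilable_sum_lt bG (compilableN cb) cG => cS.
apply: compilable_ext (compilable_eq cS (compilable_const _ 0)) => w B e _.
congr nat_of_bool; rewrite sum_nat_seq_eq0 /index_iota subn0.
by apply: eq_all => i /=; rewrite eqb0 negbK.
Qed.

Lemma compilable_all_seq (s : seq nat) b : (forall t, t \in s -> compilableb (b t)) ->
  compilableb (fun w B e => all (fun t => b t w B e) s).
Proof.
elim: s => [|t s IHs] cb; first exact: compilable_const.
apply: compilable_and; first by apply: cb; rewrite mem_head.
by apply: IHs => u us; apply: cb; rewrite inE us orbT.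
Qed.

Lemma compilable_has_seq (s : seq nat) b : (forall t, t \in s -> compilableb (b t)) ->
  compilableb (fun w B e => has (fun t => b t w B e) s).
Proof.
elim: s => [|t s IHs] cb; first exact: compilable_const.
apply: compilable_or; first by apply: cb; rewrite mem_head.
by apply: IHs => u us; apply: cb; rewrite inE us orbT.
Qed.

(** * Functions written to the output bit by bit *)

Definition wfunc := seq bool -> nat -> seq nat -> seq bool.

(** The bound on the length of the output is recorded besides the time because the output is finally
    moved to its place cell by cell. *)
Definition emittable (S : wfunc) : Prop :=
  forall rho r, 2 < r -> all (fun j => 2 < j < r) rho ->
  exists c T, poly_bounded T /\
    forall w B m o, ready w B m -> valid E w B (regs m rho) -> written o m ->
    size (S w B (regs m rho)) <= T B /\
    run c m (T B) (fun m' => keeps_but_output r m m' /\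
                             written (o ++ S w B (regs m rho)) m').

Lemma emittable_ext S1 S2 :
  (forall w B e, valid E w B e -> S1 w B e = S2 w B e) ->
  emittable S1 -> emittable S2.
Proof.
move=> eS em rho r lt_r lt_rho; have [c [T [pT spec]]] := em rho r lt_r lt_rho.
exists c, T; split=> // w B m o rd vd wr.
by rewrite -eS //; exact: spec.
Qed.

Lemma emittable_bit b : emittable (fun _ _ _ => [:: b]).
Proof.
move=> rho r lt_r lt_rho.
pose cell := Add (Add (rget 2) (Add (rget 2) (rget 2))) (Const 2).
exists (Seqn (Store cell (Const b.+1)) (rset 2 (Add (rget 2) (Const 1)))).
exists (fun _ => 1 + 1); split; first by auto with polyb.
move=> w B m o rd vd [m2 mo]; split=> //.
apply: run_seq; apply: run_store; apply: run_store => /=.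
set a := _ + _ + 2; have {a}->: a = 3 * size o + 2 by rewrite /a m2; lia.
have ->: update m (3 * size o + 2) b.+1 (reg 2) = size o.
  by rewrite /update -m2; case: eqP => //; rewrite /reg; lia.
split; [split=> [j lt_j jN2 | j] | split=> [|i]].
- by rewrite /update /reg; do 2!(case: eqP => [|_]; first by lia).
- by rewrite /update /reg; do 2!(case: eqP => [|_]; first by lia).
- by rewrite /update eqxx size_cat.
- rewrite size_cat /= addn1 ltnS leq_eqVlt => lt_i.
  rewrite /update; case: eqP => [|_]; first by rewrite /reg; lia.
  rewrite nth_cat; case: eqP => [ei|ni].
    have -> : i = size o by lia.
    by rewrite ltnn subnn.
  have lt_io : i < size o by lia.
  by rewrite lt_io mo.
Qed.

Lemma emittable_cat S1 S2 : emittable S1 -> emittable S2 ->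
  emittable (fun w B e => S1 w B e ++ S2 w B e).
Proof.
move=> em1 em2 rho r lt_r lt_rho.
have [c1 [T1 [pT1 spec1]]] := em1 rho r lt_r lt_rho.
have [c2 [T2 [pT2 spec2]]] := em2 rho r lt_r lt_rho.
exists (Seqn c1 c2), (fun B => T1 B + T2 B); split; first by auto with polyb.
move=> w B m o rd vd wr; have [sz1 run1] := spec1 w B m o rd vd wr.
split; first by have [sz2 _] := spec2 w B m o rd vd wr; rewrite size_cat leq_add.
apply: run_seq; apply: run_mono run1 => // m1 [k1 wr1].
have eq1 := keeps_but_output_regs k1 lt_rho.
have rd1 := keeps_but_output_ready (ltnW lt_r) k1 rd.
have [] := spec2 w B m1 _ rd1 _ wr1; rewrite eq1 // => _.
apply: run_mono => // m2 [k2 wr2]; split; last by rewrite catA.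
exact: keeps_but_output_trans k1 k2.
Qed.

Lemma emittable_if b S : compilableb b -> emittable S ->
  emittable (fun w B e => if b w B e then S w B e else [::]).
Proof.
move=> cb em rho r lt_r lt_rho.
have [c1 [T1 [pT1 spec1]]] := cb rho r lt_r lt_rho.
have [c2 [T2 [pT2 spec2]]] := em rho r lt_r lt_rho.
exists (Seqn c1 (Ifnz (rget r) c2 Skip)), (fun B => T1 B + (T2 B + 1).+1).
split; first by auto with polyb.
move=> w B m o rd vd wr; split.
  have [sz2 _] := spec2 w B m o rd vd wr; case: (b _ _ _) => //.
  by apply: leq_trans sz2 _; lia.
apply: run_seq; apply: run_mono (spec1 w B m rd vd) => // m1 [k1 v1].
have eq1 := keeps_regs k1 (all_lt_keep lt_rho).
have rd1 := keeps_ready (ltnW lt_r) k1 rd.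
have wr1 := keeps_written lt_r k1 wr.
apply: run_if => /=; rewrite v1; case: (b _ _ _) => // _.
- have [] := spec2 w B m1 _ rd1 _ wr1; rewrite eq1 // => _.
  apply: run_mono; first exact: leq_addr.
  move=> m2 [k2 wr2]; split=> //.
  by apply: keeps_but_output_trans k2; exact: keeps_forget_output.
- apply: (run_mono (leq_addl _ _) (fun m' h => h)); apply: run_skip.
  by rewrite cats0; split=> //; exact: keeps_forget_output.
Qed.

Lemma emittable_loop S : emittable S ->
  emittable (fun w B e => flatten [seq S w B (i :: e) | i <- iota 0 B]).
Proof.
move=> em rho r lt_r lt_rho.
have [||c [T [pT spec]]] := em (r :: rho) r.+1.
- by lia.
- by rewrite /= (@all_lt_wider r) //; lia.
exists (for_loop r c), (fun B => 1 + (B * (T B).+2).+1).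
split; first by auto 10 with polyb.
move=> w B m o rd vd wr; set e := regs m rho.
have setr m' i : keeps_but_output r m m' -> m' (reg r) = i ->
    regs m' (r :: rho) = i :: e.
  by move=> k' ri; rewrite /= ri (keeps_but_output_regs k').
pose out i := flatten [seq S w B (j :: e) | j <- iota 0 i].
have outS i : out i.+1 = out i ++ S w B (i :: e).
  by rewrite /out -[in LHS]addn1 iotaD map_cat flatten_cat /= cats0.
have upd m' i : keeps_but_output r m' (update m' (reg r) i).
  by split=> [j lt_j _|j]; rewrite /update /reg; case: eqP => //; lia.
have updw o' m' i : written o' m' -> written o' (update m' (reg r) i).
  by apply: (keeps_written lt_r); exact: keeps_update.
pose Inv i m' := keeps_but_output r m m' /\ written (o ++ out i) m'.
split.
  suff le_i i : i <= B -> size (out i) <= i * T B.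
    by apply: leq_trans (le_i B _) _ => //; rewrite !mulnS; lia.
  elim: i => [|i IHi] // lt_i; rewrite outS size_cat mulSn addnC.
  rewrite leq_add ?IHi //; last exact: ltnW.
  (* The bound on the length is part of a specification about memories, so a memory with [i] in
     register [r] is supplied. *)
  have k1 := upd m i.
  have rd1 := keeps_but_output_ready (ltnW lt_r) k1 rd.
  have [] := spec w B _ o rd1 _ (updw _ _ _ wr).
  + rewrite (setr _ i) //; last by rewrite /update eqxx.
    by apply: valid_cons vd; exact: ltnW.
  + by rewrite (setr _ i) //; rewrite /update eqxx.
apply: (run_for_loop (Inv := Inv)).
- move=> i m' [[k' _] _]; have [_ <- _] := rd; apply: k' => //; exact: ltnW lt_r.
- by split; [exact: upd | apply: updw; rewrite cats0].
- move=> i m' lt_i [k' wr'] ri.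
  have rd' := keeps_but_output_ready (ltnW lt_r) k' rd.
  have [] := spec w B m' _ rd' _ wr'; rewrite (setr _ i) //.
    by apply: valid_cons vd; exact: ltnW.
  move=> _; apply: run_mono => // m2 [k2 wr2]; split.
    by rewrite -ri; apply: k2.1 => //; lia.
  split; last by apply: updw; rewrite outS catA.
  apply: keeps_but_output_trans k' _.
  apply: keeps_but_output_trans (keeps_but_outputW (leqnSn r) k2) _.
  exact: upd.
Qed.

Lemma flatten_iota_widen T (G : nat -> seq T) (p : pred nat) n N : n <= N ->
  flatten [seq (if (i < n) && p i then G i else [::]) | i <- iota 0 N] =
  flatten [seq G i | i <- iota 0 n & p i].
Proof.
move=> le_n.
have eqf s : flatten [seq (if p i then G i else [::]) | i <- s] =
             flatten [seq G i | i <- s & p i].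
  by elim: s => //= i s ->; case: (p i).
rewrite -(subnKC le_n) iotaD map_cat flatten_cat.
rewrite (_ : flatten (map _ (iota (0 + n) _)) = [::]) ?cats0.
  rewrite -eqf; congr flatten; apply/eq_in_map => i.
  by rewrite mem_iota add0n => /= ->.
have: all (leq n) (iota (0 + n) (N - n)).
  by apply/allP => i; rewrite mem_iota add0n; case/andP.
elim: (iota _ _) => //= i s IHs /andP[le_i /IHs ->].
by rewrite ltnNge le_i.
Qed.

Lemma emittable_loop_lt S G b : bounded G -> compilable G -> compilableb b ->
  emittable S ->
  emittable (fun w B e =>
    flatten [seq S w B (i :: e) | i <- iota 0 (G w B e) & b w B (i :: e)]).
Proof.
move=> bG cG cb em.
have cg : compilableb (fun w B e => (head 0 e < shift G w B e) && b w B e).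
  apply: compilable_and => //; apply: compilable_lt; first exact: compilable_head.
  exact: compilable_shift.
apply: emittable_ext (emittable_loop (emittable_if cg em)) => w B e vd /=.
by rewrite /shift /= (@flatten_iota_widen _ (fun i => S w B (i :: e))
  (fun i => b w B (i :: e))) //; exact: bG.
Qed.

Lemma emittable_nseq F b : bounded F -> compilable F ->
  emittable (fun w B e => nseq (F w B e) b).
Proof.
move=> bF cF.
apply: emittable_ext (emittable_loop_lt bF cF
  (compilable_const _ 1 : compilableb (fun _ _ _ => true)) (emittable_bit b)).
move=> w B e _ /=; rewrite filter_predT.
by elim: (F w B e) 0 => //= n IHn k; rewrite IHn.
Qed.

Lemma emittable_nat F : bounded F -> compilable F ->
  emittable (fun w B e => enc_nat (F w B e)).
Proof.
move=> bF cF; have := emittable_cat (emittable_nseq true bF cF) (emittable_bit false).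
by apply: emittable_ext => w B e _; rewrite cats1.
Qed.

End DerivedCompilable.

(** * Programs that tolerate arbitrary initial contents outside the input *)

(* Bits are moved upwards from the last one on, with the input length in cell 0
   as counter; the length is then recovered from the zero put behind them. *)
Definition load : prog :=
  let cell e k := Add (Add e (Add e e)) (Const k) in
  Seqn (Store (cell (rget 0) 4) (Const 0))
 (Seqn (Whilenz (rget 0)
         (Seqn (Store (cell (rget 0) 1) (Add (Fetch (rget 0)) (Const 1)))
               (rset 0 (Sub (rget 0) (Const 1)))))
       (Whilenz (Fetch (cell (rget 0) 4)) (rset 0 (Add (rget 0) (Const 1))))).

Lemma run_load w m : holds_output m w ->
  run load m (1 + ((size w * 3).+1 + (size w * 2).+1)) (fun m' =>
    m' (reg 0) = size w /\
    forall i, i < size w -> m' (3 * i + 4) = (nth false w i).+1).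
Proof.
move=> [m0 mi]; set n := size w.
apply: run_seq; apply: run_store => /=; rewrite m0 -/n.
have -> : n + (n + n) + 4 = 3 * n + 4 by lia.
set m1 := update _ _ _.
(* The target [3 * j + 4] of a bit lies above its source [j.+1]; going down from the last bit
   overwrites no bit that is still to be moved. *)
pose Inv i (m' : memory) := [/\ m' 0 = n - i, m' (3 * n + 4) = 0,
  forall j, j < n - i -> m' j.+1 = nth false w j &
  forall j, n - i <= j < n -> m' (3 * j + 4) = (nth false w j).+1].
pose Inv2 i (m' : memory) := [/\ m' 0 = i, m' (3 * n + 4) = 0 &
  forall j, j < n -> m' (3 * j + 4) = (nth false w j).+1].
apply: run_seq.
apply: (run_mono (leqnn _) (Q := Inv n)); last first.
  apply: (run_while (Inv := Inv)).
  - by move=> i m' lt_i [e0 _ _ _]; rewrite /= e0; lia.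
  - by move=> m' [e0 _ _ _]; rewrite /= e0; lia.
  - move=> i m' lt_i [e0 es lo hi].
    rewrite -[2]/(1 + 1); apply: run_seq; apply: run_store; apply: run_store.
    rewrite /= {1}/reg muln0 e0.
    set a := _ + _ + 1; have {a}-> : a = 3 * (n - i.+1) + 4 by rewrite /a; lia.
    have -> : m' (n - i) = nth false w (n - i.+1).
      by rewrite -lo; [congr m' |]; lia.
    have upd0 x : update m' (3 * (n - i.+1) + 4) x 0 = n - i.
      by rewrite /update e0; case: eqP => //; lia.
    rewrite upd0 /reg muln0; split.
    + by rewrite /update eqxx; lia.
    + by rewrite /update; do 2!(case: eqP => [|_]; first by lia).
    + move=> j lt_j; rewrite /update; case: eqP => // _.
      by case: eqP => [|_]; [lia | apply: lo; lia].
    + move=> j le_j; rewrite /update; case: eqP => [|_]; first by lia.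
      case: eqP => [ej|nej]; last by apply: hi; lia.
      by rewrite addn1; congr (nat_of_bool (nth _ _ _)).+1; lia.
  - split.
    + by rewrite subn0 /m1 /update m0; case: eqP => //; lia.
    + by rewrite /m1 /update eqxx.
    + move=> j lt_j; rewrite /m1 /update; case: eqP => [|_]; first by lia.
      by apply: mi; lia.
    + by move=> j; lia.
move=> m2 [e0 es _ hi].
apply: (run_mono (leqnn _) (Q := Inv2 n)); last first.
  apply: (run_while (Inv := Inv2)).
  - move=> i m' lt_i [f0 _ fi]; rewrite /= /reg muln0 f0.
    have -> : i + (i + i) + 4 = 3 * i + 4 by lia.
    by rewrite fi.
  - move=> m' [f0 fs _]; rewrite /= /reg muln0 f0 -fs; congr m'; lia.
  - move=> i m' lt_i [f0 fs fi]; apply: run_store => /=; rewrite /reg muln0 f0.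
    split; first by rewrite /update eqxx addn1.
      by rewrite /update; case: eqP => //; lia.
    by move=> j lt_j; rewrite /update; case: eqP; [lia | rewrite fi].
  - by split=> //; [rewrite e0; lia | move=> j lt_j; apply: hi; lia].
by move=> m3 [f0 _ fi]; split=> //; rewrite /reg muln0.
Qed.

(** The length cannot be kept in register 2, whose cell 6 is itself a target when there are six bits
    or more. A zero behind the output bits marks the end instead, and the counter in cell 0 ends up
    as the length required there. *)
Definition unload : prog :=
  let cell r := Add (Add (rget r) (Add (rget r) (rget r))) (Const 2) in
  Seqn (Store (cell 2) (Const 0))
 (Seqn (rset 0 (Const 0))
       (Whilenz (Fetch (cell 0))
         (Seqn (Store (Add (rget 0) (Const 1)) (Sub (Fetch (cell 0)) (Const 1)))
               (rset 0 (Add (rget 0) (Const 1)))))).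

Lemma run_unload o m : written o m ->
  run unload m (1 + (1 + (size o * 3).+1)) (fun m' => holds_output m' o).
Proof.
move=> [m2 mo]; set n := size o.
apply: run_seq; apply: run_store; apply: run_seq; apply: run_store => /=.
rewrite m2 -/n /reg muln0.
have -> : n + (n + n) + 2 = 3 * n + 2 by lia.
set m1 := update _ _ _.
pose Inv i (m' : memory) := [/\ m' 0 = i, m' (3 * n + 2) = 0,
  forall j, j < i -> m' j.+1 = nth false o j &
  forall j, i <= j < n -> m' (3 * j + 2) = (nth false o j).+1].
apply: (run_mono (leqnn _) (Q := Inv n)).
  by move=> m' [e0 _ lo _]; split.
apply: (run_while (Inv := Inv)).
- move=> i m' lt_i [e0 _ _ hi] /=; rewrite /reg muln0 e0.
  have -> : i + (i + i) + 2 = 3 * i + 2 by lia.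
  by rewrite hi // leqnn.
- by move=> m' [e0 es _ _] /=; rewrite /reg muln0 e0 -es; congr m'; lia.
- move=> i m' lt_i [e0 es lo hi].
  rewrite -[2]/(1 + 1); apply: run_seq; apply: run_store; apply: run_store.
  rewrite /= /reg muln0 e0 addn1.
  have -> : i + (i + i) + 2 = 3 * i + 2 by lia.
  rewrite hi ?leqnn // subn1 /=.
  have -> x : update m' i.+1 x 0 = i by rewrite /update; case: eqP => //; lia.
  split.
  + by rewrite /update eqxx addn1.
  + rewrite /update; case: eqP => [h|_]; first by lia.
    by case: eqP => [h|_]; first by lia.
  + move=> j lt_j; rewrite /update; case: eqP => // _.
    by case: eqP => [[->]//|nj]; apply: lo; lia.
  + move=> j le_j; rewrite /update; do 2!(case: eqP => [|_]; first by lia).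
    by apply: hi; lia.
- split.
  + by rewrite /m1 /update eqxx.
  + rewrite /m1 /update; case: eqP => [|_]; first by lia.
    by rewrite eqxx.
  + by [].
  + move=> j lt_j; rewrite /m1 /update; do 2!(case: eqP => [|_]; first by lia).
    by rewrite mo //; lia.
Qed.

Definition transducible (h : seq bool -> seq bool) : Prop :=
  exists c T, poly_bounded T /\ forall w m, holds_output m w ->
    run c m (T (size w)) (fun m' => holds_output m' (h w)).

Theorem emittable_transducible E S : emittable E S ->
  transducible (fun w => S w ((size w).+2 ^ E.+1) [::]).
Proof.
move=> em.
have [||c [T [[C [q leT]] spec]]] := em [::] 3 => //.
(* The common bound is computed by a compiled program as well, one with exponent [E = 0], whose own
   loop bound [size w + 2] takes a single addition. *)
have cP : compilable 0 (fun w B e => (size w).+2 ^ E.+1).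
  apply: (@compilableX _ E.+1 (fun w _ _ => (size w).+2)).
    by move=> w B e [le _]; rewrite expn1 in le.
  exact: (compilableS (compilableS (compilable_size 0))).
have [||cp [Tp [[C' [q' leTp]] specp]]] := cP [::] 3 => //.
exists (Seqn load (Seqn (rset 1 (Add (rget 0) (Const 2)))
  (Seqn cp (Seqn (rset 1 (rget 3)) (Seqn (rset 2 (Const 0))
  (Seqn c unload)))))).
pose P n := n.+2 ^ E.+1; pose TP n := C * (P n).+1 ^ q.
exists (fun n => (1 + ((n * 3).+1 + (n * 2).+1)) + (1 + (C' * n.+3 ^ q'
  + (1 + (1 + (TP n + (1 + (1 + (TP n * 3).+1)))))))).
split; first by rewrite /TP /P; auto 20 with polyb.
move=> w m hm; apply: run_seq; apply: run_mono (run_load hm) => // m1 [r0 ri].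
apply: run_seq; apply: run_store; rewrite [eval _ _]/= [eval _ _]/= r0.
apply: run_seq.
have rd1 : ready w (size w + 2) (update m1 (reg 1) (size w + 2)).
  split; rewrite /update ?eqxx //.
  by move=> i lt_i; case: eqP => [|_]; [rewrite /reg; lia | exact: ri].
have vd1 : valid 0 w (size w + 2) [::] by split=> //; rewrite expn1; lia.
apply: run_mono (specp w _ _ rd1 vd1) => [|m2 [k2 v2]].
  by apply: leq_trans (leTp _) _; rewrite addn2.
have [s0 _ si] := keeps_ready (isT : 2 <= 3) k2 rd1.
apply: run_seq; apply: run_store; apply: run_seq; apply: run_store.
rewrite [eval _ _]/= [eval _ _]/= [eval _ _]/= [eval _ _]/= v2.
set m3 := update _ _ _.
have rd3 : ready w (P (size w)) m3.
  split; rewrite /m3 /update ?eqxx //.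
  move=> i lt_i; do 2!(case: eqP => [|_]; first by rewrite /reg; lia).
  exact: si.
have vd3 : valid E w (P (size w)) [::] by split.
have wr3 : written [::] m3 by split=> //; rewrite /m3 /update eqxx.
have [sz run3] := spec w _ m3 [::] rd3 vd3 wr3.
apply: run_seq; apply: run_mono run3 => [|m4 [_ wr4]]; first exact: leT.
apply: run_mono (run_unload wr4) => //=.
by rewrite !add1n !ltnS leq_mul2r; exact: leq_trans sz (leT _).
Qed.

(** * Composition of reductions *)

Lemma expn_homo e : {homo expn^~ e : m n / m <= n}.
Proof. by case: e => // e m n le_mn; rewrite leq_exp2r. Qed.

Lemma leq_expn_size C n : C <= n.+2 ^ C.
Proof.
by apply: leq_trans (ltnW (ltn_expl C (isT : 1 < 2))) _; exact: expn_homo.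
Qed.

Lemma transducible_nseq_poly C q :
  transducible (fun w => nseq (C * (size w).+1 ^ q) true).
Proof.
apply: (@emittable_transducible (C + q)
  (fun w _ _ => nseq (C * (size w).+1 ^ q) true)).
have leCq w B e : valid (C + q) w B e -> C * (size w).+1 ^ q <= B.
  move=> [le _]; apply: leq_trans le; rewrite expnS expnD mulnCA.
  apply: leq_mul; first exact: leq_expn_size.
  apply: leq_trans (leq_pmull _ _) => //.
  exact: expn_homo.
apply: (@emittable_nseq _ (fun w _ _ => C * (size w).+1 ^ q)) => //.
apply: (@compilableM _ (fun _ _ _ => C)).
- move=> w B e vd; apply: leq_trans (leCq w B e vd); rewrite leq_pmulr //.
  by rewrite expn_gt0.
- exact: compilable_const.
- apply: (@compilableX _ _ (fun w _ _ => (size w).+1)).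
    by move=> w B e /valid_size/ltnW.
  exact: compilableS (compilable_size _).
Qed.

(** The time factor and the parameter bound of a composed reduction have this form and must be
    computable. The program for [f] is followed by one that writes a polynomial of its input length
    in unary. *)
Lemma computable_comp_poly (f : nat -> nat) C q :
  computable f -> computable (fun n => C * (f n).+1 ^ q).
Proof.
move=> [c comp]; have [c' [T [_ spec]]] := transducible_nseq_poly C q.
exists (Seqn c c') => n; have [b [t [m [ex out _]]]] := comp n.
have [t' [m' [ex' out' le']]] := spec _ _ out; rewrite !size_nseq in out' le'.
exists (t + T (f n)), (t + t'), m'; split=> //; first exact: ExecSeqn ex ex'.
by rewrite leq_add2l.
Qed.

(** * Outputs and running time *)

Lemma exec_touched c m t m' : exec c m t m' ->
  exists A : seq nat, size A <= t /\ forall a, a \notin A -> m' a = m a.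
Proof.
have cat2 t1 t2 (A1 A2 : seq nat) (m0 m1 m2 : memory) :
    size A1 <= t1 /\ (forall a, a \notin A1 -> m1 a = m0 a) ->
    size A2 <= t2 /\ (forall a, a \notin A2 -> m2 a = m1 a) ->
    size (A1 ++ A2) <= t1 + t2 /\
    (forall a, a \notin A1 ++ A2 -> m2 a = m0 a).
  move=> [s1 e1] [s2 e2]; split; first by rewrite size_cat leq_add.
  by move=> a; rewrite mem_cat negb_or => /andP[/e1 <- /e2].
elim=> {c m t m'}.
- by exists [::].
- move=> a e m; exists [:: eval m a]; split=> // b; rewrite inE /update.
  by move/negbTE->.
- move=> c1 c2 m m1 m2 t1 t2 _ [A1 h1] _ [A2 h2].
  by exists (A1 ++ A2); exact: cat2 h1 h2.
- by move=> e c1 c2 m m1 t _ _ [A [s h]]; exists A; split=> //; exact: leqW.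
- by move=> e c1 c2 m m1 t _ _ [A [s h]]; exists A; split=> //; exact: leqW.
- move=> e c m m1 m2 t1 t2 _ _ [A1 h1] _ [A2 h2].
  exists (A1 ++ A2); have [s h] := cat2 _ _ _ _ _ _ _ h1 h2.
  by split=> //; exact: leqW.
- by exists [::].
Qed.

(** The initial memory is zero behind the input, so a one of the output lies in a cell of the input
    or in a cell that was written, and a step writes at most one cell. *)
Lemma count_output_true c w w' b :
  runs_within c w w' b -> count id w' <= size w + b.
Proof.
move=> [t [m [/exec_touched[A [szA eA]] [_ out] le_t]]].
pose ones := [seq i <- iota 0 (size w') | nth false w' i].
have -> : count id w' = size ones.
  rewrite -[in LHS](mkseq_nth false w') /mkseq count_map size_filter.
  by apply: eq_count.
(* Bit [i] is kept in cell [i.+1], hence the predecessors of the written addresses. *)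
suff sub : {subset ones <= iota 0 (size w) ++ map predn A}.
  have un : uniq ones by rewrite filter_uniq ?iota_uniq.
  apply: leq_trans (uniq_leq_size un sub) _.
  by rewrite size_cat size_iota size_map leq_add2l (leq_trans szA).
move=> i; rewrite mem_filter mem_iota add0n mem_cat mem_iota => /andP[wi lt_i].
case: (boolP (i.+1 \in A)) => [/(map_f predn)/= -> | /eA]; first by rewrite orbT.
rewrite out // wi /=; case: ltnP => //= le_i.
by rewrite nth_default.
Qed.

(** The second program is polynomial in the length of the intermediate code. By the last hypothesis
    this length is linear in the number of ones, and [count_output_true] bounds that number by the
    input length and the time of the first program. *)
Theorem fpt_reducible_comp (P Q R : pproblem) (r : instance Q -> instance R)
    (h : seq bool -> seq bool) (D C q : nat) :
  fpt_reducible P Q -> transducible h ->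
  (forall x, encode (r x) = h (encode x)) ->
  (forall x, yes x <-> yes (r x)) ->
  (forall x, param (r x) <= C * (param x).+1 ^ q) ->
  (forall x : instance Q, size (encode x) <= D * (count id (encode x)).+1) ->
  fpt_reducible P R.
Proof.
move=> [r1 [c1 [f [g [e [cf cg red]]]]]] [c2 [T [[A [a leT]] spec]]] enc yesr parr szQ.
exists (fun x => r (r1 x)), (Seqn c1 c2).
exists (fun k => (1 + A * D.+1 ^ a) * (f k).+1 ^ a.+1).
exists (fun k => C * (g k).+1 ^ q), (e.+1 * a.+1).
split; try exact: computable_comp_poly.
move=> x; have [yes1 par1 run1] := red x; split.
- exact: iff_trans yes1 (yesr _).
- apply: leq_trans (parr _) _; rewrite leq_mul2l; apply/orP; right.
  exact: expn_homo.
have cnt := count_output_true run1.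
have [t1 [m1 [ex1 out1 le1]]] := run1.
have [t2 [m2 [ex2 out2 le2]]] := spec _ _ out1.
exists (t1 + t2), m2; split.
- exact: ExecSeqn ex1 ex2.
- by rewrite enc.
have le3 := leq_trans le2 (leT _).
have sz := szQ (r1 x).
set X := (size (encode x)).+1 in le1 cnt *; set k := param x in le1 cnt *.
set w' := encode (r1 x) in sz cnt le3 *.
have X1 : X <= X ^ e.+1 by rewrite expnS leq_pmulr // expn_gt0.
have Xe : X ^ e <= X ^ e.+1 by rewrite expnS leq_pmull.
have X0 : 0 < X ^ e.+1 by rewrite expn_gt0.
(* The exponent is [e.+1] because [Y] must dominate both the factor [X ^ e] of the time and the
   input length itself, even when [e] is 0. *)
set Y := X ^ e.+1 in X1 Xe X0.
have le4 : t1 <= (f k).+1 * Y by apply: leq_trans le1 _; exact: leq_mul.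
have le5 : (size w').+1 <= D.+1 * ((f k).+1 * Y).
  have cnt' : (count id w').+1 <= (f k).+1 * Y.
    have : f k * X ^ e <= f k * Y by exact: leq_mul.
    by rewrite mulSn; move: cnt; rewrite /X; lia.
  have : D * (count id w').+1 <= D * ((f k).+1 * Y) by exact: leq_mul.
  have : 0 < (f k).+1 * Y by rewrite muln_gt0 X0.
  by rewrite mulSn; lia.
have le6 : (size w').+1 ^ a <= D.+1 ^ a * ((f k).+1 * Y) ^ a.
  by rewrite -expnMn; exact: expn_homo.
have Z1 : 0 < (f k).+1 * Y by rewrite muln_gt0 X0.
rewrite expnM -/Y -mulnA -expnMn.
move: Z1 le4 le6; set Z := (f k).+1 * Y => Z1 le4 le6.
have Za : Z ^ a <= Z ^ a.+1 by rewrite expnS leq_pmull.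
have ZZ : Z <= Z ^ a.+1 by rewrite expnS leq_pmulr // expn_gt0 Z1.
rewrite mulnDl mul1n; apply: leq_add; first exact: leq_trans le4 ZZ.
apply: leq_trans le3 _; rewrite -mulnA leq_mul2l; apply/orP; right.
by apply: leq_trans le6 _; rewrite leq_mul2l Za orbT.
Qed.

(** * Treecut width of star-like graphs *)

Section ThreeCenter.

Variables (W : finType) (X : {set W}).

Lemma suppress_one_sub (g : multigraph W) :
  verts (suppress_one X g) \subset verts g.
Proof. by rewrite /suppress_one; case: pickP => //= v _; exact: subsetDl. Qed.

Lemma three_center_sub (g : multigraph W) :
  verts (three_center X g) \subset verts g.
Proof.
rewrite /three_center; elim: #|_| => //= n; apply: subset_trans.
exact: suppress_one_sub.
Qed.

(** An invariant of exhaustive suppression: the vertices outside [X] are independent and loopless.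
    Suppressing one of them changes no multiplicity at the others, so their degrees do not grow and
    all of them disappear in the end. *)
Definition suppressible (g : multigraph W) : Prop :=
  forall v, v \in verts g :\: X ->
    degree g v <= 2 /\ forall u, u \in verts g :\: X -> mult g v u = 0.

Lemma suppressible_suppress_one g :
  suppressible g -> suppressible (suppress_one X g).
Proof.
move=> sup; rewrite /suppress_one; case: pickP => // v /and3P[vg vX _].
have vgX : v \in verts g :\: X by rewrite inE vX.
have sub u : u \in verts (suppress g v) :\: X -> u \in verts g :\: X.
  by rewrite !inE => /and3P[-> _ ->].
move=> u /sub ugX; have [deg u0] := sup u ugX; have [_ v0] := sup v vgX.
have same x : mult (suppress g v) u x = mult g u x.
  by rewrite /= v0 //=; case: eqP; rewrite addn0.
split=> [|x /sub xgX]; last by rewrite same u0.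
apply: leq_trans deg; rewrite /degree same leq_add2r.
rewrite (eq_bigr (mult g u)) => [|x _]; last exact: same.
rewrite [leqRHS](bigID (fun x => x == v)) /= addnC.
apply: leq_trans (leq_addr _ _); apply: eq_leq; apply: eq_bigl => x.
by rewrite !inE; case: (x == v); case: (x == u); case: (x \in _).
Qed.

Lemma card_suppress_one g : suppressible g ->
  #|verts (suppress_one X g) :\: X| <= #|verts g :\: X|.-1.
Proof.
move=> sup; rewrite /suppress_one; case: pickP => [v /and3P[vg vX _] | none].
  rewrite /= [in leqRHS](cardsD1 v) !inE vg vX /=.
  by apply: subset_leq_card; apply/subsetP => u; rewrite !inE andbCA.
suff -> : verts g :\: X = set0 by rewrite cards0.
apply/setP => v; rewrite [in RHS]inE; apply/negP => vgX.
have := none v; have [-> _] := sup v vgX; move: vgX.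
by rewrite inE => /andP[-> ->].
Qed.

Lemma three_center_suppressible g :
  suppressible g -> verts (three_center X g) \subset X.
Proof.
move=> sup; rewrite -setD_eq0 -cards_eq0 -leqn0 /three_center.
suff [_] : suppressible (iter #|verts g| (suppress_one X) g) /\
    #|verts (iter #|verts g| (suppress_one X) g) :\: X|
      <= #|verts g :\: X| - #|verts g|.
  move=> le; apply: leq_trans le _.
  by have := subset_leq_card (subsetDl (verts g) X); lia.
elim: #|verts g| => [|n [supn IHn]]; first by rewrite subn0.
split; first exact: suppressible_suppress_one.
by apply: leq_trans (card_suppress_one supn) _; lia.
Qed.

End ThreeCenter.

(** * The star with the core in its centre *)

Section StarDecomposition.

Variables (V L : finType) (G : rel V) (core : {set V}).
Variables (piece : V -> L) (half : V -> bool).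

Hypothesis G_sym : symmetric G.
Hypothesis piece_edge : forall a b,
  a \notin core -> b \notin core -> G a b -> piece a = piece b.
Hypothesis core_edge : forall a b b',
  a \notin core -> b \in core -> b' \in core -> G a b -> G a b' -> b = b'.
Hypothesis piece_inj : forall a b, a \notin core -> b \notin core ->
  piece a = piece b -> half a = half b -> a = b.

Let T : rel (option L) := [rel x y | (x == None) != (y == None)].
Let bag (v : V) : option L := if v \in core then None else Some (piece v).

Let T_sym : symmetric T. Proof. by move=> x y; rewrite /T /= eq_sym. Qed.

Lemma star_is_tree : is_tree T.
Proof.
have toN x : connect T x None.
  by case: x => [l|]; [apply: connect1 | exact: connect0].
split=> //.
- by rewrite card_option.
- by move=> x; rewrite /T /= eqxx.
- move=> x y; apply: connect_trans (toN x) _.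
  by rewrite (sym_connect_sym T_sym).
- move=> [|x [|y [|z s]]] // /andP[].
  case: x y z => [x|] [y|] [z|] //=; rewrite ?inE ?andbF //.
  by case: s => [|u s]; rewrite /= ?andbF //; case: u; rewrite //= ?inE ?orbT ?andbF.
Qed.

(** An edge that leaves a piece ends in the core. Its first end is one of at most two vertices, told
    apart by [half], and has at most one neighbour in the core, so [half] determines the edge. *)
Lemma piece_leaves l :
  #|[set p : V * V | [&& G p.1 p.2, bag p.1 == Some l & bag p.2 != Some l]]| <= 2.
Proof.
set A := [set p | _].
have AP p : p \in A -> [/\ G p.1 p.2, p.1 \notin core, piece p.1 = l &
    p.2 \in core].
  rewrite inE /bag => /and3P[e]; case: ifP => // /negbT p1 /eqP[pl] p2.
  split=> //; apply: contraNT p2 => p2; rewrite (negbTE p2).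
  by rewrite -(piece_edge p1 p2 e) pl.
rewrite -card_bool -(card_in_imset (f := fun p => half p.1) (D := A)).
  exact: max_card.
move=> [a b] [a' b'] /AP[/= e1 a1 l1 b1] /AP[/= e2 a2 l2 b2] eh.
have ea : a = a' by apply: piece_inj => //; rewrite l1 l2.
by subst a'; rewrite (core_edge a1 b1 b2 e1 e2).
Qed.

Lemma side_leaf l : side T None (Some l) = [set Some l].
Proof.
apply/setP => x; rewrite !inE; apply/idP/eqP => [/connectP[p] | ->]; last first.
  exact: connect0.
case: p => //= y p /andP[/andP[]]; case: y => //= _.
by rewrite setUC eqxx.
Qed.

Lemma side_root l : side T (Some l) None = ~: [set Some l].
Proof.
apply/setP => x; rewrite !inE; apply/idP/idP => [|xl].
  apply: contraTN => /eqP->; apply/connectP => -[p].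
  case/lastP: p => // p y; rewrite rcons_path last_rcons => /andP[_ e] ey.
  move: e; rewrite -ey /=; case: (last _ _) => //= /andP[_].
  by rewrite setUC eqxx.
case: x xl => [l' ne|_]; last exact: connect0.
apply: connect1 => /=; apply: contra ne => /eqP/setP/(_ (Some l')).
by rewrite !inE eqxx orbT => /esym; rewrite orbF.
Qed.

Lemma adhesion_le e : T e.1 e.2 -> adhesion G T bag e.1 e.2 <= 2.
Proof.
case: e => [[l|] [l'|]] //= _; rewrite /adhesion.
- rewrite side_root; apply: leq_trans (piece_leaves l).
  have inj : injective (fun p : V * V => (p.2, p.1)) by move=> [a b] [c d] [-> ->].
  rewrite -(card_imset _ inj).
  apply: subset_leq_card; apply/subsetP => p /imsetP[[a b] ab ->]; move: ab.
  by rewrite !inE /= negbK => /and3P[e1 e2 e3]; rewrite /= G_sym e1 e2 e3.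
- rewrite side_leaf; apply: leq_trans (piece_leaves l').
  by apply: subset_leq_card; apply/subsetP => p; rewrite !inE.
Qed.

(** No suppression is used: there are at most two vertices of the piece, and removing a leaf leaves
    a single component, which contributes the third vertex. *)
Lemma torso_leaf l : torso_size G T bag (Some l) <= 3.
Proof.
apply: leq_trans (subset_leq_card (three_center_sub _ _)) _.
rewrite /torso /=; apply: leq_trans (leq_card_setU _ _) _.
rewrite -[3]/(2 + 1); apply: leq_add.
  rewrite card_imset; last by move=> ? ? [].
  rewrite -card_bool -(card_in_imset (f := half)); first exact: max_card.
  move=> a b; rewrite !inE /bag; do 2!case: ifP => // /negbT ?.
  by move=> /eqP[la] /eqP[lb]; apply: piece_inj => //; rewrite la lb.
have comp x : x != Some l -> component T (Some l) x = ~: [set Some l].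
  move=> xl; apply/setP => y; rewrite !inE.
  apply/idP/idP => [/connectP[p]|yl].
    elim: p x xl => [|z p IHp] x xl /=; first by move=> _ ->.
    by move=> /andP[/and3P[_ _ zl] /IHp]; apply.
  have toN z : z != Some l -> connect (del_node T (Some l)) z None.
    by case: z => [z zl|_]; [apply: connect1; apply/and3P | exact: connect0].
  apply: connect_trans (toN x xl) _.
  rewrite sym_connect_sym; first exact: toN.
  by move=> a b; rewrite /del_node /= -!/(T _ _) T_sym (andbC (a != _)).
rewrite -(cards1 (inr (~: [set Some l]) : V + {set option L})).
apply: subset_leq_card; apply/subsetP => p /imsetP[x]; rewrite !inE /= => xl ->.
by rewrite comp.
Qed.

Lemma component_root l : component T None (Some l) = [set Some l].
Proof.
apply/setP => y; rewrite !inE; apply/idP/eqP => [/connectP[[|z p] //=]|->].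
  by case: z.
exact: connect0.
Qed.

Lemma consolidate_root v : consolidate T bag None v =
  if v \in core then inl v else inr [set Some (piece v)].
Proof.
by rewrite /consolidate /bag; case: (v \in core); rewrite ?component_root.
Qed.

(** The contracted pieces have degree at most 2 by [piece_leaves] and are pairwise nonadjacent, so
    suppression removes all of them and leaves only core vertices. *)
Lemma torso_root : torso_size G T bag None <= #|core|.
Proof.
have partE : part bag None = [set inl v | v in core].
  apply/setP => p; apply/imsetP/imsetP => -[v vc ->]; exists v => //; move: vc.
    by rewrite inE /bag; case: ifP.
  by rewrite inE /bag => ->.
rewrite -(card_imset core (inl_inj (B := {set option L}))) -partE.
apply/subset_leq_card/three_center_suppressible => v.
have nonpart u : u \in verts (torso G T bag None) :\: part bag None ->
    exists l, u = inr [set Some l].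
  rewrite inE => /andP[/negbTE uX]; rewrite inE uX /= => /imsetP[x].
  by rewrite inE; case: x => [l _ ->|//]; exists l; rewrite component_root.
move/nonpart=> [l ->]; split; last first.
  move=> u /nonpart[l' ->]; rewrite /=; case: eqP => // ne.
  apply/eqP; rewrite cards_eq0; apply/eqP/setP => -[a b]; rewrite !inE /=.
  rewrite !consolidate_root; apply/negP => /and3P[e].
  case: ifP => // /negbT ca /eqP[la]; case: ifP => // /negbT cb /eqP[lb].
  by apply: ne; rewrite -la -lb (piece_edge ca cb e).
rewrite /degree /= eqxx addn0.
(* The degree sorts the edges of the contracted piece by their other end in the torso; exchanging
   the sums counts each of these edges once. *)
rewrite (eq_bigr (fun u => \sum_(e : V * V | [&& G e.1 e.2,
  consolidate T bag None e.1 == inr [set Some l] & consolidate T bag None e.2 == u]) 1)); last first.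
  move=> u /andP[_ ne]; rewrite eq_sym (negbTE ne) -sum1_card.
  by apply: eq_bigl => e; rewrite inE.
apply: leq_trans (piece_leaves l).
rewrite -sum1_card (exchange_big_dep (fun e : V * V => [&& G e.1 e.2,
  bag e.1 == Some l & bag e.2 != Some l])) /=; last first.
  move=> u [a b] /andP[_ ne] /= /and3P[e].
  rewrite !consolidate_root /bag e /=; case: ifP => // _ /eqP[/set1_inj la] cu.
  rewrite la eqxx /=; apply: contra ne; rewrite -(eqP cu).
  by case: ifP => // _ /eqP[->].
rewrite [leqRHS](eq_bigl (fun e : V * V => [&& G e.1 e.2,
  bag e.1 == Some l & bag e.2 != Some l])) => [|e]; last by rewrite inE.
apply: leq_sum => e _; rewrite sum1_card.
rewrite -(cards1 (consolidate T bag None e.2)).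
apply: subset_leq_card; apply/subsetP => u; rewrite !inE.
by case/and4P=> _ _ _ /eqP->.
Qed.

Theorem star_treecut_width : treecut_width G <= maxn #|core| 3.
Proof.
rewrite /treecut_width; case: ex_minnP => k _ min_k.
apply: leq_trans (min_k (decomposition_width G T bag) _) _.
  by apply/asboolP; exists (option L), T, bag; split=> //; exact: star_is_tree.
rewrite geq_max; apply/andP; split.
  apply/bigmax_leqP => e /adhesion_le le2; apply: leq_trans le2 _.
  by rewrite leq_max orbT.
apply/bigmax_leqP => -[l|] _.
  by apply: leq_trans (torso_leaf l) _; rewrite leq_maxr.
by apply: leq_trans torso_root _; rewrite leq_maxl.
Qed.

End StarDecomposition.

(** * From conflict-free selection to structure learning *)

Section ConflictTable.

(* There are [K] colours with [M] options each; option [p] of colour [i] has the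
   code [i * M + p], and [bad] is the conflict relation on codes.  Vertex
   [i < K] stands for colour [i]; vertices [K + 2 (x n + y)] and its successor,
   where [n = K * M], form the gadget of the pair of codes [(x, y)]. *)
Variables (K M : nat) (bad : rel nat).

(** The case [i = j] is included, so [bad x x] forbids an option by itself. The relation need not be
    symmetric, which is why every ordered pair of codes has its own gadget. *)
Definition conflict_free : Prop := exists sel : nat -> nat,
  (forall i, i < K -> sel i < M) /\
  (forall i j, i < K -> j < K -> ~~ bad (i * M + sel i) (j * M + sel j)).

Definition ncodes : nat := K * M.
Definition nverts : nat := K + 2 * (ncodes * ncodes).
Definition gadget (u : nat) : nat := (u - K) %/ 2.
Definition second (u : nat) : bool := (u - K) %% 2 == 1.
Definition code1 (u : nat) : nat := gadget u %/ ncodes.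
Definition code2 (u : nat) : nat := gadget u %% ncodes.
Definition conflict (u : nat) : bool := bad (code1 u) (code2 u).

Definition has_option (v p : nat) : bool := (v < K) || ((p == 0) && conflict v).

(* The clause [code1 u == code2 u] only serves to make the parent sets of the
   options of a colour pairwise distinct. *)
Definition is_parent (v p u : nat) : bool :=
  if v < K then
    (K <= u) && (if second u then conflict u && (code2 u == v * M + p)
                 else (conflict u || (code1 u == code2 u)) && (code1 u == v * M + p))
  else if second v then (u == code2 v %/ M) || (u.+1 == v)
  else (u == code1 v %/ M) || (u == v.+1).

Definition parent_set (v p : nat) : seq nat :=
  [seq u <- iota 0 nverts | is_parent v p u].

Definition options (v : nat) : seq (seq nat * nat) :=
  [seq (parent_set v p, 1) | p <- iota 0 M & has_option v p].

Definition conflict_table : table := [seq options v | v <- iota 0 nverts].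

(** A slot stands for one unit of score: a core vertex, or the gadget of a conflicting pair,
    represented by its first vertex. The goal asks that every slot be earned. *)
Definition slot (v : nat) : bool := (v < K) || (~~ second v && conflict v).

Definition conflict_goal : nat := count slot (iota 0 nverts).

Lemma size_conflict_table : size conflict_table = nverts.
Proof. by rewrite size_map size_iota. Qed.

Lemma nth_conflict_table v : v < nverts -> nth [::] conflict_table v = options v.
Proof. by move=> lt_v; rewrite (nth_map 0) ?size_iota // nth_iota. Qed.

Lemma ncodes_gt0 v : K <= v < nverts -> 0 < ncodes.
Proof. by rewrite /nverts; case: ncodes => //; lia. Qed.

Lemma code_lt v : K <= v < nverts -> (code1 v < ncodes) && (code2 v < ncodes).
Proof.
move=> v_piece; have n0 := ncodes_gt0 v_piece.
rewrite /code1 /code2 ltn_mod n0 andbT ltn_divLR // /gadget ltn_divLR //.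
by move: v_piece; rewrite /nverts; lia.
Qed.

Lemma color_lt x : x < ncodes -> x %/ M < K.
Proof.
rewrite /ncodes; case: M => [|m]; first by rewrite muln0.
by move=> lt_x; rewrite ltn_divLR.
Qed.

Definition vertex (x y : nat) (s : bool) : nat := K + 2 * (x * ncodes + y) + s.

Lemma vertex_spec x y s : x < ncodes -> y < ncodes ->
  [/\ K <= vertex x y s < nverts, second (vertex x y s) = s,
      code1 (vertex x y s) = x & code2 (vertex x y s) = y].
Proof.
move=> lt_x lt_y.
have sub : vertex x y s - K = (x * ncodes + y) * 2 + s by rewrite /vertex; lia.
have g : gadget (vertex x y s) = x * ncodes + y.
  by rewrite /gadget sub divnMDl // divn_small ?addn0 //; case: (s).
split.
- by rewrite /vertex /nverts; nia.
- by rewrite /second sub modnMDl; case: (s).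
- by rewrite /code1 g divnMDl ?divn_small ?addn0 //; lia.
- by rewrite /code2 g modnMDl modn_small.
Qed.

Lemma vertexE v : K <= v < nverts -> v = vertex (code1 v) (code2 v) (second v).
Proof.
move=> v_piece; rewrite /vertex /code1 /code2 -divn_eq.
by rewrite /second /gadget; have := divn_eq (v - K) 2; lia.
Qed.

Lemma code_split v p : p < M -> (v * M + p) %/ M = v.
Proof. by move=> lt_p; rewrite divnMDl ?divn_small ?addn0 //; lia. Qed.

Lemma option_code_lt v p : v < K -> p < M -> v * M + p < ncodes.
Proof. by rewrite /ncodes => lt_v lt_p; nia. Qed.

Lemma is_parent_inj v p p' : v < nverts -> p < M -> p' < M ->
  has_option v p -> has_option v p' ->
  (forall u, u < nverts -> is_parent v p u = is_parent v p' u) -> p = p'.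
Proof.
rewrite /has_option => lt_v lt_p lt_p'.
case: (ltnP v K) => [vK _ _ eqp | _ /andP[/eqP-> _] /andP[/eqP-> _]] //.
have ltx := option_code_lt vK lt_p.
(* The first vertex of the gadget of [(x, x)], with [x] the code of [p], is a parent for option [p]
   by the extra clause of [is_parent], and for [p'] only if the codes agree. *)
have [bnd sec c1 c2] := vertex_spec false ltx ltx.
have /andP[leK ltV] := bnd.
have := eqp _ ltV; rewrite /is_parent vK leK sec c1 c2 !eqxx orbT /=.
by move/esym/eqP/addnI.
Qed.

Lemma is_parent_irr v p : v < nverts -> is_parent v p v = false.
Proof.
rewrite /is_parent; case: (ltnP v K) => [vK|leKv] lt_v //.
have /code_lt/andP[l1 l2] : K <= v < nverts by rewrite leKv.
have := color_lt l1; have := color_lt l2.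
by case: second => c1 c2; apply/negP => /orP[] /eqP; lia.
Qed.

Lemma conflict_table_ok : table_ok conflict_table.
Proof.
apply/forallP => -[v lt_v] /=; move: (lt_v); rewrite size_conflict_table => lt_vV.
rewrite nth_conflict_table //; apply/andP; split.
  rewrite /unzip1 -map_comp map_inj_in_uniq ?filter_uniq ?iota_uniq // => p p'.
  rewrite !mem_filter !mem_iota /= => /andP[hp lp] /andP[hp' lp'] /= eqs.
  apply: (is_parent_inj lt_vV) => // u lt_u.
  have mem q : is_parent v q u = (u \in parent_set v q).
    by rewrite mem_filter mem_iota add0n lt_u !andbT.
  by rewrite !mem eqs.
apply/allP => _ /mapP[p _ ->] /=; apply/and4P; split=> //.
- by apply: sorted_filter; [exact: ltn_trans | exact: iota_ltn_sorted].
- by apply/allP => u; rewrite mem_filter mem_iota => /andP[].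
- by rewrite mem_filter is_parent_irr.
Qed.

Definition conflict_instance : bnsl_instance :=
  BNSLInstance conflict_goal conflict_table_ok.

Local Notation vtype := 'I_(size conflict_table).

Lemma vtype_lt (a : vtype) : a < nverts.
Proof. by rewrite -size_conflict_table. Qed.

Definition attained (R : rel nat) (v : nat) : bool :=
  has (fun p => has_option v p &&
    all (fun u => R u v == is_parent v p u) (iota 0 nverts)) (iota 0 M).

Lemma attainedP R v : reflect
  (exists p, [/\ p < M, has_option v p &
     forall u, u < nverts -> R u v = is_parent v p u]) (attained R v).
Proof.
apply: (iffP hasP) => [[p] | [p [lt_p hp eqp]]].
  rewrite mem_iota => lt_p /andP[hp /allP eqp]; exists p; split=> // u lt_u.
  by apply/eqP/eqp; rewrite mem_iota.
exists p; first by rewrite mem_iota.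
rewrite hp; apply/allP => u; rewrite mem_iota => lt_u.
by rewrite eqp.
Qed.

Lemma count_le1 (T : eqType) (P : pred T) s : uniq s ->
  (forall x y, x \in s -> y \in s -> P x -> P y -> x = y) -> count P s = has P s.
Proof.
move=> us same; case: hasP => [[x xs Px] | none]; last first.
  by apply/eqP; rewrite -leqn0 leqNgt -has_count; apply/hasP.
rewrite -(@eq_in_count _ (pred1 x)) ?count_uniq_mem ?xs // => y ys /=.
by apply/eqP/idP => [->|Py]; last exact: same.
Qed.

Lemma local_scoreE (R : rel nat) (v : vtype) :
  @local_score conflict_table v (parents [rel a b : vtype | R a b] v) =
  attained R v.
Proof.
rewrite /local_score nth_conflict_table ?vtype_lt //.
rewrite /options big_map big_filter_cond /= sum1_count.
rewrite count_le1 ?iota_uniq // => [|p p']; last first.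
  rewrite !mem_iota /= => lp lp' /andP[hp /eqP ep] /andP[hp' /eqP ep'].
  apply: (is_parent_inj (vtype_lt v)) => // u lt_u.
  have lt_u' : u < size conflict_table by rewrite size_conflict_table.
  have /setP/(_ (Ordinal lt_u')) := etrans ep (esym ep').
  by rewrite !inE !mem_filter mem_iota /= add0n lt_u !andbT.
congr nat_of_bool; apply: eq_has => p /=; congr (_ && _).
apply/eqP/allP => [/setP eqs u | eqs].
  rewrite mem_iota /= add0n => lt_u.
  have lt_u' : u < size conflict_table by rewrite size_conflict_table.
  have := eqs (Ordinal lt_u').
  by rewrite !inE !mem_filter mem_iota /= add0n lt_u andbT => ->.
apply/setP => u; rewrite !inE mem_filter mem_iota add0n vtype_lt !andbT /=.
have /eqs/eqP-> // : val u \in iota 0 nverts by rewrite mem_iota add0n vtype_lt.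
Qed.

Lemma bnsl_yes_count : bnsl_yes conflict_instance <->
  exists R : rel nat, acyclic [rel a b : vtype | R a b] /\
    conflict_goal <= count (attained R) (iota 0 nverts).
Proof.
have scoreE (R : rel nat) : score (@local_score conflict_table) [rel a b : vtype | R a b] =
    count (attained R) (iota 0 nverts).
  rewrite /score (eq_bigr _ (fun v _ => local_scoreE R v)) -size_conflict_table.
  rewrite -(big_mkord xpredT (fun v => nat_of_bool (attained R v))).
  rewrite /index_iota subn0 -sum1_count [RHS]big_mkcond.
  by apply: eq_bigr => v _; case: attained.
split=> [[D [acD le]] | [R [acR le]]]; last first.
  by exists [rel a b : vtype | R a b]; split=> //; rewrite scoreE.
pose R (u v : nat) := if (insub u : option vtype, insub v : option vtype) is
  (Some a, Some b) then D a b else false.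
have eqD : D = [rel a b : vtype | R a b].
  by apply/funext => a; apply/funext => b; rewrite /= /R !valK.
by exists R; rewrite -eqD; split=> //; rewrite -scoreE -eqD.
Qed.

Lemma acyclic_pair (R : rel nat) u v : acyclic [rel a b : vtype | R a b] ->
  u < nverts -> v < nverts -> R u v -> R v u -> False.
Proof.
rewrite -size_conflict_table => acR lt_u lt_v uv vu.
have := acR [:: Ordinal lt_u; Ordinal lt_v].
by rewrite /= uv vu => /(_ isT).
Qed.

Lemma acyclic_rank (R : rel nat) (rank : nat -> nat) :
  (forall u v, u < nverts -> v < nverts -> R u v -> rank u < rank v) ->
  acyclic [rel a b : vtype | R a b].
Proof.
move=> mono [//|x s] /= cyc.
have tr : transitive [rel a b : vtype | rank a < rank b].
  by move=> b a c /=; exact: ltn_trans.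
have : path [rel a b : vtype | rank a < rank b] x (rcons s x).
  by apply: sub_path cyc => a b /=; apply: mono; exact: vtype_lt.
move/(order_path_min tr)/allP/(_ x); rewrite mem_rcons inE eqxx /= ltnn.
by move/(_ isT).
Qed.

Definition slot_of (v : nat) : nat := if v < K then v else v - second v.

Lemma slot_ofE v : K <= v < nverts -> slot_of v = vertex (code1 v) (code2 v) false.
Proof.
move=> v_piece; rewrite {1}(vertexE v_piece) /slot_of.
have /andP[l1 l2] := code_lt v_piece.
have [/andP[le_v _] sec _ _] := vertex_spec (second v) l1 l2.
by rewrite ltnNge le_v sec /vertex addnK addn0.
Qed.

Lemma parent_partner x y s p : x < ncodes -> y < ncodes ->
  is_parent (vertex x y s) p (vertex x y (~~ s)).
Proof.
move=> lx ly; have [/andP[le_v _] sec _ _] := vertex_spec s lx ly.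
rewrite /is_parent ltnNge le_v sec /=.
by rewrite /vertex; case: s {sec le_v}; apply/orP; right; apply/eqP; lia.
Qed.

Lemma parent_color x y s p : x < ncodes -> y < ncodes ->
  is_parent (vertex x y s) p ((if s then y else x) %/ M).
Proof.
move=> lx ly; have [/andP[le_v _] sec c1 c2] := vertex_spec s lx ly.
by rewrite /is_parent ltnNge le_v sec c1 c2 /=; case: s {sec le_v c1 c2}; rewrite eqxx.
Qed.

Lemma attained_has R v : attained R v -> slot (slot_of v) || (nverts <= v).
Proof.
case/attainedP=> p [_ hp _]; case: (leqP nverts v) => [_|lt_v]; first by rewrite orbT.
rewrite orbF /slot; case: (ltnP v K) hp => [vK _ | leKv].
  by rewrite /slot_of vK vK.
rewrite /has_option ltnNge leKv /= => /andP[_ conf].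
have v_piece : K <= v < nverts by rewrite leKv.
rewrite slot_ofE //; have /andP[l1 l2] := code_lt v_piece.
by have [_ -> c1 c2] := vertex_spec false l1 l2; rewrite /conflict c1 c2 [bad _ _]conf orbT.
Qed.

(** If both vertices of a gadget scored, each would be a parent of the other, which is a cycle of
    length two. *)
Lemma attained_slot_inj (R : rel nat) u v : acyclic [rel a b : vtype | R a b] ->
  u < nverts -> v < nverts -> attained R u -> attained R v ->
  slot_of u = slot_of v -> u = v.
Proof.
move=> acR lt_u lt_v.
wlog le_uv : u v lt_u lt_v / u <= v.
  move=> wl au av e; case/orP: (leq_total u v) => le; first exact: wl.
  by apply/esym; exact: wl.
move=> /attainedP[p [_ _ pu]] /attainedP[p' [_ _ pv]].
case: (ltnP u K) => [uK | leKu].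
  rewrite {1}/slot_of uK; case: (ltnP v K) => [vK | leKv].
    by rewrite /slot_of vK.
  have v_piece : K <= v < nverts by rewrite leKv.
  by rewrite slot_ofE // /vertex; lia.
have u_piece : K <= u < nverts by rewrite leKu.
have v_piece : K <= v < nverts by rewrite (leq_trans leKu).
have /andP[lu1 lu2] := code_lt u_piece; have /andP[lv1 lv2] := code_lt v_piece.
rewrite !slot_ofE // => e.
have [_ _ c1 c2] := vertex_spec false lu1 lu2.
have [_ _ c1' c2'] := vertex_spec false lv1 lv2.
have e1 : code1 v = code1 u by rewrite -c1 e c1'.
have e2 : code2 v = code2 u by rewrite -c2 e c2'.
case: (eqVneq (second v) (second u)) => [es | ns].
  by rewrite (vertexE u_piece) (vertexE v_piece) e1 e2 es.
have eu := vertexE u_piece.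
have ev : v = vertex (code1 u) (code2 u) (~~ second u).
  by rewrite {1}(vertexE v_piece) e1 e2; case: second ns => //; case: second.
case: (acyclic_pair acR lt_u lt_v).
- by have := parent_partner (~~ second u) p' lu1 lu2; rewrite negbK -eu -ev -pv.
- by have := parent_partner (second u) p lu1 lu2; rewrite -eu -ev -pu.
Qed.

Lemma yes_conflict_free : bnsl_yes conflict_instance -> conflict_free.
Proof.
case/bnsl_yes_count=> R [acR le].
pose A := [seq v <- iota 0 nverts | attained R v].
have AP v : (v \in A) = (v < nverts) && attained R v.
  by rewrite mem_filter mem_iota andbC.
have uB : uniq [seq slot_of v | v <- A].
  rewrite map_inj_in_uniq ?filter_uniq ?iota_uniq // => u v.
  by rewrite !AP => /andP[lu au] /andP[lv av]; exact: (attained_slot_inj acR).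
have sub : {subset [seq slot_of v | v <- A] <= [seq v <- iota 0 nverts | slot v]}.
  move=> s /mapP[v]; rewrite AP => /andP[lv av] ->; rewrite mem_filter mem_iota.
  have := attained_has av; rewrite leqNgt lv orbF => ->; rewrite /= add0n.
  by rewrite /slot_of; case: ifP => // _; exact: leq_ltn_trans (leq_subr _ _) lv.
(* The scoring vertices inject into the slots and are at least as numerous, so every slot is
   earned. *)
have [|_ memB] := uniq_min_size uB sub.
  by rewrite size_map !size_filter.
have att s : s < nverts -> slot s ->
    exists2 v, (v < nverts) && attained R v & slot_of v = s.
  move=> lt_s sl; have : s \in [seq slot_of v | v <- A].
    by rewrite memB mem_filter mem_iota sl.
  by case/mapP=> v; rewrite AP => av ->; exists v.
have core i : i < K -> exists p, (p < M) && [forall u : 'I_nverts, R u i == is_parent i p u].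
  move=> iK; have [||v /andP[lv av] sv] := att i.
  - by rewrite /nverts; lia.
  - by rewrite /slot iK.
  have ev : v = i.
    move: sv; rewrite /slot_of; case: (ltnP v K) => // leKv.
    have := slot_ofE (_ : K <= v < nverts); rewrite leKv lv /slot_of ltnNge leKv /=.
    by move=> /(_ isT) ->; rewrite /vertex; lia.
  case/attainedP: av => p [lp _ pv]; exists p; rewrite lp -ev /=.
  by apply/forallP => u; rewrite pv.
pose sel i := if i < K =P true is ReflectT iK then xchoose (core i iK) else 0.
have selP i : i < K -> sel i < M /\ forall u, u < nverts -> R u i = is_parent i (sel i) u.
  rewrite /sel => iK; case: eqP => // iK'.
  have /andP[-> /forallP eqp] := xchooseP (core i iK'); split=> // u lu.
  exact: (eqP (eqp (Ordinal lu))).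
exists sel; split=> [i iK|i j iK jK]; first by case: (selP i iK).
have [si pi] := selP i iK; have [sj pj] := selP j jK.
set x := i * M + sel i; set y := j * M + sel j; apply/negP => bxy.
have lx : x < ncodes by exact: option_code_lt.
have ly : y < ncodes by exact: option_code_lt.
have [/andP[leK1 lt1] s1 c11 c12] := vertex_spec false lx ly.
have [/andP[leK2 lt2] s2 c21 c22] := vertex_spec true lx ly.
have iV : i < nverts by rewrite /nverts; lia.
have jV : j < nverts by rewrite /nverts; lia.
have [|v /andP[lv av] sv] := att (vertex x y false) lt1.
  by rewrite /slot s1 /conflict c11 c12 bxy orbT.
have v_piece : K <= v < nverts.
  rewrite lv andbT leqNgt; apply/negP => vK; move: sv; rewrite /slot_of vK.
  by rewrite /vertex; lia.
have ev : v = vertex x y (second v).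
  have /andP[lv1 lv2] := code_lt v_piece.
  have [_ _ d1 d2] := vertex_spec false lv1 lv2.
  move: sv; rewrite slot_ofE // => sv.
  have e1 : code1 v = x by rewrite -d1 sv c11.
  have e2 : code2 v = y by rewrite -d2 sv c12.
  by rewrite {1}(vertexE v_piece) e1 e2.
case/attainedP: av => p [_ _ pv].
(* The scoring vertex of the gadget has the colour of its code as a parent, and the chosen option of
   that colour makes the vertex a parent in turn: a cycle of length two. *)
have := parent_color (second v) p lx ly; rewrite -ev -pv; last first.
  by case: second; rewrite /x /y code_split.
move: ev; case: (second v) => ev; rewrite /x /y code_split // => Rc.
- apply: (acyclic_pair acR jV lv Rc); rewrite pj // ev /is_parent jK leK2 s2 c22.
  by rewrite /conflict c21 c22 bxy eqxx.
- apply: (acyclic_pair acR iV lv Rc); rewrite pi // ev /is_parent iK leK1 s1 c11.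
  by rewrite /conflict c11 c12 bxy eqxx.
Qed.

Lemma conflict_free_yes : conflict_free -> bnsl_yes conflict_instance.
Proof.
move=> [sel [sel_lt sel_ok]].
pose chosen x := sel (x %/ M) == x %% M.
have chosenE x : chosen x -> x = x %/ M * M + sel (x %/ M).
  by move/eqP->; exact: divn_eq.
have chosen_opt i : i < K -> chosen (i * M + sel i).
  move=> iK; have lt := sel_lt i iK.
  by rewrite /chosen code_split // modnMDl modn_small.
have chosen_ok x y : x < ncodes -> y < ncodes -> chosen x -> chosen y -> ~~ bad x y.
  move=> lx ly cx cy; rewrite (chosenE x cx) (chosenE y cy).
  by apply: sel_ok; exact: color_lt.
(* In the gadget of a conflict [(x, y)] the second vertex, attached to the colour of [y], scores if
   [x] is chosen, since then [y] is not; otherwise the first vertex scores. *)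
pose served v := conflict v && (chosen (code1 v) == second v).
pose R u v := if v < K then is_parent v (sel v) u else served v && is_parent v 0 u.
(* Unserved gadget vertices have no parents. Those of a core vertex are unserved, and those of a
   served vertex are a core vertex and its unserved partner. *)
pose rank v := if v < K then 1 else (served v).*2.
apply/bnsl_yes_count; exists R; split.
  apply: (@acyclic_rank R rank) => u v lt_u lt_v; rewrite /R /rank.
  case: (ltnP v K) => [vK | leKv].
    rewrite /is_parent vK => /andP[leKu par]; rewrite (ltnNge u K) leKu /=.
    have := @code_lt u; rewrite leKu lt_u => /(_ isT)/andP[l1 l2].
    suff -> : served u = false by [].
    apply/negP => /andP[conf]; move: par; rewrite conf /=.
    case: second => /eqP ec; rewrite ?eqb_id.
      move=> c1; have := chosen_ok _ _ l1 l2 c1; rewrite [bad _ _]conf ec.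
      by move=> /(_ (chosen_opt _ vK)).
    by rewrite ec chosen_opt.
  have v_piece : K <= v < nverts by rewrite leKv.
  move=> /andP[sv]; rewrite sv; case: (ltnP u K) => // leKu.
  have /andP[l1 l2] := code_lt v_piece.
  rewrite /is_parent ltnNge leKv /= => par.
  suff -> : served u = false by [].
  have cu1 := color_lt l1; have cu2 := color_lt l2.
  have eu : u = vertex (code1 v) (code2 v) (~~ second v).
    move: par; rewrite {3 5}(vertexE v_piece).
    by case: second => /orP[] /eqP; rewrite /vertex /=; lia.
  have [_ su cu _] := vertex_spec (~~ second v) l1 l2; rewrite -eu in su cu.
  rewrite /served cu su; apply/negP => /andP[_ ne]; case/andP: sv => _ e.
  by move: ne e; case: (chosen _); case: (second v).
rewrite /conflict_goal -!size_filter -[leqRHS](size_map slot_of).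
apply: uniq_leq_size; first by rewrite filter_uniq ?iota_uniq.
move=> s; rewrite mem_filter mem_iota add0n => /andP[sl /= lt_s].
have att v : v < nverts -> attained R v -> slot_of v = s ->
    s \in [seq slot_of v | v <- [seq v <- iota 0 nverts | attained R v]].
  by move=> lv av <-; apply: map_f; rewrite mem_filter av mem_iota.
case: (ltnP s K) sl => [sK _ | leKs].
  apply: (att s) => //; last by rewrite /slot_of sK.
  apply/attainedP; exists (sel s); split; rewrite ?sel_lt /has_option ?sK //.
  by move=> u _; rewrite /R sK.
rewrite /slot ltnNge leKs /= => /andP[nsec conf].
have s_piece : K <= s < nverts by rewrite leKs.
have /andP[l1 l2] := code_lt s_piece.
pose v := vertex (code1 s) (code2 s) (chosen (code1 s)).
have [v_piece sv cv1 cv2] := vertex_spec (chosen (code1 s)) l1 l2.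
have /andP[leKv lv] := v_piece.
apply: (att v) => //; last first.
  by rewrite slot_ofE // cv1 cv2 {3}(vertexE s_piece) (negbTE nsec).
have M_gt0 : 0 < M by have := ncodes_gt0 s_piece; rewrite muln_gt0 => /andP[].
apply/attainedP; exists 0; split=> //.
  by rewrite /has_option /conflict cv1 cv2 [bad _ _]conf orbT.
move=> u _; rewrite /R ltnNge leKv /= /served /conflict cv1 cv2 sv eqxx andbT.
by rewrite [bad _ _]conf.
Qed.

Theorem conflict_instanceP : bnsl_yes conflict_instance <-> conflict_free.
Proof. by split; [exact: yes_conflict_free | exact: conflict_free_yes]. Qed.

(** * Treecut width of the instance *)

Lemma potential_parentP (a b : vtype) :
  a \in potential_parents (@local_score conflict_table) b ->
  exists p, [/\ p < M, has_option b p & is_parent b p a].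
Proof.
case/bigcupP=> Z; rewrite inE => /andP[_ nz] aZ.
move: nz; rewrite /local_score nth_conflict_table ?vtype_lt //.
rewrite sum_nat_seq_neq0 => /hasP[o /mapP[p]]; rewrite mem_filter mem_iota add0n.
move=> /andP[hp lp] -> /= /andP[/eqP eZ _]; exists p; split=> //.
by move: aZ; rewrite -eZ inE mem_filter => /andP[].
Qed.

Theorem conflict_instance_width :
  superstructure_treecut_width conflict_instance <= maxn K 3.
Proof.
pose core := [set a : vtype | a < K].
pose piece (a : vtype) : 'I_nverts.+1 := inord (gadget a).
pose G := superstructure (@local_score conflict_table).
have gadget_lt (a : vtype) : gadget a < nverts.+1.
  by have := vtype_lt a; rewrite /gadget; have := leq_div (a - K) 2; lia.
have dir_piece (a b : vtype) : K <= a -> K <= b ->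
    a \in potential_parents (@local_score conflict_table) b -> gadget a = gadget b.
  move=> leKa leKb /potential_parentP[p [_ _]].
  have b_piece : K <= b < nverts by rewrite leKb vtype_lt.
  have /andP[l1 l2] := code_lt b_piece.
  have := color_lt l1; have := color_lt l2.
  rewrite /is_parent (ltnNge b K) leKb /= /second /gadget.
  by case: eqP => sec c1 c2 /orP[] /eqP; lia.
(* Both kinds of arcs between a gadget vertex and the core lead to the same core vertex, the colour
   of the code on its side of the pair. *)
have color (a b : vtype) : K <= a -> b < K -> G a b ->
    b = (if second a then code2 a else code1 a) %/ M :> nat.
  move=> leKa bK /orP[] /potential_parentP[p [lp _]].
    rewrite /is_parent bK leKa; case: second => /= /andP[_ /eqP->];
      by rewrite code_split.
  rewrite /is_parent ltnNge leKa /= /second.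
  by case: eqP => sec /orP[] /eqP //; lia.
have coreK : #|core| <= K.
  case: (posnP K) => [K0 | K0].
    by rewrite K0 leqn0 cards_eq0; apply/eqP/setP => a; rewrite !inE K0.
  pose f (a : vtype) : 'I_K := insubd (Ordinal K0) (val a).
  rewrite -[leqRHS]card_ord -(card_in_imset (f := f) (D := core)).
    exact: max_card.
  move=> a b; rewrite !inE => aK bK /(congr1 val).
  by rewrite /f !val_insubd aK bK => /val_inj.
rewrite /superstructure_treecut_width -/G.
apply: leq_trans (_ : maxn #|core| 3 <= _); last first.
  by rewrite geq_max leq_max coreK leq_maxr.
apply: (@star_treecut_width _ _ G core piece (fun a => second a)).
- by move=> a b; rewrite /G /superstructure /= orbC.
- move=> a b; rewrite !inE -!leqNgt => leKa leKb /orP[] /dir_piece e;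
    by rewrite /piece e.
- move=> a b b'; rewrite !inE -leqNgt => leKa bK b'K /color e /color e'.
  by apply: val_inj; rewrite /= e // e'.
- move=> a b; rewrite !inE -!leqNgt => leKa leKb /(congr1 val).
  rewrite /= !inordK // => eg es; apply: val_inj.
  move: es; rewrite /= /second; move: eg; rewrite /gadget.
  have := divn_eq (a - K) 2; have := divn_eq (b - K) 2.
  have := ltn_mod (a - K) 2; have := ltn_mod (b - K) 2.
  by do 2!case: eqP; lia.
Qed.

End ConflictTable.

(** * From weighted circuit satisfiability to conflict-free selection *)

Definition digit (b x t : nat) : nat := x %/ b ^ t %% b.

Fixpoint of_digits (b n : nat) (f : nat -> nat) : nat :=
  if n is n'.+1 then of_digits b n' (fun t => f t.+1) * b + f 0 else 0.

Lemma of_digits_lt b n f : (forall t, t < n -> f t < b) -> of_digits b n f < b ^ n.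
Proof.
elim: n f => //= n IHn f lt_f.
have lt : of_digits b n (fun t => f t.+1) < b ^ n by apply: IHn => t; exact: (lt_f t.+1).
rewrite expnSr; apply: (@leq_trans ((of_digits b n (fun t => f t.+1)).+1 * b)).
  by rewrite mulSn; have := lt_f 0 isT; lia.
by rewrite leq_mul2r lt orbT.
Qed.

Lemma digit_of_digits b n f t : (forall t, t < n -> f t < b) -> t < n ->
  digit b (of_digits b n f) t = f t.
Proof.
elim: n f t => //= n IHn f t lt_f; have f0 : f 0 < b by exact: lt_f.
case: t => [_|t lt_t]; first by rewrite /digit expn0 divn1 modnMDl modn_small.
rewrite /digit expnS divnMA divnMDl ?(divn_small f0) ?addn0; last by lia.
by apply: (IHn (fun t => f t.+1)) => // u; exact: (lt_f u.+1).
Qed.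

Section Certificates.

(* [d] bounds the depth and [k] is the weight; gate [g] among [s] gates has kind
   [kd g] (as in [gate_code]), arity [ar g] and in-neighbours [ch g t]. *)
Variables (d k s : nat) (kd ar : nat -> nat) (ch : nat -> nat -> nat).

(** Evaluation with fuel [d.+1] reaches at most [2 ^ d.+1] inputs, and each takes two consecutive
    indices to be pinned down. The numbers of the paths that it follows from 1 stay below the same
    bound. *)
Definition ndigits : nat := 2 ^ d.+2.
Definition ncolors : nat := k.+2 ^ ndigits.
Definition noptions : nat := s.+2 ^ (ndigits + ndigits).

(* The set of true inputs is given by the increasing sequence of their positions
   counted from 1, extended by the sentinels 0 at index 0 and [s.+1] at index
   [k.+1].  A colour is a tuple of indices.  An option of it assigns a position
   to each index of the tuple, and a claim to each path from the output that
   may lead to a gate of large fan-in. *)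
Definition index_at (x t : nat) : nat := digit k.+2 (x %/ noptions) t.
Definition position_at (x t : nat) : nat := digit s.+2 (x %% noptions) t.
Definition claim_at (x p : nat) : nat := digit s.+2 (x %% noptions) (ndigits + p).

(* Kleene's truth values: 0 is false, 1 is unknown and 2 is true. *)
Definition known_input (x g : nat) : nat :=
  if has (fun t => [&& 0 < index_at x t, index_at x t < k.+1
                     & position_at x t == g.+1]) (iota 0 ndigits) then 2
  else if has (fun t => has (fun t' => [&& index_at x t' == (index_at x t).+1,
             position_at x t < g.+1 & g.+1 < position_at x t'])
           (iota 0 ndigits)) (iota 0 ndigits) then 0
  else 1.

(* The path 1 is the output, and the children of the path [p] are [2 p] and
   [2 p + 1]; the path 0 stands for evaluation without claims. *)
Definition right_path (p : nat) : nat := if p == 0 then 0 else p.*2.+1.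

(* A claim 0 says that all in-neighbours have the value that is neutral for the
   gate, and a claim [t + 1] says that in-neighbour [t] has the other one. *)
Definition claimed (x p g : nat) : bool := (kd g == 2) == (claim_at x p == 0).

(** Conjunction is the minimum and disjunction the maximum of truth values, written with the
    truncated subtraction of the machine. Without claims, as when the fuel runs out, a large gate is
    unknown. *)
Fixpoint kleene (f p x g : nat) : nat :=
  if f is f'.+1 then
    if kd g == 0 then known_input x g
    else if kd g == 1 then 2 - kleene f' p.*2 x (ch g 0)
    else if ar g <= 2 then
      let v0 := kleene f' p.*2 x (ch g 0) in
      let v1 := kleene f' (right_path p) x (ch g 1) in
      if kd g == 2 then v0 - (v0 - v1) else v0 + (v1 - v0)
    else if p == 0 then 1 else if claimed x p g then 2 else 0
  else 1.

Definition agrees (b : bool) (v : nat) : bool := if b then v != 0 else v != 2.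

(** In-neighbours of a large gate are evaluated on path 0 with full fuel, and unknown values pass. A
    false claim is thus refuted only by an option whose tuple covers the in-neighbour concerned. *)
Fixpoint claims_ok (f p x g : nat) : bool :=
  if f is f'.+1 then
    if kd g == 0 then true
    else if kd g == 1 then claims_ok f' p.*2 x (ch g 0)
    else if ar g <= 2 then
      claims_ok f' p.*2 x (ch g 0) && claims_ok f' (right_path p) x (ch g 1)
    else if claim_at x p == 0 then
      all (fun t => agrees (kd g == 2) (kleene d.+1 0 x (ch g t))) (iota 0 (ar g))
    else ((claim_at x p).-1 < ar g) &&
         agrees (kd g != 2) (kleene d.+1 0 x (ch g (claim_at x p).-1))
  else true.

Definition checked (x : nat) : bool :=
  [&& all (fun t => [&& (index_at x t == 0) ==> (position_at x t == 0),
             (index_at x t == k.+1) ==> (position_at x t == s.+1)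
           & (0 < index_at x t) && (index_at x t < k.+1) ==>
             (kd (position_at x t).-1 == 0)]) (iota 0 ndigits),
      claims_ok d.+1 1 x s.-1 & agrees true (kleene d.+1 1 x s.-1)].

Definition consistent (x y : nat) : bool :=
  all (fun t => all (fun t' =>
    ((index_at x t == index_at y t') ==> (position_at x t == position_at y t')) &&
    ((index_at x t < index_at y t') ==> (position_at x t < position_at y t')))
    (iota 0 ndigits)) (iota 0 ndigits) &&
  all (fun p => claim_at x p == claim_at y p) (iota 0 ndigits).

(** Testing [checked] on one side is enough because all ordered pairs are compared. The diagonal
    also forces the positions within a single tuple to increase with their indices. *)
Definition in_conflict (x y : nat) : bool := ~~ (checked x && consistent x y).

Lemma ndigits_gt0 : 0 < ndigits. Proof. by rewrite expn_gt0. Qed.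

Lemma noptions_gt0 : 0 < noptions. Proof. by rewrite expn_gt0. Qed.

Lemma index_lt x t : index_at x t < k.+2. Proof. by rewrite ltn_mod. Qed.

Definition truth (b : bool) : nat := if b then 2 else 0.

Definition approximates (v : nat) (b : bool) : bool := (v == 1) || (v == truth b).

Lemma approximates_agrees v b : approximates v b -> agrees b v.
Proof. by case: b => /orP[] /eqP->. Qed.

(** * Inputs known from an increasing sequence *)

Section Positions.

Variable pos : nat -> nat.
Hypothesis pos0 : pos 0 = 0.
Hypothesis pos_last : pos k.+1 = s.+1.
Hypothesis pos_mono : forall i j, i < j -> j <= k.+1 -> pos i < pos j.

Definition selected (g : nat) : bool := has (fun i => pos i == g.+1) (iota 1 k).

Definition follows (x : nat) : Prop :=
  forall t, t < ndigits -> position_at x t = pos (index_at x t).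

Lemma selectedP g : reflect (exists2 i, 0 < i <= k & pos i = g.+1) (selected g).
Proof.
apply: (iffP hasP) => [[i ik /eqP e] | [i ik e]]; exists i => //.
- by move: ik; rewrite mem_iota add1n ltnS.
- by rewrite mem_iota add1n ltnS.
- by rewrite e.
Qed.

Lemma selected_gap g i : i <= k -> pos i < g.+1 < pos i.+1 -> ~~ selected g.
Proof.
move=> le_ik /andP[lo hi]; apply/negP => /selectedP[j /andP[j0 jk] e].
rewrite -e in lo hi.
have : ~~ (j <= i).
  apply/negP; rewrite leq_eqVlt => /orP[/eqP ej | lt_ji].
    by rewrite ej ltnn in lo.
  have : pos j < pos i by apply: pos_mono => //; lia.
  by lia.
rewrite -ltnNge leq_eqVlt => /orP[/eqP ej | lt_ij].
  by rewrite ej ltnn in hi.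
have : pos i.+1 < pos j by apply: pos_mono => //; lia.
by lia.
Qed.

Lemma known_input_approximates x g :
  follows x -> approximates (known_input x g) (selected g).
Proof.
move=> fx; rewrite /known_input; case: hasP => [[t] | none].
  rewrite mem_iota => lt_t /and3P[i0 ik /eqP e].
  suff -> : selected g by [].
  apply/selectedP; exists (index_at x t); last by rewrite -fx.
  by rewrite i0 -ltnS.
case: hasP => [[t] | _ //]; rewrite mem_iota => lt_t /hasP[t'].
rewrite mem_iota => lt_t' /and3P[/eqP e lo hi].
rewrite !fx // e in lo hi; have := index_lt x t'; rewrite e => ik.
by rewrite (negbTE (@selected_gap g (index_at x t) _ _)) ?lo.
Qed.

Lemma known_input_exact x g i t t' : follows x -> t < ndigits -> t' < ndigits ->
  index_at x t = i -> index_at x t' = i.+1 -> pos i <= g.+1 < pos i.+1 ->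
  known_input x g = truth (selected g).
Proof.
move=> fx lt_t lt_t' et et' /andP[]; rewrite leq_eqVlt => /orP[/eqP ei | lo] hi.
all: have := index_lt x t'; rewrite et' ltnS => ik.
  have i0 : 0 < i by case: i ei {et et' hi ik} => //; rewrite pos0.
  have -> : selected g by apply/selectedP; exists i; rewrite ?i0.
  rewrite /known_input (_ : has _ _) //; apply/hasP; exists t.
    by rewrite mem_iota.
  by rewrite fx // et i0 ik ei /=.
have nsel : ~~ selected g by apply: (@selected_gap _ i); rewrite ?lo.
have := known_input_approximates g fx; rewrite /known_input (negbTE nsel).
case: ifP => // _ _; rewrite ifT //.
apply/hasP; exists t; first by rewrite mem_iota.
apply/hasP; exists t'; first by rewrite mem_iota.
by rewrite !fx // et et' eqxx lo hi.
Qed.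

Lemma gap_exists g : g < s -> exists2 i, i <= k & pos i <= g.+1 < pos i.+1.
Proof.
move=> lt_g.
suff find n : g.+1 < pos n -> exists2 i, i < n & pos i <= g.+1 < pos i.+1.
  by have [|i lt_i e] := find k.+1; [rewrite pos_last | exists i].
elim: n => [|n IHn]; first by rewrite pos0.
move=> hi; case: (leqP (pos n) g.+1) => [lo|lt].
  by exists n => //; rewrite lo.
by have [i lt_i e] := IHn lt; exists i => //; exact: ltnW.
Qed.

(** Each listed input lies between two consecutive terms of the sequence, the lower one included. A
    tuple containing the indices of both decides whether the input is true, and it has room for two
    indices per input. *)
Lemma cover_exists (l : seq nat) : 0 < s -> all (fun g => g < s) l ->
  (size l).*2 <= ndigits ->
  exists2 I, I < ncolors & forall x, x %/ noptions = I -> follows x ->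
    forall g, g \in l -> known_input x g = truth (selected g).
Proof.
move=> s0 lt_l szl.
pose P g i := (i <= k) && (pos i <= g.+1 < pos i.+1).
pose gap g := find (P g) (iota 0 k.+1).
have gapP g : g < s -> P g (gap g).
  move=> lt_g; have hasP : has (P g) (iota 0 k.+1).
    have [i ik ei] := gap_exists lt_g; apply/hasP; exists i.
      by rewrite mem_iota.
    by rewrite /P ik.
  have := nth_find 0 hasP; rewrite nth_iota //.
  by move: hasP; rewrite has_find size_iota.
have gap_le g : g < s -> gap g <= k by move/gapP/andP=> [].
have lt_nth t : nth 0 l t < s.
  case: (ltnP t (size l)) => lt_t; last by rewrite nth_default.
  by apply: (allP lt_l); exact: mem_nth.
(* Digits [2 j] and [2 j + 1] are the two ends of the gap of the [j]-th listed input. Digits past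
   the list use the default input 0, which is in range by [0 < s]. *)
pose f t := gap (nth 0 l t./2) + odd t.
have lt_f t : t < ndigits -> f t < k.+2.
  by move=> _; have := gap_le _ (lt_nth t./2); rewrite /f; case: odd; lia.
exists (of_digits k.+2 ndigits f); first exact: of_digits_lt.
have dI t : t < ndigits -> digit k.+2 (of_digits k.+2 ndigits f) t = f t.
  exact: digit_of_digits.
move=> x xI fx g gl.
have lt_g : g < s by exact: (allP lt_l).
have lt_i : (index g l).*2.+1 < ndigits.
  by apply: leq_trans szl; rewrite -doubleS leq_double index_mem.
have /andP[_ bnd] := gapP g lt_g.
have ev : index_at x (index g l).*2 = gap g.
  rewrite /index_at xI dI; last exact: ltnW.
  by rewrite /f doubleK odd_double nth_index ?addn0.
have od : index_at x (index g l).*2.+1 = (gap g).+1.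
  by rewrite /index_at xI dI // /f /= uphalf_double odd_double nth_index // addn1.
exact: (known_input_exact fx (ltnW lt_i) lt_i ev od bnd).
Qed.

End Positions.

(** * Evaluating the circuit *)

Section Circuit.

Variable C : circuit.
Hypothesis sizeC : size C = s.
Hypothesis C_ok : circuit_ok C.
Hypothesis weftC : circuit_weft C <= 1.
Hypothesis depthC : circuit_depth C <= d.
Hypothesis kdE : forall g, g < s -> kd g = (gate_code (nth Input C g)).1.
Hypothesis arE : forall g, g < s -> ar g = size (fanin (nth Input C g)).
Hypothesis chE : forall g t, g < s -> t < ar g ->
  ch g t = nth 0 (fanin (nth Input C g)) t.

Lemma s_gt0 : 0 < s. Proof. by rewrite -sizeC; case/andP: C_ok. Qed.

Lemma output_lt : s.-1 < s. Proof. by rewrite prednK ?leqnn ?s_gt0. Qed.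

Lemma gate_okE g : g < s -> gate_ok g (nth Input C g).
Proof.
rewrite -sizeC => lt_g; case/andP: C_ok => _ /forallP/(_ (Ordinal lt_g)).
by [].
Qed.

Lemma sweep_rcons T (F : nat -> gate -> seq T -> T) (C' : circuit) g :
  sweep F (rcons C' g) =
  rcons (sweep F C') (F (size (sweep F C')) g (sweep F C')).
Proof. by rewrite /sweep -cats1 foldl_cat. Qed.

Lemma size_sweep T (F : nat -> gate -> seq T -> T) (C' : circuit) :
  size (sweep F C') = size C'.
Proof. by elim/last_ind: C' => // C' g IH; rewrite sweep_rcons !size_rcons IH. Qed.

Lemma nth_sweep T (F : nat -> gate -> seq T -> T) x0 (C' : circuit) g :
  g < size C' -> nth x0 (sweep F C') g =
                 F g (nth Input C' g) (take g (sweep F C')).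
Proof.
elim/last_ind: C' => // C' h IH; rewrite size_rcons ltnS leq_eqVlt sweep_rcons.
rewrite !nth_rcons size_sweep -cats1 take_cat size_sweep.
case/orP=> [/eqP-> | lt_g]; last by rewrite lt_g IH.
by rewrite ltnn eqxx subnn take0 cats0.
Qed.

Lemma last_sweep T (F : nat -> gate -> seq T -> T) x0 :
  last x0 (sweep F C) = nth x0 (sweep F C) s.-1.
Proof. by rewrite -nth_last size_sweep sizeC. Qed.

Lemma child_fanin g t : g < s -> t < ar g -> ch g t \in fanin (nth Input C g).
Proof. by move=> lt_g lt_t; rewrite chE // mem_nth // -arE. Qed.

Lemma child_lt g t : g < s -> t < ar g -> ch g t < g.
Proof.
move=> lt_g lt_t; case/and3P: (gate_okE lt_g) => /allP lt _ _.
exact/lt/child_fanin.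
Qed.

(** In-neighbours are distinct and precede the gate. The bound lets a claim, which may name any
    in-neighbour, fit in one digit to the base [s.+2]. *)
Lemma ar_le g : g < s -> ar g <= g.
Proof.
move=> lt_g; case/and3P: (gate_okE lt_g) => /allP lt un _.
rewrite arE // -[g in leqRHS](size_iota 0); apply: uniq_leq_size => // j /lt.
by rewrite mem_iota.
Qed.

Definition depth_at (g : nat) : nat := nth 0 (sweep (fun _ g acc =>
  if is_input g then 0 else (\max_(j <- fanin g) nth 0 acc j).+1) C) g.

Definition weft_at (g : nat) : nat := nth 0 (sweep (fun _ g acc =>
  (2 < size (fanin g)) + \max_(j <- fanin g) nth 0 acc j) C) g.

Lemma depth_child g t : g < s -> t < ar g -> depth_at (ch g t) < depth_at g.
Proof.
move=> lt_g lt_t; have fan := child_fanin lt_g lt_t; have lt := child_lt lt_g lt_t.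
rewrite [X in _ < X]/depth_at nth_sweep ?sizeC //.
have -> : is_input (nth Input C g) = false by case: nth fan.
rewrite ltnS; apply: leq_trans (leq_bigmax_seq _ fan isT).
by rewrite nth_take.
Qed.

Lemma weft_child g t : g < s -> t < ar g ->
  (2 < ar g) + weft_at (ch g t) <= weft_at g.
Proof.
move=> lt_g lt_t; have fan := child_fanin lt_g lt_t; have lt := child_lt lt_g lt_t.
rewrite [leqRHS]/weft_at nth_sweep ?sizeC // arE // leq_add2l.
by apply: leq_trans (leq_bigmax_seq _ fan isT); rewrite nth_take.
Qed.

Section Evaluation.

Variable a : nat -> bool.

Definition value_step (i : nat) (g : gate) (acc : seq bool) : bool :=
  match g with
  | Input => a i
  | Neg j => ~~ nth false acc j
  | And s => all (nth false acc) s
  | Or s => has (nth false acc) s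
  end.

Definition value_at (g : nat) : bool := nth false (sweep value_step C) g.

Variant gate_view (g : nat) : Prop :=
| GateInput of kd g = 0 & value_at g = a g
| GateNeg of kd g = 1 & 0 < ar g & value_at g = ~~ value_at (ch g 0)
| GateAnd of kd g = 2 & 1 < ar g &
    value_at g = all (fun t => value_at (ch g t)) (iota 0 (ar g))
| GateOr of kd g = 3 & 1 < ar g &
    value_at g = has (fun t => value_at (ch g t)) (iota 0 (ar g)).

Lemma gateP g : g < s -> gate_view g.
Proof.
move=> lt_g.
have ok := gate_okE lt_g; have K1 := kdE lt_g; have A1 := arE lt_g.
have chs t : t < ar g -> value_at (ch g t) =
    nth false (take g (sweep value_step C)) (nth 0 (fanin (nth Input C g)) t).
  by move=> lt_t; rewrite -chE // nth_take ?child_lt.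
have V1 : value_at g = value_step g (nth Input C g) (take g (sweep value_step C)).
  by rewrite /value_at nth_sweep ?sizeC.
case E : (nth Input C g) ok K1 A1 chs V1 => [|j|l|l] /and3P[_ _ sz] /= K1 A1 chs V1.
- exact: GateInput.
- by apply: GateNeg; rewrite ?A1 // V1 chs ?A1.
- apply: GateAnd; rewrite ?A1 // V1 -[in LHS](mkseq_nth 0 l) all_map.
  by apply: eq_in_all => t; rewrite mem_iota => lt_t /=; rewrite chs ?A1.
- apply: GateOr; rewrite ?A1 // V1 -[in LHS](mkseq_nth 0 l) has_map.
  by apply: eq_in_has => t; rewrite mem_iota => lt_t /=; rewrite chs ?A1.
Qed.

Definition neutral (g : nat) : bool :=
  all (fun t => value_at (ch g t) == (kd g == 2)) (iota 0 (ar g)).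

(** Handles conjunctions and disjunctions at once, in the form in which [claimed] reads a claim. *)
Lemma value_neutral g : g < s -> 1 < kd g ->
  value_at g = ((kd g == 2) == neutral g).
Proof.
move=> lt_g; rewrite /neutral; case: (gateP lt_g) => -> //= _ -> _.
  by rewrite eq_sym eqb_id; apply: eq_all => t; rewrite eqb_id.
rewrite -[LHS]negbK -all_predC eq_sym eqbF_neg; congr (~~ _).
by apply: eq_all => t; rewrite /= eqbF_neg.
Qed.

(** The semantic counterpart of [claims_ok]: the claims give the large gates their true values,
    whichever in-neighbours they name. *)
Fixpoint claims_true (f p x g : nat) : Prop :=
  if f is f'.+1 then
    if kd g == 0 then True
    else if kd g == 1 then claims_true f' p.*2 x (ch g 0)
    else if ar g <= 2 then
      claims_true f' p.*2 x (ch g 0) /\ claims_true f' (right_path p) x (ch g 1)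
    else p = 0 \/ claimed x p g = value_at g
  else True.

Lemma claims_true0 f x g : claims_true f 0 x g.
Proof.
elim: f g => //= f IHf g; case: ifP => // _; case: ifP => // _.
by case: ifP => _; [split; exact: IHf | left].
Qed.

(** The inputs on which [kleene] depends; the descent stops at large gates, whose values come from
    claims. *)
Fixpoint leaves (f g : nat) : seq nat :=
  if f is f'.+1 then
    if kd g == 0 then [:: g]
    else if kd g == 1 then leaves f' (ch g 0)
    else if ar g <= 2 then leaves f' (ch g 0) ++ leaves f' (ch g 1)
    else [::]
  else [::].

Lemma size_leaves f g : size (leaves f g) <= 2 ^ f.
Proof.
elim: f g => //= f IHf g; have := expn_gt0 2 f; rewrite expnS /= => pos.
case: ifP => [_ /=|_]; first by lia.
case: ifP => [_|_]; first by have := IHf (ch g 0); lia.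
case: ifP => // _; rewrite size_cat.
by have := IHf (ch g 0); have := IHf (ch g 1); lia.
Qed.

Lemma leaves_lt f g : g < s -> all (fun h => h < s) (leaves f g).
Proof.
elim: f g => //= f IHf g lt_g.
have sub t : t < ar g -> ch g t < s.
  by move=> lt_t; apply: ltn_trans (child_lt lt_g lt_t) lt_g.
case: (gateP lt_g) => -> /=; first by rewrite lt_g.
all: move=> ge _.
- by apply: IHf; exact: sub.
- by case: ifP => // _; rewrite all_cat !IHf ?sub //; lia.
- by case: ifP => // _; rewrite all_cat !IHf ?sub //; lia.
Qed.

Lemma all_iota2 (P : pred nat) n : 1 < n -> n <= 2 -> all P (iota 0 n) = P 0 && P 1.
Proof. by case: n => [|[|[|n]]] //= _ _; rewrite andbT. Qed.

Lemma has_iota2 (P : pred nat) n : 1 < n -> n <= 2 -> has P (iota 0 n) = P 0 || P 1.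
Proof. by case: n => [|[|[|n]]] //= _ _; rewrite orbF. Qed.

(** Unknown values come from exhausted fuel, from a large gate met on path 0, or from unknown
    inputs; the depth bound, the weft condition and the hypothesis on the leaves exclude them. The
    remaining hypothesis makes the claimed values correct. *)
Lemma kleene_exact f p x g : g < s -> depth_at g < f ->
  (p = 0 -> weft_at g = 0) -> claims_true f p x g ->
  (forall h, h \in leaves f g -> known_input x h = truth (a h)) ->
  kleene f p x g = truth (value_at g).
Proof.
elim: f p g => //= f IHf p g lt_g dp weft ct kn.
have sub t : t < ar g -> forall p', (p' = 0 -> p = 0) ->
    claims_true f p' x (ch g t) ->
    (forall h, h \in leaves f (ch g t) -> known_input x h = truth (a h)) ->
    kleene f p' x (ch g t) = truth (value_at (ch g t)).
  move=> lt_t p' p0 ct' kn'; apply: IHf => //.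
  - exact: ltn_trans (child_lt lt_g lt_t) lt_g.
  - by have := depth_child lt_g lt_t; lia.
  - by move=> /p0/weft; have := weft_child lt_g lt_t; lia.
have p2 : p.*2 = 0 -> p = 0 by lia.
have pr : right_path p = 0 -> p = 0 by rewrite /right_path; case: eqP; lia.
have large : 2 < ar g -> p = 0 -> False.
  move=> ar2 /weft w0; have := @weft_child g 0 lt_g.
  by rewrite w0 ar2; move/(_ (ltn_trans (isT : 0 < 2) ar2)).
have two : 1 < ar g ->
    claims_true f p.*2 x (ch g 0) /\ claims_true f (right_path p) x (ch g 1) ->
    (forall h, h \in leaves f (ch g 0) ++ leaves f (ch g 1) ->
       known_input x h = truth (a h)) ->
    kleene f p.*2 x (ch g 0) = truth (value_at (ch g 0)) /\
    kleene f (right_path p) x (ch g 1) = truth (value_at (ch g 1)).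
  move=> ge [ct0 ct1] kn'; split; apply: sub => //; first exact: ltnW.
    by move=> h hl; apply: kn'; rewrite mem_cat hl.
  by move=> h hl; apply: kn'; rewrite mem_cat hl orbT.
move: ct kn; case: (gateP lt_g) => [-> ->|-> ge ->|K ge V|K ge V] /=.
- by move=> _; apply; rewrite inE.
- by move=> ct kn; rewrite sub //; case: value_at.
- rewrite K /=; case: ifP => [le2 ct kn | gt2 ct _].
    have [-> ->] := two ge ct kn.
    by rewrite V all_iota2 //; do 2!case: value_at.
  have ar2 : 2 < ar g by rewrite ltnNge gt2.
  case: eqP => [/(large ar2)|_] //.
  by case: ct => [/(large ar2)|->] //; case: value_at.
- rewrite K /=; case: ifP => [le2 ct kn | gt2 ct _].
    have [-> ->] := two ge ct kn.
    by rewrite V has_iota2 //; do 2!case: value_at.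
  have ar2 : 2 < ar g by rewrite ltnNge gt2.
  case: eqP => [/(large ar2)|_] //.
  by case: ct => [/(large ar2)|->] //; case: value_at.
Qed.

(** Exhausted fuel and large gates on path 0 only introduce unknown values, and Kleene's connectives
    yield a definite value only when it is forced. *)
Lemma kleene_approximates f p x g : g < s -> claims_true f p x g ->
  (forall h, h < s -> kd h = 0 -> approximates (known_input x h) (a h)) ->
  approximates (kleene f p x g) (value_at g).
Proof.
move=> lt_g ct kn; elim: f p g lt_g ct => //= f IHf p g lt_g.
have sub t : t < ar g -> ch g t < s.
  by move=> lt_t; apply: ltn_trans (child_lt lt_g lt_t) lt_g.
case: (gateP lt_g) => [K V|K ge V|K ge V|K ge V]; rewrite K /= => ct.
- by rewrite V; exact: kn.
- by rewrite V; have /orP[] := IHf _ _ (sub 0 ge) ct; case: value_at => /eqP->.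
- case: ifP ct => [le2 [ct0 ct1] | gt2 ct].
    rewrite V all_iota2 //.
    have := IHf _ _ (sub 0 (ltnW ge)) ct0; have := IHf _ _ (sub 1 ge) ct1.
    by do 2!case: value_at => /orP[] /eqP->.
  by case: eqP => // p0; case: ct => // ->; rewrite V; case: all.
- case: ifP ct => [le2 [ct0 ct1] | gt2 ct].
    rewrite V has_iota2 //.
    have := IHf _ _ (sub 0 (ltnW ge)) ct0; have := IHf _ _ (sub 1 ge) ct1.
    by do 2!case: value_at => /orP[] /eqP->.
  by case: eqP => // p0; case: ct => // ->; rewrite V; case: has.
Qed.

End Evaluation.

(** * Selections and satisfying assignments *)

Lemma weight_count a : weight C a =
  count (fun g => is_input (nth Input C g) && a g) (iota 0 s).
Proof.
rewrite /weight sizeC.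
rewrite -(big_mkord (fun g => is_input (nth Input C g)) (fun g => nat_of_bool (a g))).
rewrite /index_iota subn0 -sum1_count big_mkcond [RHS]big_mkcond.
by apply: eq_bigr => g _; case: is_input => //=; case: (a g).
Qed.

Lemma kd_input g : g < s -> (kd g == 0) = is_input (nth Input C g).
Proof. by move=> lt_g; rewrite kdE //; case: nth. Qed.

Lemma agrees_truth b v : agrees b (truth v) = (v == b).
Proof. by case: b; case: v. Qed.

Lemma double_leaves f g : f <= d.+1 -> (size (leaves f g)).*2 <= ndigits.
Proof.
move=> le_f; rewrite /ndigits expnS mul2n leq_double.
by apply: leq_trans (size_leaves f g) _; rewrite leq_exp2l.
Qed.

Lemma depth_output : depth_at s.-1 <= d.
Proof. by rewrite /depth_at -last_sweep. Qed.

Lemma weft_output : weft_at s.-1 <= 1.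
Proof. by rewrite /weft_at -last_sweep. Qed.

Lemma conflict_free_satisfiable : conflict_free ncolors noptions in_conflict ->
  exists a, weight C a = k /\ circuit_value a C.
Proof.
move=> [sel [sel_lt sel_ok]].
pose code I := I * noptions + sel I.
have good I J : I < ncolors -> J < ncolors -> checked (code I) && consistent (code I) (code J).
  by move=> lt_I lt_J; have := sel_ok I J lt_I lt_J; rewrite negbK.
have codeK I : I < ncolors -> code I %/ noptions = I.
  move=> lt_I; rewrite /code divnMDl ?noptions_gt0 //.
  by rewrite divn_small ?addn0 ?sel_lt.
have lt_col i : i <= k.+1 -> i < ncolors.
  move=> le_i; apply: leq_trans (_ : k.+2 <= _); first exact: le_i.
  by rewrite /ncolors -{1}(expn1 k.+2) leq_exp2l // ndigits_gt0.
have idx0 i : i <= k.+1 -> index_at (code i) 0 = i.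
  move=> le_i; rewrite /index_at codeK ?lt_col //.
  by rewrite /digit expn0 divn1 modn_small.
(* For [i <= k.+1] the colour [i] is the tuple with [i] at place 0 and zeros elsewhere, so its
   option assigns a position to index [i]. *)
pose pos i := position_at (code i) 0.
have cons_pos I J : I < ncolors -> J < ncolors -> forall t t', t < ndigits -> t' < ndigits ->
    (index_at (code I) t = index_at (code J) t' ->
       position_at (code I) t = position_at (code J) t') /\
    (index_at (code I) t < index_at (code J) t' ->
       position_at (code I) t < position_at (code J) t').
  move=> lI lJ t t' lt lt'; case/andP: (good I J lI lJ) => _ /andP[/allP c _].
  have /c/allP/(_ t') : t \in iota 0 ndigits by rewrite mem_iota.
  rewrite mem_iota => /(_ lt')/andP[/implyP c1 /implyP c2]; split=> [e|//].
  by apply/eqP/c1; rewrite e.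
have check_pos I : I < ncolors -> forall t, t < ndigits ->
    [/\ index_at (code I) t = 0 -> position_at (code I) t = 0,
        index_at (code I) t = k.+1 -> position_at (code I) t = s.+1 &
        0 < index_at (code I) t < k.+1 -> kd (position_at (code I) t).-1 = 0].
  move=> lI t lt; case/andP: (good I I lI lI) => /and3P[/allP c _ _] _.
  have /c/and3P[/implyP c1 /implyP c2 /implyP c3] : t \in iota 0 ndigits.
    by rewrite mem_iota.
  by split=> e; apply/eqP; [apply: c1 | apply: c2 | apply: c3] => //; rewrite e.
(* Consistency with these special colours makes every option follow one and the same sequence. *)
have fol I : I < ncolors -> follows pos (code I).
  move=> lI t lt; have le_i : index_at (code I) t <= k.+1 by rewrite -ltnS index_lt.
  by have [-> //] := cons_pos _ _ lI (lt_col _ le_i) t 0 lt ndigits_gt0; rewrite idx0.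
have pos0 : pos 0 = 0.
  by have [c _ _] := check_pos 0 (lt_col 0 isT) 0 ndigits_gt0; apply: c; rewrite idx0.
have pos_last : pos k.+1 = s.+1.
  have [_ c _] := check_pos _ (lt_col _ (leqnn k.+1)) 0 ndigits_gt0.
  by apply: c; rewrite idx0.
have pos_mono i j : i < j -> j <= k.+1 -> pos i < pos j.
  move=> lt_ij le_j; have le_i : i <= k.+1 by lia.
  have [_ c] := cons_pos _ _ (lt_col _ le_i) (lt_col _ le_j) 0 0 ndigits_gt0 ndigits_gt0.
  by apply: c; rewrite !idx0.
have pos_bnd i : 0 < i <= k -> 0 < pos i < s.+1.
  move=> /andP[i0 ik]; rewrite -pos_last -{1}pos0.
  by rewrite !pos_mono // (leq_trans ik).
have pos_input i : 0 < i <= k -> kd (pos i).-1 = 0.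
  move=> /andP[i0 ik]; have le_i : i <= k.+1 by exact: leqW.
  have [_ _ c] := check_pos _ (lt_col _ le_i) 0 ndigits_gt0.
  by apply: c; rewrite idx0 // i0.
pose a := selected pos.
exists a; split.
  rewrite weight_count -size_filter.
  rewrite -[RHS](size_iota 1 k) -[RHS](size_map (fun i => (pos i).-1)).
  apply/perm_size/uniq_perm.
  - by rewrite filter_uniq ?iota_uniq.
  - rewrite map_inj_in_uniq ?iota_uniq // => i j.
    rewrite !mem_iota !add1n !ltnS => bi bj e.
    have /andP[pi _] := pos_bnd i bi; have /andP[pj _] := pos_bnd j bj.
    case: (ltngtP i j) => // lt.
      have : pos i < pos j by apply: pos_mono => //; lia.
      by lia.
    have : pos j < pos i by apply: pos_mono => //; lia.
    by lia.
  - move=> g; rewrite mem_filter mem_iota /=; apply/idP/mapP.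
      move=> /andP[/andP[_ /selectedP[i bi e]] _]; exists i; last by rewrite e.
      by rewrite mem_iota add1n ltnS.
    move=> [i]; rewrite mem_iota add1n ltnS => bi ->.
    have /andP[pi0 pis] := pos_bnd i bi.
    have lt : (pos i).-1 < s by lia.
    rewrite -kd_input // pos_input // lt andbT /=.
    by apply/selectedP; exists i => //; lia.
have known_leaves f g : f <= d.+1 -> g < s -> exists2 J, J < ncolors &
    forall h, h \in leaves f g -> known_input (code J) h = truth (a h).
  move=> le_f lt_g.
  have [J lt_J kJ] := cover_exists pos0 pos_last pos_mono s_gt0
    (leaves_lt a f lt_g) (double_leaves g le_f).
  by exists J => //; apply: kJ; [exact: codeK | exact: fol].
have claim_same I J p : I < ncolors -> J < ncolors -> p < ndigits ->
    claim_at (code I) p = claim_at (code J) p.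
  move=> lI lJ lp; case/andP: (good I J lI lJ) => _ /andP[_ /allP c].
  by apply/eqP/c; rewrite mem_iota.
(* The bound on [p] keeps the numbers of all paths below [p] within the claims. The hypothesis
   ranges over all colours, since the refutation of a false claim may come from another colour than
   [I]. *)
have claims f p g : 0 < p -> p.+1 * 2 ^ f <= ndigits -> g < s ->
    depth_at g < d.+1 -> weft_at g <= 1 ->
    (forall I, I < ncolors -> claims_ok f p (code I) g) ->
    forall I, I < ncolors -> claims_true a f p (code I) g.
  elim: f p g => //= f IHf p g p0 le_p lt_g dp wf okI I lI.
  have sub t p' : t < ar g -> 0 < p' <= p.*2.+1 ->
      (forall I, I < ncolors -> claims_ok f p' (code I) (ch g t)) ->
      claims_true a f p' (code I) (ch g t).
    move=> lt_t /andP[p'0 le_p'] ok'; apply: IHf => //.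
    - apply: leq_trans le_p; rewrite expnS mulnA leq_mul2r; apply/orP; right.
      by lia.
    - exact: ltn_trans (child_lt lt_g lt_t) lt_g.
    - exact: ltn_trans (depth_child lt_g lt_t) dp.
    - by have := weft_child lt_g lt_t; lia.
  have large : 1 < kd g -> 2 < ar g -> (forall I, I < ncolors ->
      if claim_at (code I) p == 0 then
        all (fun t => agrees (kd g == 2) (kleene d.+1 0 (code I) (ch g t))) (iota 0 (ar g))
      else ((claim_at (code I) p).-1 < ar g) &&
        agrees (kd g != 2) (kleene d.+1 0 (code I) (ch g (claim_at (code I) p).-1))) ->
      claimed (code I) p g = value_at a g.
    move=> kd1 ar2 okL; rewrite /claimed (value_neutral a lt_g kd1).
    congr (_ == _).
    have lt_p : p < ndigits.
      apply: leq_trans le_p; rewrite expnS.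
      by have := expn_gt0 2 f; nia.
    have exact_child t : t < ar g -> exists2 J, J < ncolors &
        kleene d.+1 0 (code J) (ch g t) = truth (value_at a (ch g t)).
      move=> lt_t; have lt_c := ltn_trans (child_lt lt_g lt_t) lt_g.
      have [J lJ kn] := known_leaves d.+1 (ch g t) (leqnn _) lt_c.
      exists J => //; apply: kleene_exact => //.
      - exact: ltn_trans (depth_child lt_g lt_t) dp.
      - by have := weft_child lt_g lt_t; lia.
      - exact: claims_true0.
    (* A neutral claim is verified in-neighbour by in-neighbour, each time by a colour that
       evaluates it exactly; a named witness takes one such colour. All colours make the same
       claim. *)
    case: eqP => [c0 | cN0]; apply/esym.
      apply/allP => t; rewrite mem_iota => lt_t.
      have [J lJ kJ] := exact_child t lt_t.
      have := okL J lJ; rewrite (claim_same J I) // c0 eqxx => /allP/(_ t).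
      by rewrite mem_iota => /(_ lt_t); rewrite kJ agrees_truth.
    have := okL I lI; case: eqP => // _ /andP[lt_c _].
    have [J lJ kJ] := exact_child _ lt_c.
    have := okL J lJ; rewrite (claim_same J I) //; case: eqP => // _ /andP[_].
    rewrite kJ agrees_truth => ne; apply/negP => /allP/(_ (claim_at (code I) p).-1).
    rewrite mem_iota => /(_ lt_c).
    by rewrite (eqP ne); case: (kd g == 2).
  have pr : 0 < right_path p <= p.*2.+1.
    by rewrite /right_path; case: eqP p0 => [->|_ _] //=; rewrite leqnn.
  have pl : 0 < p.*2 <= p.*2.+1 by lia.
  move: okI large; case: (gateP a lt_g) => [K V|K ge V|K ge V|K ge V]; rewrite K /=.
  - by [].
  - by move=> okI _; apply: sub.
  - move=> okI large; case: ifP okI => [le2 okI | gt2 okI]; last first.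
      by right; apply: large => //; rewrite ltnNge gt2.
    split.
      by apply: sub => // [|J lJ]; [exact: ltnW | have /andP[] := okI J lJ].
    by apply: sub => // J lJ; have /andP[] := okI J lJ.
  - move=> okI large; case: ifP okI => [le2 okI | gt2 okI]; last first.
      by right; apply: large => //; rewrite ltnNge gt2.
    split.
      by apply: sub => // [|J lJ]; [exact: ltnW | have /andP[] := okI J lJ].
    by apply: sub => // J lJ; have /andP[] := okI J lJ.
have [J lJ kn] := known_leaves d.+1 s.-1 (leqnn _) output_lt.
have checkedJ I : I < ncolors -> checked (code I) by move=> lI; case/andP: (good I I lI lI).
have ct : claims_true a d.+1 1 (code J) s.-1.
  apply: claims => //.
  - exact: output_lt.
  - by rewrite ltnS depth_output.
  - exact: weft_output.
  - by move=> I /checkedJ/and3P[].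
have := checkedJ J lJ => /and3P[_ _].
rewrite (kleene_exact output_lt _ _ ct kn) ?ltnS ?depth_output // agrees_truth eqb_id.
by rewrite /value_at -last_sweep.
Qed.

(** Inverts the heap numbering of paths. The fuel [p] is enough because halving decreases [p]. *)
Fixpoint path_gate_rec (n p : nat) : nat :=
  if n is n'.+1 then
    if p <= 1 then s.-1 else ch (path_gate_rec n' p./2) (odd p)
  else s.-1.

Definition path_gate (p : nat) : nat := path_gate_rec p p.

Lemma path_gate_recE n m p : p <= n -> p <= m -> path_gate_rec n p = path_gate_rec m p.
Proof.
elim: n m p => [|n IHn] [|m] p /=; try by case: p => [|[]].
by move=> le_n le_m; case: leqP => // p1; rewrite (IHn m) //; lia.
Qed.

Lemma path_gate_double p (b : bool) : 0 < p -> path_gate (b + p.*2) = ch (path_gate p) b.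
Proof.
move=> p0; rewrite /path_gate; case E: (b + p.*2) => [|n]; first by lia.
have rec q : path_gate_rec n.+1 q =
  if q <= 1 then s.-1 else ch (path_gate_rec n q./2) (odd q) by [].
rewrite rec ifN; last by lia.
rewrite -E half_bit_double oddD odd_double addbF oddb.
by rewrite (path_gate_recE (m := p)) //; lia.
Qed.

Lemma satisfiable_conflict_free a :
  weight C a = k -> circuit_value a C -> conflict_free ncolors noptions in_conflict.
Proof.
move=> wa va.
pose L := [seq g <- iota 0 s | is_input (nth Input C g) && a g].
have szL : size L = k by rewrite size_filter -weight_count.
(* The true inputs, counted from 1, between the two sentinels. *)
pose P := 0 :: rcons [seq g.+1 | g <- L] s.+1; pose pos i := nth 0 P i.
have szP : size P = k.+2 by rewrite /P /= size_rcons size_map szL.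
have sortedP : sorted ltn P.
  rewrite /P /= -cats1 cat_path /= andbT.
  have sL : sorted ltn [seq g.+1 | g <- L].
    rewrite sorted_map; apply: sorted_filter; first by move=> y x z; exact: ltn_trans.
    exact: iota_ltn_sorted.
  have memL g : g \in [seq g.+1 | g <- L] -> 0 < g < s.+1.
    by case/mapP=> h; rewrite mem_filter mem_iota => /andP[_ lt_h] ->.
  rewrite path_min_sorted ?sL /=; last by apply/allP => g /memL/andP[].
  by have := mem_last 0 [seq g.+1 | g <- L]; rewrite inE => /orP[/eqP-> | /memL/andP[]].
have pos0 : pos 0 = 0 by [].
have pos_mid i : 0 < i <= k -> pos i = (nth 0 L i.-1).+1.
  case: i => // i /andP[_ lt_i]; rewrite /pos /P /= nth_rcons size_map szL lt_i.
  by rewrite (nth_map 0) ?szL.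
have pos_last : pos k.+1 = s.+1.
  by rewrite /pos /P /= nth_rcons size_map szL ltnn eqxx.
have pos_mono i j : i < j -> j <= k.+1 -> pos i < pos j.
  move=> lt_ij le_j; apply: (sorted_ltn_nth ltn_trans 0 sortedP) => //.
  - by rewrite inE szP ltnS (leq_trans (ltnW lt_ij)).
  - by rewrite inE szP.
have pos_le i : i <= k.+1 -> pos i < s.+2.
  rewrite leq_eqVlt => /orP[/eqP->|lt_i]; first by rewrite pos_last.
  by rewrite -pos_last; apply: leqW; exact: pos_mono.
have selE g : g < s -> kd g = 0 -> selected pos g = a g.
  move=> lt_g /eqP; rewrite kd_input // => inp.
  have memL : (g \in L) = a g by rewrite mem_filter inp mem_iota add0n lt_g !andbT.
  rewrite -memL; apply/selectedP/idP => [[i bi] | gL].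
    rewrite pos_mid // => -[<-]; apply: mem_nth; rewrite szL; lia.
  have lt_i : index g L < k by rewrite -szL index_mem.
  by exists (index g L).+1 => //; rewrite pos_mid //= nth_index.
(* The witness is the first in-neighbour whose value is not neutral. A number may describe no path
   of the circuit, hence the test that the gate is in range. *)
pose claim p := if path_gate p < s then
  (if neutral a (path_gate p) then 0 else
   (find (fun t => value_at a (ch (path_gate p) t) != (kd (path_gate p) == 2))
      (iota 0 (ar (path_gate p)))).+1) else 0.
have claimP p : path_gate p < s -> ~~ neutral a (path_gate p) ->
    let t := (claim p).-1 in
    [/\ claim p != 0, t < ar (path_gate p) &
        value_at a (ch (path_gate p) t) != (kd (path_gate p) == 2)].
  move=> lt_p nn; rewrite /claim lt_p (negbTE nn) /=.
  move: nn; rewrite /neutral -has_predC => h.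
  have lt := h; rewrite has_find size_iota in lt.
  by split=> //; have := nth_find 0 h; rewrite nth_iota.
have claim_lt p : claim p < s.+2.
  rewrite /claim; case: ifP => // lt_p; case: ifP => // /negbT nn.
  have [_ lt _] := claimP p lt_p nn; move: lt.
  rewrite /claim lt_p (negbTE nn) /=; have := ar_le lt_p; lia.
pose dg I t := if t < ndigits then pos (digit k.+2 I t) else claim (t - ndigits).
have dg_lt I t : t < ndigits + ndigits -> dg I t < s.+2.
  by rewrite /dg => _; case: ifP => // _; apply: pos_le; rewrite -ltnS ltn_mod.
pose sel I := of_digits s.+2 (ndigits + ndigits) (dg I).
have sel_lt I : sel I < noptions by apply: of_digits_lt; exact: dg_lt.
pose code I := I * noptions + sel I.
have idx I t : index_at (code I) t = digit k.+2 I t.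
  by rewrite /index_at /code divnMDl ?noptions_gt0 // divn_small ?addn0.
have modE I : code I %% noptions = sel I by rewrite modnMDl modn_small.
have fol I : follows pos (code I).
  move=> t lt; rewrite idx /position_at modE digit_of_digits /dg ?lt //.
    exact: dg_lt.
  by rewrite ltn_addr.
have clm I p : p < ndigits -> claim_at (code I) p = claim p.
  move=> lt; rewrite /claim_at modE digit_of_digits; first last.
  - by rewrite ltn_add2l.
  - exact: dg_lt.
  by rewrite /dg ltnNge leq_addr /= addKn.
have approx I f p g : g < s -> claims_true a f p (code I) g ->
    approximates (kleene f p (code I) g) (value_at a g).
  move=> lt_g ct; apply: kleene_approximates => // h lt_h kh.
  by rewrite -selE //; exact: (known_input_approximates pos0 pos_last pos_mono).
(* The options pass the test because their evaluations of in-neighbours approximate the true values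
   and so cannot refute a true claim. *)
have paths I f p : 0 < p -> path_gate p < s -> p.+1 * 2 ^ f <= ndigits ->
    claims_ok f p (code I) (path_gate p) /\ claims_true a f p (code I) (path_gate p).
  elim: f p => //= f IHf p p0 lt_g le_p; set g := path_gate p in lt_g *.
  have right : right_path p = (true + p.*2) by rewrite /right_path; case: eqP p0 => [->|].
  have sub (b : bool) : b < ar g ->
      claims_ok f (b + p.*2) (code I) (ch g b) /\
      claims_true a f (b + p.*2) (code I) (ch g b).
    move=> lt_b; rewrite -(path_gate_double b p0); apply: IHf.
    - by lia.
    - by rewrite path_gate_double //; exact: ltn_trans (child_lt lt_g lt_b) lt_g.
    - apply: leq_trans le_p; rewrite expnS mulnA leq_mul2r; apply/orP; right.
      by case: (b); lia.
  have sub0 := sub false; have sub1 := sub true; rewrite /= add0n in sub0.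
  have lt_p : p < ndigits.
    apply: leq_trans le_p; rewrite expnS.
    by have := expn_gt0 2 f; nia.
  have app t : t < ar g -> approximates (kleene d.+1 0 (code I) (ch g t)) (value_at a (ch g t)).
    move=> lt_t; apply: approx; last exact: claims_true0.
    exact: ltn_trans (child_lt lt_g lt_t) lt_g.
  have large : 1 < kd g ->
      (if claim_at (code I) p == 0 then
        all (fun t => agrees (kd g == 2) (kleene d.+1 0 (code I) (ch g t))) (iota 0 (ar g))
      else ((claim_at (code I) p).-1 < ar g) &&
        agrees (kd g != 2) (kleene d.+1 0 (code I) (ch g (claim_at (code I) p).-1)))
      /\ claimed (code I) p g = value_at a g.
    move=> kd1; rewrite /claimed clm // (value_neutral a lt_g kd1).
    case: (boolP (neutral a g)) => [nt | nn].
      have -> : claim p = 0 by rewrite /claim lt_g nt.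
      rewrite eqxx; split=> //; apply/allP => t lt_t.
      rewrite -(eqP (allP nt _ lt_t)); apply/approximates_agrees/app.
      by move: lt_t; rewrite mem_iota.
    have [c0 lt ne] := claimP p lt_g nn; rewrite (negbTE c0); split=> //.
    rewrite lt /=; have := app _ lt; move: ne; rewrite -/g.
    case: value_at; case: (kd g == 2) => // _; exact: approximates_agrees.
  move: large sub0 sub1; rewrite right.
  case: (gateP a lt_g) => [K V|K ge V|K ge V|K ge V]; rewrite K /=.
  - by [].
  - by move=> _ sub0 _; exact: sub0.
  - move=> large sub0 sub1; case: ifP => _.
      have [ok0 ct0] := sub0 (ltnW ge); have [ok1 ct1] := sub1 ge.
      by rewrite ok0 ok1.
    by have [okL ctL] := large isT; split=> //; right.
  - move=> large sub0 sub1; case: ifP => _.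
      have [ok0 ct0] := sub0 (ltnW ge); have [ok1 ct1] := sub1 ge.
      by rewrite ok0 ok1.
    by have [okL ctL] := large isT; split=> //; right.
have checkedI I : checked (code I).
  have [||okI ctI] := paths I d.+1 1 isT.
  - exact: output_lt.
  - by rewrite /ndigits (expnS 2 d.+1).
  apply/and3P; split; first last.
  - have := approx I d.+1 1 s.-1 output_lt ctI.
    have -> : value_at a s.-1 by rewrite /value_at -last_sweep.
    exact: approximates_agrees.
  - exact: okI.
  apply/allP => t; rewrite mem_iota => lt_t; rewrite fol //.
  apply/and3P; split; apply/implyP.
  - by move/eqP->.
  - by move/eqP->; rewrite pos_last.
  - move=> bi; have bi' : 0 < index_at (code I) t <= k by [].
    rewrite pos_mid //=; set g := nth _ _ _.
    have : g \in L by apply: mem_nth; rewrite szL; lia.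
    by rewrite mem_filter mem_iota => /andP[/andP[inp _] lt_g]; rewrite kd_input.
exists sel; split=> [I _|I J _ _]; first exact: sel_lt.
rewrite negbK checkedI /= /consistent; apply/andP; split.
  apply/allP => t; rewrite mem_iota => lt_t; apply/allP => t'; rewrite mem_iota => lt_t'.
  rewrite !fol //; apply/andP; split; apply/implyP; first by move/eqP->.
  by move=> lt; apply: pos_mono => //; rewrite -ltnS index_lt.
by apply/allP => p; rewrite mem_iota => lt_p; rewrite !clm.
Qed.

End Circuit.

End Certificates.

(** * Reading the circuit off its code *)

(* The codes of instances are concatenations of unary numbers. *)
Definition enc_nats (l : seq nat) : seq bool := flatten (map enc_nat l).

(** The [j]-th unary number of a code consists of the ones with exactly [j] zeros before them. In
    this form reading it is a bounded sum. *)
Definition entry (w : seq bool) (j : nat) : nat :=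
  \sum_(0 <= p < size w) (nth false w p && (count negb (take p w) == j)).

Lemma entry_cat u v j : entry (u ++ v) j =
  entry u j + (if count negb u <= j then entry v (j - count negb u) else 0).
Proof.
rewrite /entry size_cat (big_cat_nat _ (n := size u)) ?leq_addr //=; congr (_ + _).
  apply: eq_big_nat => p /andP[_ lt_p].
  by rewrite nth_cat lt_p takel_cat // ltnW.
rewrite -{1}[size u]add0n big_addn addKn.
case: leqP => [le_j | lt_j].
  apply: eq_bigr => p _; rewrite nth_cat ltnNge leq_addl /= addnK.
  rewrite take_cat ltnNge leq_addl /= addnK count_cat.
  by congr (nat_of_bool (_ && _)); lia.
apply: big1 => p _; rewrite take_cat ltnNge leq_addl /= count_cat.
by case: (nth _ _ _) => //=; case: eqP => //; lia.
Qed.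

Lemma entry_enc_nat n j : entry (enc_nat n) j = if j == 0 then n else 0.
Proof.
have bit p : p < n.+1 -> nth false (enc_nat n) p = (p < n).
  move=> lt_p; rewrite nth_rcons size_nseq nth_nseq.
  by case: ltnP => //; case: eqP.
rewrite /entry size_rcons size_nseq.
rewrite (eq_big_nat _ _ (F2 := fun p => if j == 0 then nat_of_bool (p < n) else 0)).
  case: eqP => _; last by rewrite big1.
  by rewrite sum_leq_id; apply/minn_idPl.
move=> p /andP[_ lt_p]; rewrite bit //; case: (ltnP p n) => [lt | le] /=.
  rewrite /enc_nat -cats1 takel_cat ?size_nseq ?(ltnW lt) // take_nseq ?(ltnW lt) //.
  by rewrite count_nseq mul0n eq_sym; case: eqP.
by case: eqP.
Qed.

Lemma entry_enc_nats l j : entry (enc_nats l) j = nth 0 l j.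
Proof.
elim: l j => [|n l IHl] j; first by rewrite /entry big_geq // nth_nil.
rewrite -[enc_nats _]/(enc_nat n ++ enc_nats l) entry_cat entry_enc_nat.
rewrite /enc_nat -cats1 count_cat count_nseq mul0n /=.
by case: j => [|j] //=; rewrite ?addn0 // subn1 IHl.
Qed.

Lemma entry_le w j : entry w j <= size w.
Proof.
rewrite -[leqRHS]muln1 -[X in X * 1]subn0 -sum_nat_const_nat.
by apply: leq_sum => p _; case: (_ && _).
Qed.

(* The truncation has no effect on codes of circuits; it makes [gate_start]
   bounded on all words. *)
Definition gate_start (w : seq bool) (g : nat) : nat :=
  iter g (fun a => minn (size w) (a + 2 + entry w a.+1)) 2.

Definition read_weight w := entry w 0.
Definition read_size w := entry w 1.
Definition read_kind w g := entry w (gate_start w g).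
Definition read_arity w g := entry w (gate_start w g).+1.
Definition read_child w g t := entry w (gate_start w g + 2 + t).

Definition gate_nats (g : gate) : seq nat :=
  [:: (gate_code g).1, size (fanin g) & fanin g].

Definition circuit_nats (k : nat) (C : circuit) : seq nat :=
  [:: k, size C & flatten (map gate_nats C)].

(** Each number has its final zero. This shows that the truncation in [gate_start] does not act on
    codes of circuits. *)
Lemma size_enc_nats l : size l <= size (enc_nats l).
Proof.
elim: l => // n l IHl; rewrite -[enc_nats _]/(enc_nat n ++ enc_nats l).
by rewrite size_cat size_rcons /=; lia.
Qed.

Lemma wcs_encodeE t d (x : wcs_instance t d) :
  wcs_encode x = enc_nats (circuit_nats (wcs_weight x) (wcs_circuit x)).
Proof.
rewrite /wcs_encode /enc_pair /enc_seq /enc_nats /= size_map; congr (_ ++ (_ ++ _)).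
elim: (wcs_circuit x) => //= g C IHC.
by rewrite IHC !map_cat !flatten_cat -!catA; congr (_ ++ _).
Qed.

Section ReadCircuit.

Variables (k : nat) (C : circuit).
Let w := enc_nats (circuit_nats k C).

Lemma gate_startE g : g <= size C ->
  gate_start w g = 2 + size (flatten (map gate_nats (take g C))).
Proof.
elim: g => [|g IHg] lt_g; first by rewrite take0.
rewrite /gate_start iterS -/(gate_start w g) IHg ?(ltnW lt_g) //.
have splitC : C = take g C ++ nth Input C g :: drop g.+1 C.
  by rewrite -drop_nth // cat_take_drop.
have sizeS : size (flatten (map gate_nats (take g.+1 C))) =
    size (flatten (map gate_nats (take g C))) + 2 + size (fanin (nth Input C g)).
  by rewrite (take_nth Input) // map_rcons flatten_rcons size_cat /=; lia.
have -> : entry w (2 + size (flatten (map gate_nats (take g C)))).+1 =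
    size (fanin (nth Input C g)).
  rewrite entry_enc_nats /=; set A := size _.
  rewrite [in nth _ _ _]splitC map_cat flatten_cat nth_cat -/A.
  by rewrite ltnNge leqnSn /= subSnn.
rewrite sizeS; have -> : forall A a, 2 + A + 2 + a = 2 + (A + 2 + a) by lia.
apply/minn_idPr; apply: leq_trans (size_enc_nats _); rewrite -sizeS /= !ltnS.
rewrite -[in leqRHS](cat_take_drop g.+1 C) map_cat flatten_cat size_cat.
exact: leq_addr.
Qed.

Lemma nth_gate g j : g < size C -> j < size (gate_nats (nth Input C g)) ->
  entry w (gate_start w g + j) = nth 0 (gate_nats (nth Input C g)) j.
Proof.
move=> lt_g lt_j; rewrite gate_startE ?(ltnW lt_g) // entry_enc_nats.
have splitC : C = take g C ++ nth Input C g :: drop g.+1 C.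
  by rewrite -drop_nth // cat_take_drop.
rewrite /circuit_nats -addnA; set A := size (flatten _).
rewrite [nth _ _ _]/= [in LHS]splitC map_cat flatten_cat nth_cat -/A.
rewrite add0n ltnNge leq_addr addKn.
rewrite -[LHS]/(nth 0 (gate_nats (nth Input C g) ++ _) j).
by rewrite nth_cat lt_j.
Qed.

Lemma read_weightE : read_weight w = k.
Proof. by rewrite /read_weight entry_enc_nats. Qed.

Lemma read_sizeE : read_size w = size C.
Proof. by rewrite /read_size entry_enc_nats. Qed.

Lemma read_kindE g : g < size C -> read_kind w g = (gate_code (nth Input C g)).1.
Proof. by move=> lt_g; rewrite /read_kind -[gate_start w g]addn0 nth_gate. Qed.

Lemma read_arityE g : g < size C -> read_arity w g = size (fanin (nth Input C g)).
Proof. by move=> lt_g; rewrite /read_arity -addn1 nth_gate. Qed.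

Lemma read_childE g t : g < size C -> t < read_arity w g ->
  read_child w g t = nth 0 (fanin (nth Input C g)) t.
Proof.
move=> lt_g; rewrite read_arityE // => lt_t.
by rewrite /read_child -addnA nth_gate.
Qed.

End ReadCircuit.

(** * Compiling the reduction *)

Section CompileReduction.

Variable E : nat.
Local Notation compilable := (compilable E).
Local Notation compilableb := (compilableb E).
Local Notation bounded := (bounded E).

Lemma bounded_le_size F : (forall w B e, F w B e <= (size w).+2) -> bounded F.
Proof. by move=> le w B e /valid_size; exact: leq_trans. Qed.

Lemma compilable_entry F : compilable F -> compilable (fun w B e => entry w (F w B e)).
Proof.
move=> cF.
have bsize : bounded (fun w B e => size w) by apply: bounded_le_size => w B e; lia.
have head1 : compilable (fun w B e => head 0 (behead e)).
  exact: (compilable_shift (compilable_head E)).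
pose zeros : func := fun w B e =>
  \sum_(0 <= q < head 0 e) ~~ nth false w (head 0 (q :: e)).
have cz : compilable zeros.
  apply: (@compilable_sum_lt _ (fun w B e => nat_of_bool (~~ nth false w (head 0 e)))).
  - exact: bounded_head.
  - exact: (compilableN (compilable_bit (compilable_head E))).
  - exact: compilable_head.
have cb : compilableb (fun w B e => nth false w (head 0 e) && (zeros w B e == shift F w B e)).
  apply: compilable_and; first exact: (compilable_bit (compilable_head E)).
  by apply: compilable_eq => //; exact: compilable_shift.
have cS := compilable_sum_lt bsize cb (compilable_size E).
apply: compilable_ext cS => w B e _; apply: eq_big_nat => p /andP[_ lt_p] /=.
congr (nat_of_bool (_ && (_ == _))); rewrite /zeros /shift /=.
have -> : take p w = mkseq (nth false w) p.
  by rewrite -[in LHS](mkseq_nth false w) /mkseq -map_take take_iota (minn_idPl (ltnW lt_p)).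
rewrite count_map -sum1_count [RHS]big_mkcond /index_iota subn0.
by apply: eq_bigr => q _ /=; case: nth.
Qed.

Lemma bounded_entry F : bounded (fun w B e => entry w (F w B e)).
Proof. by apply: bounded_le_size => w B e; apply: leq_trans (entry_le _ _) _; lia. Qed.

Lemma iteri_guard (f : nat -> nat) n N x : n <= N ->
  iteri N (fun i a => if i < n then f a else a) x = iter n f x.
Proof.
move=> le_n; rewrite -(subnKC le_n); elim: (N - n) => [|m IHm].
  suff small i : i <= n -> iteri i (fun i a => if i < n then f a else a) x = iter i f x.
    by rewrite addn0 small.
  by elim: i => //= i IHi lt_i; rewrite lt_i IHi // ltnW.
by rewrite addnS /= ltnNge leq_addr /= IHm.
Qed.

Lemma compilable_gate_start G : bounded G -> compilable G ->
  compilable (fun w B e => gate_start w (G w B e)).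
Proof.
move=> bG cG.
(* The minimum of [a] and [b] is computed as [a - (a - b)], and rounds past the gate number keep the
   accumulator. *)
pose step : func := fun w B e => if head 0 e < G w B (behead (behead e)) then
  size w - (size w - (head 0 (behead e) + 2 + entry w (head 0 (behead e)).+1))
  else head 0 (behead e).
have c1 : compilable (fun w B e => head 0 (behead e)).
  exact: (compilable_shift (compilable_head E)).
have cstep : compilable step.
  apply: compilable_ifb => //.
    apply: compilable_lt; first exact: compilable_head.
    exact: (compilable_shift (compilable_shift cG)).
  apply: compilableB; first exact: compilable_size.
  apply: compilableB; first exact: compilable_size.
  apply: compilableD; last exact: (compilable_entry (compilableS c1)).
  by apply: compilableD => //; exact: compilable_const.
have b2 : bounded (fun _ _ _ => 2) by exact: bounded_le_size.
have bstep w B i a e : valid E w B (i :: a :: e) -> step w B (i :: a :: e) <= B.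
  move=> vd; rewrite /step /=; case: ifP => _; first by have := valid_size vd; lia.
  by case: vd => _ /= /and3P[].
apply: compilable_ext (compilable_iteri cstep (compilable_const E 2) b2 bstep).
move=> w B e vd; rewrite /gate_start -(iteri_guard _ _ (bG w B e vd)).
by apply: eq_iteri => i a; rewrite /step /=; case: ifP => // _; lia.
Qed.

Lemma compilable_read_weight : compilable (fun w B e => read_weight w).
Proof. exact: (compilable_entry (compilable_const E 0)). Qed.

Lemma compilable_read_size : compilable (fun w B e => read_size w).
Proof. exact: (compilable_entry (compilable_const E 1)). Qed.

Lemma compilable_read_kind G : bounded G -> compilable G ->
  compilable (fun w B e => read_kind w (G w B e)).
Proof. by move=> bG cG; exact: (compilable_entry (compilable_gate_start bG cG)). Qed.

Lemma compilable_read_arity G : bounded G -> compilable G ->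
  compilable (fun w B e => read_arity w (G w B e)).
Proof.
by move=> bG cG; exact: (compilable_entry (compilableS (compilable_gate_start bG cG))).
Qed.

Lemma compilable_read_child G F : bounded G -> compilable G -> compilable F ->
  compilable (fun w B e => read_child w (G w B e) (F w B e)).
Proof.
move=> bG cG cF; apply: compilable_entry; apply: compilableD => //.
by apply: compilableD; [exact: compilable_gate_start | exact: compilable_const].
Qed.

Lemma bounded_read_child G F : bounded (fun w B e => read_child w (G w B e) (F w B e)).
Proof. exact: bounded_entry. Qed.

End CompileReduction.

(** * Compiling the certificates and the table *)

Section CompileCertificates.

Variable d : nat.

(** With [X] the input length plus 2 and [n = ndigits d], there are at most [X ^ n] colours with at
    most [X ^ (2 n)] options each. The squared number of codes is at most [X ^ (6 n)], and two more
    factors [X], which is at least 2, absorb the constants in the number of vertices. *)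
Let E := (6 * ndigits d).+1.
Local Notation compilable := (compilable E).
Local Notation compilableb := (compilableb E).
Local Notation bounded := (bounded E).
Local Notation emittable := (emittable E).
Local Notation const := (compilable_const E).

(** Defined on all words, codes of circuits or not, because [transducible] speaks of every word;
    [conflict_instance] is well formed for any relation. *)
Definition word_conflict (w : seq bool) : rel nat := in_conflict d
  (read_weight w) (read_size w) (read_kind w) (read_arity w) (read_child w).

Definition word_kleene (w : seq bool) := kleene d
  (read_weight w) (read_size w) (read_kind w) (read_arity w) (read_child w).

Definition word_claims_ok (w : seq bool) := claims_ok d
  (read_weight w) (read_size w) (read_kind w) (read_arity w) (read_child w).

Definition word_colors (w : seq bool) : nat := ncolors d (read_weight w).
Definition word_options (w : seq bool) : nat := noptions d (read_size w).
Definition word_codes (w : seq bool) : nat := ncodes (word_colors w) (word_options w).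
Definition word_verts (w : seq bool) : nat := nverts (word_colors w) (word_options w).

Lemma word_bounds w : let X := (size w).+2 in let n := ndigits d in
  [/\ word_colors w <= X ^ n, word_options w <= X ^ (n + n),
      word_codes w <= X ^ (n + (n + n)) &
      word_verts w <= X ^ E.+1].
Proof.
move=> X n.
have kX : word_colors w <= X ^ n by apply: expn_homo; rewrite !ltnS entry_le.
have sX : word_options w <= X ^ (n + n) by apply: expn_homo; rewrite !ltnS entry_le.
have cX : word_codes w <= X ^ (n + (n + n)) by rewrite expnD; exact: leq_mul.
split=> //; rewrite /word_verts /nverts -/(word_codes w).
have ccX : word_codes w * word_codes w <= X ^ (6 * n).
  have -> : 6 * n = (n + (n + n)) + (n + (n + n)) by lia.
  by rewrite expnD; exact: leq_mul.
have kX' : word_colors w <= X ^ (6 * n).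
  by apply: leq_trans kX _; rewrite leq_exp2l //; lia.
have -> : X ^ E.+1 = X * (X * X ^ (6 * n)) by rewrite -!expnS.
have X4 : 4 <= X * X by exact: (@leq_mul 2 2).
rewrite [leqRHS]mulnA; apply: (@leq_trans (4 * X ^ (6 * n))); first by lia.
by rewrite leq_mul2r X4 orbT.
Qed.

Lemma bounded_pow (F : func) n : n <= E.+1 ->
  (forall w B e, F w B e <= (size w).+2 ^ n) -> bounded F.
Proof.
move=> le_n leF w B e [le _]; apply: leq_trans (leF w B e) _.
by apply: leq_trans le; rewrite leq_exp2l.
Qed.

Lemma bounded_colors : bounded (fun w _ _ => word_colors w).
Proof.
apply: (@bounded_pow _ (ndigits d)) => [|w B e]; first by rewrite /E; lia.
by have [] := word_bounds w.
Qed.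

Lemma bounded_options : bounded (fun w _ _ => word_options w).
Proof.
apply: (@bounded_pow _ (ndigits d + ndigits d)) => [|w B e]; first by rewrite /E; lia.
by have [] := word_bounds w.
Qed.

Lemma bounded_codes : bounded (fun w _ _ => word_codes w).
Proof.
apply: (@bounded_pow _ (ndigits d + (ndigits d + ndigits d))) => [|w B e].
  by rewrite /E; lia.
by have [] := word_bounds w.
Qed.

Lemma bounded_verts : bounded (fun w _ _ => word_verts w).
Proof. by apply: (@bounded_pow _ E.+1) => // w B e; have [] := word_bounds w. Qed.

Lemma bounded_weight2 : bounded (fun w _ _ => (read_weight w).+2).
Proof. by apply: bounded_le_size => w B e; rewrite !ltnS entry_le. Qed.

Lemma bounded_size2 : bounded (fun w _ _ => (read_size w).+2).
Proof. by apply: bounded_le_size => w B e; rewrite !ltnS entry_le. Qed.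

Lemma compilable_weight2 : compilable (fun w _ _ => (read_weight w).+2).
Proof. exact: (compilableS (compilableS (compilable_read_weight E))). Qed.

Lemma compilable_size2 : compilable (fun w _ _ => (read_size w).+2).
Proof. exact: (compilableS (compilableS (compilable_read_size E))). Qed.

Lemma compilable_colors : compilable (fun w _ _ => word_colors w).
Proof. exact: (compilableX _ bounded_weight2 compilable_weight2). Qed.

Lemma compilable_options : compilable (fun w _ _ => word_options w).
Proof. exact: (compilableX _ bounded_size2 compilable_size2). Qed.

Lemma compilable_codes : compilable (fun w _ _ => word_codes w).
Proof. exact: (compilableM bounded_colors compilable_colors compilable_options). Qed.

Lemma compilable_verts : compilable (fun w _ _ => word_verts w).
Proof.
apply: compilableD; first exact: compilable_colors.
apply: (@compilableM _ (fun _ _ _ => 2)); first exact: bounded_le_size.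
  exact: const.
exact: (compilableM bounded_codes compilable_codes compilable_codes).
Qed.

Lemma compilable_digit (b X : func) t : bounded b -> compilable b ->
  bounded X -> compilable X ->
  compilable (fun w B e => digit (b w B e) (X w B e) t).
Proof.
move=> bb cb bX cX; apply: (@compilable_mod _ (fun w B e => X w B e %/ b w B e ^ t)) => //.
  exact: (@bounded_div _ X (fun w B e => b w B e ^ t)).
by apply: compilable_div => //; exact: compilableX.
Qed.

Section Codes.

Variable X : func.
Hypotheses (bX : bounded X) (cX : compilable X).

Let index_of (t : nat) : func := fun w B e =>
  index_at d (read_weight w) (read_size w) (X w B e) t.
Let position_of (t : nat) : func := fun w B e =>
  position_at d (read_size w) (X w B e) t.
Let claim_of (p : nat) : func := fun w B e =>
  claim_at d (read_size w) (X w B e) p.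

Lemma compilable_index t : compilable (index_of t).
Proof.
apply: (compilable_digit _ bounded_weight2 compilable_weight2).
  exact: (@bounded_div _ _ _ bX).
exact: (compilable_div bX cX compilable_options).
Qed.

Lemma compilable_position t : compilable (position_of t).
Proof.
apply: (compilable_digit _ bounded_size2 compilable_size2).
  exact: (@bounded_mod _ _ _ bX).
exact: (compilable_mod bX cX compilable_options).
Qed.

Lemma compilable_claim p : compilable (claim_of p).
Proof.
apply: (compilable_digit _ bounded_size2 compilable_size2).
  exact: (@bounded_mod _ _ _ bX).
exact: (compilable_mod bX cX compilable_options).
Qed.

Lemma compilable_known_input G : compilable G -> compilable (fun w B e =>
  known_input d (read_weight w) (read_size w) (X w B e) (G w B e)).
Proof.
move=> cG.
have cK := compilable_read_weight E.
apply: compilable_ifb; [|exact: const|].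
  apply: compilable_has_seq => t _.
  apply: compilable_and; first by apply: compilable_lt; [exact: const | exact: compilable_index].
  apply: compilable_and.
    by apply: compilable_lt; [exact: compilable_index | exact: compilableS].
  by apply: compilable_eq; [exact: compilable_position | exact: compilableS].
apply: compilable_ifb; [|exact: const|exact: const].
apply: compilable_has_seq => t _; apply: compilable_has_seq => t' _.
apply: compilable_and.
  by apply: compilable_eq; [exact: compilable_index | exact: (compilableS (compilable_index t))].
apply: compilable_and.
  by apply: compilable_lt; [exact: compilable_position | exact: compilableS].
by apply: compilable_lt; [exact: compilableS | exact: compilable_position].
Qed.

Lemma compilable_eqb b1 b2 : compilableb b1 -> compilableb b2 ->
  compilableb (fun w B e => b1 w B e == b2 w B e).
Proof.
move=> c1 c2; apply: compilable_ext (compilable_eq c1 c2) => w B e _.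
by case: (b1 w B e); case: (b2 w B e).
Qed.

Lemma compilable_kind_eq c G : bounded G -> compilable G ->
  compilableb (fun w B e => read_kind w (G w B e) == c).
Proof.
by move=> bG cG; apply: compilable_eq; [exact: compilable_read_kind | exact: const].
Qed.

Lemma compilable_claimed p G : bounded G -> compilable G ->
  compilableb (fun w B e =>
    claimed d (read_size w) (read_kind w) (X w B e) p (G w B e)).
Proof.
move=> bG cG; apply: compilable_eqb; first exact: compilable_kind_eq.
by apply: compilable_eq; [exact: compilable_claim | exact: const].
Qed.

Lemma compilable_child t G : bounded G -> compilable G ->
  compilable (fun w B e => read_child w (G w B e) t).
Proof. by move=> bG cG; apply: compilable_read_child => //; exact: const. Qed.

Lemma bounded_child t G : bounded (fun w B e => read_child w (G w B e) t).
Proof. exact: (@bounded_read_child _ G (fun _ _ _ => t)). Qed.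

Lemma compilable_small G : bounded G -> compilable G ->
  compilableb (fun w B e => read_arity w (G w B e) <= 2).
Proof.
by move=> bG cG; apply: compilable_le; [exact: compilable_read_arity | exact: const].
Qed.

(** Fuel and path are constants of the program, so the recursion is unfolded into code whose size
    depends on [d] only. *)
Lemma compilable_kleene f p G : bounded G -> compilable G ->
  compilable (fun w B e => word_kleene w f p (X w B e) (G w B e)).
Proof.
elim: f p G => [|f IHf] p G bG cG; first exact: const.
rewrite /word_kleene /=.
have sub t p' : compilable (fun w B e =>
    word_kleene w f p' (X w B e) (read_child w (G w B e) t)).
  by apply: IHf; [exact: bounded_child | exact: compilable_child].
apply: compilable_ifb; first exact: compilable_kind_eq.
  exact: compilable_known_input.
apply: compilable_ifb; first exact: compilable_kind_eq.
  by apply: compilableB; [exact: const | exact: sub].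
apply: compilable_ifb; first exact: compilable_small.
  apply: compilable_ifb; first exact: compilable_kind_eq.
    by apply: compilableB; [|apply: compilableB]; exact: sub.
  by apply: compilableD; [|apply: compilableB]; exact: sub.
case: (p == 0); first exact: const.
by apply: compilable_ifb; [exact: compilable_claimed | exact: const | exact: const].
Qed.

Lemma compilable_agrees b F : compilable F -> compilableb b ->
  compilableb (fun w B e => agrees (b w B e) (F w B e)).
Proof.
move=> cF cb; apply: compilableb_if => //; apply: compilableN;
  by apply: compilable_eq => //; exact: const.
Qed.

End Codes.

Lemma compilable_claims_ok f p X G : bounded X -> compilable X ->
  bounded G -> compilable G ->
  compilableb (fun w B e => word_claims_ok w f p (X w B e) (G w B e)).
Proof.
move=> bX cX; elim: f p G => [|f IHf] p G bG cG; first exact: const.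
rewrite /word_claims_ok /=.
have sub t p' : compilableb (fun w B e =>
    word_claims_ok w f p' (X w B e) (read_child w (G w B e) t)).
  by apply: IHf; [exact: bounded_child | exact: compilable_child].
have pred_bounded : bounded (fun w B e => (claim_at d (read_size w) (X w B e) p).-1).
  move=> w B e vd; apply: leq_trans (leq_pred _) _.
  by apply: ltnW; apply: leq_trans (bounded_size2 vd); rewrite ltn_mod.
have cclaim := compilable_claim bX cX p.
apply: compilableb_if; [exact: compilable_kind_eq | exact: const |].
apply: compilableb_if; [exact: compilable_kind_eq | exact: sub |].
apply: compilableb_if; first exact: compilable_small.
  by apply: compilable_and; exact: sub.
apply: compilableb_if; first by apply: compilable_eq => //; exact: const.
  pose b : seq bool -> nat -> seq nat -> bool := fun w B e =>
    agrees (read_kind w (shift G w B e) == 2)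
      (word_kleene w d.+1 0 (shift X w B e) (read_child w (shift G w B e) (head 0 e))).
  apply: (@compilable_all_lt _ b); last exact: compilable_read_arity.
    exact: bounded_entry.
  have bG' := bounded_shift bG; have cG' := compilable_shift cG.
  apply: compilable_agrees; last exact: compilable_kind_eq.
  apply: compilable_kleene.
  - exact: bounded_shift.
  - exact: compilable_shift.
  - exact: bounded_read_child.
  - by apply: compilable_read_child => //; exact: compilable_head.
apply: compilable_and.
  by apply: compilable_lt; [exact: compilable_pred | exact: compilable_read_arity].
apply: compilable_agrees; last by apply: compilableN; exact: compilable_kind_eq.
apply: (@compilable_kleene X bX cX d.+1 0 (fun w B e =>
  read_child w (G w B e) (claim_at d (read_size w) (X w B e) p).-1)).
  exact: bounded_read_child.
by apply: compilable_read_child => //; exact: compilable_pred.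
Qed.

Lemma compilable_conflict X Y : bounded X -> compilable X -> bounded Y -> compilable Y ->
  compilableb (fun w B e => word_conflict w (X w B e) (Y w B e)).
Proof.
move=> bX cX bY cY.
have ceq F c : compilable F -> compilableb (fun w B e => F w B e == c).
  by move=> cF; apply: compilable_eq => //; exact: const.
have cK1 := compilableS (compilable_read_weight E).
have cout : compilable (fun w B e => (read_size w).-1).
  exact: (compilable_pred (compilable_read_size E)).
have bout : bounded (fun w B e => (read_size w).-1).
  apply: bounded_le_size => w B e; apply: leq_trans (leq_pred _) _.
  by apply: leq_trans (entry_le _ _) _; lia.
apply: compilableN; apply: compilable_and; last first.
  apply: compilable_and; apply: compilable_all_seq => t _; last first.
    by apply: compilable_eq; exact: compilable_claim.
  apply: compilable_all_seq => t' _.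
  apply: compilable_and; apply: compilable_imply.
  - by apply: compilable_eq; exact: compilable_index.
  - by apply: compilable_eq; exact: compilable_position.
  - by apply: compilable_lt; exact: compilable_index.
  - by apply: compilable_lt; exact: compilable_position.
apply: compilable_and.
  apply: compilable_all_seq => t _.
  have ci := compilable_index bX cX t; have cp := compilable_position bX cX t.
  apply: compilable_and; first by apply: compilable_imply; apply: ceq.
  apply: compilable_and.
    apply: compilable_imply; apply: compilable_eq => //.
    exact: (compilableS (compilable_read_size E)).
  apply: compilable_imply.
    apply: compilable_and; last exact: compilable_lt.
    by apply: compilable_lt => //; exact: const.
  apply: compilable_kind_eq; last exact: compilable_pred.
  move=> w B e vd; apply: leq_trans (leq_pred _) _.
  by apply: ltnW; apply: leq_trans (bounded_size2 vd); rewrite ltn_mod.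
apply: compilable_and.
  exact: (@compilable_claims_ok d.+1 1 X (fun w B e => (read_size w).-1)).
apply: compilable_agrees; last exact: const.
exact: (@compilable_kleene X bX cX d.+1 1 (fun w B e => (read_size w).-1)).
Qed.

Lemma compilable_count b G : bounded G -> compilableb b -> compilable G ->
  compilable (fun w B e => count (fun i => b w B (i :: e)) (iota 0 (G w B e))).
Proof.
move=> bG cb cG; apply: compilable_ext (compilable_sum_lt bG cb cG) => w B e _.
rewrite -sum1_count [RHS]big_mkcond /index_iota subn0.
by apply: eq_bigr => i _; case: (b w B _).
Qed.

Section Vertices.

Variable U : func.
Hypotheses (bU : bounded U) (cU : compilable U).

Local Notation color w := (word_colors w).
Local Notation option w := (word_options w).

Lemma bounded_sub_colors : bounded (fun w B e => U w B e - color w).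
Proof. by move=> w B e /bU; apply: leq_trans; exact: leq_subr. Qed.

Lemma compilable_sub_colors : compilable (fun w B e => U w B e - color w).
Proof. by apply: compilableB => //; exact: compilable_colors. Qed.

Lemma compilable_gadget : compilable (fun w B e => gadget (color w) (U w B e)).
Proof. exact: (compilable_div bounded_sub_colors compilable_sub_colors (const 2)). Qed.

Lemma bounded_gadget : bounded (fun w B e => gadget (color w) (U w B e)).
Proof. exact: (@bounded_div _ _ _ bounded_sub_colors). Qed.

Lemma compilable_second : compilableb (fun w B e => second (color w) (U w B e)).
Proof.
apply: compilable_eq; last exact: const.
exact: (compilable_mod bounded_sub_colors compilable_sub_colors (const 2)).
Qed.

Lemma compilable_code1 : compilable (fun w B e => code1 (color w) (option w) (U w B e)).
Proof. exact: (compilable_div bounded_gadget compilable_gadget compilable_codes). Qed.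

Lemma bounded_code1 : bounded (fun w B e => code1 (color w) (option w) (U w B e)).
Proof. exact: (@bounded_div _ _ _ bounded_gadget). Qed.

Lemma compilable_code2 : compilable (fun w B e => code2 (color w) (option w) (U w B e)).
Proof. exact: (compilable_mod bounded_gadget compilable_gadget compilable_codes). Qed.

Lemma bounded_code2 : bounded (fun w B e => code2 (color w) (option w) (U w B e)).
Proof. exact: (@bounded_mod _ _ _ bounded_gadget). Qed.

Lemma compilable_gadget_conflict : compilableb (fun w B e =>
  conflict (color w) (option w) (word_conflict w) (U w B e)).
Proof.
exact: (compilable_conflict bounded_code1 compilable_code1 bounded_code2 compilable_code2).
Qed.

Lemma compilable_is_core : compilableb (fun w B e => U w B e < color w).
Proof. by apply: compilable_lt => //; exact: compilable_colors. Qed.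

Lemma compilable_slot : compilableb (fun w B e =>
  slot (color w) (option w) (word_conflict w) (U w B e)).
Proof.
apply: compilable_or; first exact: compilable_is_core.
apply: compilable_and; last exact: compilable_gadget_conflict.
by apply: compilableN; exact: compilable_second.
Qed.

Lemma compilable_has_option F : compilable F -> compilableb (fun w B e =>
  has_option (color w) (option w) (word_conflict w) (U w B e) (F w B e)).
Proof.
move=> cF; apply: compilable_or; first exact: compilable_is_core.
apply: compilable_and; last exact: compilable_gadget_conflict.
by apply: compilable_eq => //; exact: const.
Qed.

End Vertices.

Lemma compilable_is_parent V P U : bounded V -> compilable V -> compilable P ->
  bounded U -> compilable U -> compilableb (fun w B e =>
  is_parent (word_colors w) (word_options w) (word_conflict w)
    (V w B e) (P w B e) (U w B e)).
Proof.
move=> bV cV cP bU cU.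
have ccode : compilable (fun w B e => V w B e * word_options w + P w B e).
  by apply: compilableD => //; apply: compilableM => //; exact: compilable_options.
have c1 := compilable_code1 bU cU; have c2 := compilable_code2 bU cU.
have conf := compilable_gadget_conflict bU cU.
apply: compilableb_if; first exact: compilable_is_core.
  apply: compilable_and; first by apply: compilable_le => //; exact: compilable_colors.
  apply: compilableb_if; first exact: compilable_second.
    by apply: compilable_and => //; exact: compilable_eq.
  apply: compilable_and; last exact: compilable_eq.
  by apply: compilable_or => //; exact: compilable_eq.
apply: compilableb_if; first exact: compilable_second.
  apply: compilable_or; apply: compilable_eq => //; last exact: compilableS.
  exact: (compilable_div (bounded_code2 bV) (compilable_code2 bV cV) compilable_options).
apply: compilable_or; apply: compilable_eq => //; last exact: compilableS.
exact: (compilable_div (bounded_code1 bV) (compilable_code1 bV cV) compilable_options).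
Qed.

Definition reduce (w : seq bool) : seq bool :=
  bnsl_encode (conflict_instance (word_colors w) (word_options w) (word_conflict w)).

(** A coded sequence begins with its length, so filtered lists are counted before their elements are
    written. *)
Lemma reduceE w : reduce w =
  let K := word_colors w in let M := word_options w in let V := word_verts w in
  let bad := word_conflict w in
  enc_nat (conflict_goal K M bad) ++ enc_nat V ++
  flatten [seq enc_nat (count (has_option K M bad v) (iota 0 M)) ++
    flatten [seq enc_nat (count (is_parent K M bad v p) (iota 0 V)) ++
      flatten [seq enc_nat u | u <- iota 0 V & is_parent K M bad v p u] ++ enc_nat 1
    | p <- iota 0 M & has_option K M bad v p]
  | v <- iota 0 V].
Proof.
rewrite /reduce /bnsl_encode /enc_pair /= /enc_seq size_conflict_table.
congr (_ ++ (_ ++ _)); rewrite /conflict_table -map_comp; congr flatten.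
apply: eq_map => v /=; rewrite /options size_map size_filter; congr (_ ++ _).
rewrite -map_comp; congr flatten; apply: eq_map => p /=.
by rewrite /parent_set size_filter -catA.
Qed.

Lemma emittable_reduce : emittable (fun w _ _ => reduce w).
Proof.
have cV := compilable_verts; have bV := bounded_verts.
have cM := compilable_options; have bM := bounded_options.
have head0 := compilable_head E; have bhead0 := @bounded_head E.
have head1 := compilable_shift head0; have bhead1 := bounded_shift bhead0.
have head2 := compilable_shift head1; have bhead2 := bounded_shift bhead1.
have true_ : compilableb (fun _ _ _ => true) := const 1.
(* [e] lists a candidate parent, an option and a vertex *)
have parent_c : compilableb (fun w B e => is_parent (word_colors w) (word_options w)
    (word_conflict w) (head 0 (behead (behead e))) (head 0 (behead e)) (head 0 e)).
  exact: (compilable_is_parent bhead2 head2 head1 bhead0 head0).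
have option_c : compilableb (fun w B e => has_option (word_colors w) (word_options w)
    (word_conflict w) (head 0 (behead e)) (head 0 e)).
  exact: (compilable_has_option bhead1 head1 head0).
have slot_c : compilableb (fun w B e => slot (word_colors w) (word_options w)
    (word_conflict w) (head 0 e)).
  exact: (compilable_slot bhead0 head0).
have count_bounded (b : seq bool -> nat -> seq nat -> bool) G : bounded G ->
    bounded (fun w B e => count (fun i => b w B (i :: e)) (iota 0 (G w B e))).
  move=> bG w B e /bG; apply: leq_trans.
  by rewrite -[leqRHS](size_iota 0) count_size.
have parents_em := emittable_loop_lt bV cV parent_c (emittable_nat bhead0 head0).
have nparents_em := emittable_nat (count_bounded _ _ bV) (compilable_count bV parent_c cV).
have one_em := emittable_nat (@bounded_le_size E (fun _ _ _ => 1) (fun _ _ _ => isT)) (const 1).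
have option_em := emittable_cat nparents_em (emittable_cat parents_em one_em).
have options_em := emittable_loop_lt bM cM option_c option_em.
have noptions_em := emittable_nat (count_bounded _ _ bM) (compilable_count bM option_c cM).
have verts_em := emittable_loop_lt bV cV true_ (emittable_cat noptions_em options_em).
have goal_em := emittable_nat (count_bounded _ _ bV) (compilable_count bV slot_c cV).
have := emittable_cat goal_em (emittable_cat (emittable_nat bV cV) verts_em).
by apply: emittable_ext => w B e _; rewrite reduceE /= filter_predT.
Qed.

Lemma transducible_reduce : transducible reduce.
Proof. exact: (emittable_transducible emittable_reduce). Qed.

End CompileCertificates.

Definition wcs_to_bnsl d (x : wcs_instance 1 d) : bnsl_instance :=
  let w := wcs_encode x in
  conflict_instance (word_colors d w) (word_options d w) (word_conflict d w).

Lemma wcs_to_bnsl_yes d (x : wcs_instance 1 d) :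
  wcs_yes x <-> bnsl_yes (wcs_to_bnsl x).
Proof.
have [okC weftC depthC] := and3P (wcs_ok x).
rewrite /wcs_to_bnsl wcs_encodeE; set k := wcs_weight x; set C := wcs_circuit x.
set w := enc_nats _.
apply: (iff_trans (B := conflict_free (word_colors d w) (word_options d w)
  (word_conflict d w))); last exact: iff_sym (conflict_instanceP _ _ _).
have sizeC : size C = read_size w by rewrite read_sizeE.
have weightC : k = read_weight w by rewrite read_weightE.
have kdE g : g < read_size w -> read_kind w g = (gate_code (nth Input C g)).1.
  by rewrite -sizeC; exact: read_kindE.
have arE g : g < read_size w -> read_arity w g = size (fanin (nth Input C g)).
  by rewrite -sizeC; exact: read_arityE.
have chE g t : g < read_size w -> t < read_arity w g ->
    read_child w g t = nth 0 (fanin (nth Input C g)) t.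
  by rewrite -sizeC; exact: read_childE.
split=> [[a [wa va]] | /(conflict_free_satisfiable sizeC okC weftC depthC kdE arE chE)].
  apply: (satisfiable_conflict_free sizeC okC weftC depthC kdE arE chE (a := a)) => //.
  by rewrite -weightC.
by rewrite -weightC => -[a [wa va]]; exists a.
Qed.

Lemma wcs_to_bnsl_width d (x : wcs_instance 1 d) :
  superstructure_treecut_width (wcs_to_bnsl x) <=
  (2 ^ ndigits d + 3) * (wcs_weight x).+1 ^ ndigits d.
Proof.
apply: leq_trans (conflict_instance_width _ _ _) _.
have -> : word_colors d (wcs_encode x) = (wcs_weight x).+2 ^ ndigits d.
  by rewrite /word_colors wcs_encodeE read_weightE.
have le2 : (wcs_weight x).+2 ^ ndigits d <= 2 ^ ndigits d * (wcs_weight x).+1 ^ ndigits d.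
  by rewrite -expnMn; apply: expn_homo; lia.
have : 0 < (wcs_weight x).+1 ^ ndigits d by rewrite expn_gt0.
by rewrite mulnDl; lia.
Qed.

(** Each zero ends a number, and ones pay for the numbers: the size of the circuit, in unary, for
    the two header numbers of every gate, and the arities for the lists of in-neighbours. *)
Lemma size_wcs_encode t d (x : wcs_instance t d) :
  size (wcs_encode x) <= 3 * (count id (wcs_encode x)).+1.
Proof.
rewrite wcs_encodeE; set l := circuit_nats _ _.
have cnt s : count id (enc_nats s) = sumn s /\ size (enc_nats s) = sumn s + size s.
  elim: s => // n s [IH1 IH2]; rewrite -[enc_nats _]/(enc_nat n ++ enc_nats s).
  rewrite count_cat size_cat IH1 IH2 size_rcons size_nseq /enc_nat -cats1 count_cat.
  by rewrite count_nseq /=; lia.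
have [-> ->] := cnt l.
suff : size l <= 2 + 2 * sumn l by lia.
rewrite /l /=; set C := wcs_circuit x.
suff : size (flatten (map gate_nats C)) <= 2 * size C + sumn (flatten (map gate_nats C)).
  by lia.
elim: C => // g C IHC; rewrite /= size_cat sumn_cat.
by move: IHC => /=; lia.
Qed.

Theorem theorem4 : W_hard 1 BNSL_treecut.
Proof.
move=> P [d red].
apply: (@fpt_reducible_comp P (WCS 1 d) BNSL_treecut (@wcs_to_bnsl d) (reduce d)
  3 (2 ^ ndigits d + 3) (ndigits d) red (transducible_reduce d)).
- by [].
- exact: wcs_to_bnsl_yes.
- exact: wcs_to_bnsl_width.
- exact: size_wcs_encode.
Qed.
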